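(* For every $z_0>0$ and $0\le\Omega_\Lambda<1$ there is a smooth function $R_0(r)$, of the form $R_0(r)=cr$ with a constant $c>0$, for which, with $E(r)=r^2/2$, $M(r)=r^3/2$ and $R[z]=R_{\Omega_\Lambda}[z]$, the resulting solution $\vec X(z)=(r,t,M)^T$ of the system $$\frac{dr}{dz}=\frac{\mathcal G A R}{\mathcal G E'R-\mathcal F}-\frac{R_z\,(M\mathcal G-R)\sqrt{1+2E}}{R\,(\delta\sigma\sqrt{2E+2M/R}-\sqrt{1+2E})(\mathcal G E'R-\mathcal F)},$$ $$\frac{dt}{dz}=\frac{\delta R_z}{\delta\sigma\sqrt{2E+2M/R}-\sqrt{1+2E}},$$ $$\frac{dM}{dz}=\frac{-\mathcal F R A}{\mathcal G E'R-\mathcal F}-\frac{R_z\,(R^2E'-\mathcal F M)\sqrt{1+2E}}{R\,(\delta\sigma\sqrt{2E+2M/R}-\sqrt{1+2E})(\mathcal G E'R-\mathcal F)}$$ with initial conditions $$\vec X(z_0)=\left(\frac{R[z_0]}{c},\ \sqrt2\,k_c,\ \frac12\left(\frac{R[z_0]}{c}\right)^3\right)^T$$ can be uniquely extended to be of class $C^\omega((0,\infty))$ (real-analytic on $(0,\infty)$). (Here $M(r)=r^3/2$ enters through the initial value $M(z_0)=r(z_0)^3/2$.)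
   Context: For $0\le\Omega_\Lambda\le1$ let $\mathcal I(y)=1/\sqrt{\Omega_\Lambda+(1-\Omega_\Lambda)y^3}$ and $R_{\Omega_\Lambda}[z]=\frac1{1+z}\int_1^{1+z}\mathcal I(y)\,dy$; $R_z=dR[z]/dz$. For $c>0$, $k_c=\sqrt{c+c^2}$. A prime denotes $d/dr$. In the system, $R=R[z]$, $E=E(r(z))$, $E'=E'(r(z))$, $R_0=R_0(r(z))$, $R_0'=R_0'(r(z))$, and $\sigma=\delta=1$ (corresponding to $\partial_tR>0$, $\partial_rR>0$). Set $$B=\frac{\sigma\sqrt{2E+2M/R}}{1+z},\qquad A=B\sqrt{1+2E},$$ $$J(R,R_0,M,E,t)=\sqrt2(t-t_0)-\sigma\int_{R_0}^R\sqrt{\frac{\tau}{\tau E+M}}\,d\tau ,\qquad t_0=\sqrt2\,k_c,$$ and define $\mathcal F,\mathcal G$ by $-(\partial_RJ)\mathcal F=E'\partial_EJ+R_0'\partial_{R_0}J$ and $-(\partial_RJ)\mathcal G=\partial_MJ$. *)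

(* Defs.v *)
From Stdlib Require Import Reals.
From Coquelicot Require Import Coquelicot.
Open Scope R_scope.

(* Signs of the time and radial derivatives of the areal radius: the expanding
   case, before shell crossing. *)
Definition sigma : R := 1.
Definition delta : R := 1.

Definition calI (Om y : R) : R := 1 / sqrt (Om + (1 - Om) * y ^ 3).

(* The areal radius R_{Omega_Lambda}[z] as a function of redshift. *)
Definition areal (Om z : R) : R := / (1 + z) * RInt (calI Om) 1 (1 + z).

Definition kc (c : R) : R := sqrt (c + c ^ 2).

Definition t0 (c : R) : R := sqrt 2 * kc c.

(* In the definitions below [q] is a value of the areal radius and [q0] a value
   of R_0. *)
Definition J (c q q0 M E t : R) : R :=
  sqrt 2 * (t - t0 c)
  - sigma * RInt (fun tau => sqrt (tau / (tau * E + M))) q0 q.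

Definition dJ_dR (c q q0 M E t : R) : R := Derive (fun u => J c u q0 M E t) q.
Definition dJ_dR0 (c q q0 M E t : R) : R := Derive (fun u => J c q u M E t) q0.
Definition dJ_dM (c q q0 M E t : R) : R := Derive (fun u => J c q q0 u E t) M.
Definition dJ_dE (c q q0 M E t : R) : R := Derive (fun u => J c q q0 M u t) E.

Record state : Type := State { sr : R; st : R; sM : R }.

(* calF and calG are the solutions of
     - (dJ/dR) calF = E' dJ/dE + R_0' dJ/dR_0,   - (dJ/dR) calG = dJ/dM;
   on [admissible] states dJ/dR is nonzero. *)
Definition calF (c : R) (E R0 : R -> R) (q : R) (X : state) : R :=
  let r := sr X in
  (Derive E r * dJ_dE c q (R0 r) (sM X) (E r) (st X)
   + Derive R0 r * dJ_dR0 c q (R0 r) (sM X) (E r) (st X))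
  / (- dJ_dR c q (R0 r) (sM X) (E r) (st X)).

Definition calG (c : R) (E R0 : R -> R) (q : R) (X : state) : R :=
  let r := sr X in
  dJ_dM c q (R0 r) (sM X) (E r) (st X)
  / (- dJ_dR c q (R0 r) (sM X) (E r) (st X)).

Definition speed (E : R -> R) (q : R) (X : state) : R :=
  sqrt (2 * E (sr X) + 2 * sM X / q).

Definition lapse (E : R -> R) (X : state) : R := sqrt (1 + 2 * E (sr X)).

Definition coefB (E : R -> R) (q z : R) (X : state) : R :=
  sigma * speed E q X / (1 + z).

Definition coefA (E : R -> R) (q z : R) (X : state) : R :=
  coefB E q z X * lapse E X.

Definition den1 (E : R -> R) (q : R) (X : state) : R :=
  delta * sigma * speed E q X - lapse E X.

Definition den2 (c : R) (E R0 : R -> R) (q : R) (X : state) : R :=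
  calG c E R0 q X * Derive E (sr X) * q - calF c E R0 q X.

Definition rhs_r (Om c : R) (E R0 : R -> R) (z : R) (X : state) : R :=
  let q := areal Om z in
  let qz := Derive (areal Om) z in
  let F := calF c E R0 q X in
  let G := calG c E R0 q X in
  G * coefA E q z X * q / den2 c E R0 q X
  - qz * (sM X * G - q) * lapse E X / (q * den1 E q X * den2 c E R0 q X).

Definition rhs_t (Om : R) (E : R -> R) (z : R) (X : state) : R :=
  delta * Derive (areal Om) z / den1 E (areal Om z) X.

Definition rhs_M (Om c : R) (E R0 : R -> R) (z : R) (X : state) : R :=
  let q := areal Om z in
  let qz := Derive (areal Om) z in
  let F := calF c E R0 q X in
  let G := calG c E R0 q X in
  - F * q * coefA E q z X / den2 c E R0 q X
  - qz * (q ^ 2 * Derive E (sr X) - F * sM X) * lapse E X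
    / (q * den1 E q X * den2 c E R0 q X).

(* The states at which every square root, the integral in J with its partial
   derivatives, and every quotient of the right-hand sides are meaningful.
   [sqrt], [/], [RInt] and [Derive] are total, so this has to be required
   explicitly of a solution. At tau = q the positivity condition gives
   2 E + 2 M / q > 0. *)
Definition admissible (c : R) (E R0 : R -> R) (q : R) (X : state) : Prop :=
  0 < q /\ 0 < R0 (sr X) /\ 0 < 1 + 2 * E (sr X) /\
  (forall tau, Rmin (R0 (sr X)) q <= tau <= Rmax (R0 (sr X)) q ->
     0 < tau * E (sr X) + sM X) /\
  den1 E q X <> 0 /\ den2 c E R0 q X <> 0.

Definition solves_system (Om c : R) (E R0 : R -> R) (a b : Rbar)
    (X : R -> state) : Prop :=
  forall z : R, Rbar_lt a z -> Rbar_lt z b ->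
    admissible c E R0 (areal Om z) (X z) /\
    is_derive (fun y => sr (X y)) z (rhs_r Om c E R0 z (X z)) /\
    is_derive (fun y => st (X y)) z (rhs_t Om E z (X z)) /\
    is_derive (fun y => sM (X y)) z (rhs_M Om c E R0 z (X z)).

Definition solves_ivp (Om c : R) (E R0 : R -> R) (z0 : R) (X0 : state)
    (a b : Rbar) (X : R -> state) : Prop :=
  X z0 = X0 /\ solves_system Om c E R0 a b X.

Definition smooth (f : R -> R) : Prop := forall n x, ex_derive_n f n x.

Definition analytic_at (f : R -> R) (x : R) : Prop :=
  exists (a : nat -> R) (eps : posreal),
    forall y, Rabs (y - x) < eps -> is_pseries a (y - x) (f y).

(* Class C^omega((0, infinity)). *)
Definition analytic_pos (X : R -> state) : Prop :=
  forall z, 0 < z ->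
    analytic_at (fun y => sr (X y)) z /\
    analytic_at (fun y => st (X y)) z /\
    analytic_at (fun y => sM (X y)) z.

(* Main.v *)
Require Import Defs.
From Stdlib Require Import Reals Factorial Lra Lia List Psatz.
From Coquelicot Require Import Coquelicot.
Open Scope R_scope.

(** The system does not see the time: neither [calF] nor [calG] contains [st],
    so it is a planar equation for [(sr, sM)] followed by a quadrature for [st].

    Existence on all of (0, infinity) comes from taking c small.  Put
    rho = c r and m = 2 c^3 M, write q = R[z] and y = 1 + z.  The planar
    equation becomes
      (rho, m)' = sqrt c (sqrt q / y * Phi1 + q' / sqrt q * Phi2),
    where Phi1 and Phi2 depend on (c, q, rho, m) only and, for small c, are
    bounded and Lipschitz uniformly in q near the initial value (q0, q0^3)
    ([scaled_flow], [tame_coefs]).  Both weights are at most a constant times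
    1 / ((1 + z) sqrt z), the derivative of 2 atan (sqrt z), although q tends
    to 0 at both ends ([areal_weights]).  The whole motion is therefore
    O(sqrt c): one Picard iteration over (0, infinity) converges ([picard],
    [scaled_field_contracting]), (rho, m) stays near its initial value and no
    denominator vanishes ([global_solution]).  Physically, c -> 0 is
    the limit in which the term 2 M / R dominates 2 E, and there rho and m are
    constant.

    Analyticity and uniqueness come together.  The two integrals in [calF]
    and [calG] have elementary primitives, so on its domain the right-hand
    side is built from constants, unknowns, sums, products, inverses, square
    roots and logarithms.  For a solution of such a system the Taylor
    coefficients at a point are iterated Lie derivatives, hence functions of
    the value at that point, and they obey a geometric bound
    ([solution_is_pseries]).  So every solution is real-analytic, and two
    solutions that meet at a point agree near it; connectedness of an interval
    makes the agreement global ([interval_connected]).  The last clause of the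
    theorem is the identity theorem ([analytic_identity]). *)

(** * Analyticity of solutions of elementary differential systems *)

(** Side conditions of derivative lemmas are equations in a carrier of the
    algebraic hierarchy; [field] and [ring] need them at type [R]. *)
Ltac req := match goal with |- @eq _ ?a ?b => change (@eq R a b); cbv beta end.

(** Enough operations for the right-hand sides of the system.  The derivative of
    an expression along a vector field whose components are expressions is again
    one, and it involves no new root or logarithm; this keeps the whole tower of
    derivatives polynomial in finitely many functions. *)
Inductive elem : Type :=
| Cst (a : R)
| Var (i : nat)
| Add (e f : elem)
| Mul (e f : elem)
| Inv (e : elem)
| Sqrt (e : elem)
| Ln (e : elem).

Fixpoint ev (v : nat -> R) (e : elem) : R :=
  match e with
  | Cst a => a
  | Var i => v i
  | Add e f => ev v e + ev v f
  | Mul e f => ev v e * ev v f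
  | Inv e => / ev v e
  | Sqrt e => sqrt (ev v e)
  | Ln e => ln (ev v e)
  end.

Fixpoint regular (v : nat -> R) (e : elem) : Prop :=
  match e with
  | Cst _ | Var _ => True
  | Add e f | Mul e f => regular v e /\ regular v f
  | Inv e => regular v e /\ ev v e <> 0
  | Sqrt e | Ln e => regular v e /\ 0 < ev v e
  end.

(** A list of expressions is a vector field on infinitely many unknowns whose
    remaining components vanish. *)
Definition field_at (P : list elem) (i : nat) : elem := nth i P (Cst 0).

Fixpoint lie (P : list elem) (e : elem) : elem :=
  match e with
  | Cst _ => Cst 0
  | Var i => field_at P i
  | Add e f => Add (lie P e) (lie P f)
  | Mul e f => Add (Mul (lie P e) f) (Mul e (lie P f))
  | Inv e => Mul (Cst (-1)) (Mul (Mul (Inv e) (Inv e)) (lie P e))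
  | Sqrt e => Mul (Cst (/ 2)) (Mul (Inv (Sqrt e)) (lie P e))
  | Ln e => Mul (Inv e) (lie P e)
  end.

Definition lie_iter (P : list elem) (n : nat) (e : elem) : elem :=
  Nat.iter n (lie P) e.

(** Normalising by the factorial turns the Leibniz rule into the Cauchy
    product, see [taylor_coef_mul]. *)
Definition taylor_coef (P : list elem) (v : nat -> R) (e : elem) (n : nat) : R :=
  ev v (lie_iter P n e) / INR (fact n).

Definition regular_field (P : list elem) (v : nat -> R) : Prop :=
  forall i, regular v (field_at P i).

Lemma regular_lie P v e :
  regular_field P v -> regular v e -> regular v (lie P e).
Proof.
  intros HP; induction e; simpl; intros He; intuition auto.
  - assert (0 < sqrt (ev v e)) by now apply sqrt_lt_R0. lra.
  - lra.
Qed.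

Lemma regular_lie_iter P v e n :
  regular_field P v -> regular v e -> regular v (lie_iter P n e).
Proof.
  intros HP He; induction n; simpl; auto. now apply regular_lie.
Qed.

Lemma is_derive_ev P (y : nat -> R -> R) z e :
  (forall i, is_derive (y i) z (ev (fun j => y j z) (field_at P i))) ->
  regular (fun j => y j z) e ->
  is_derive (fun x => ev (fun j => y j x) e) z (ev (fun j => y j z) (lie P e)).
Proof.
  intros Hy; induction e; simpl; intros He.
  - apply @is_derive_const.
  - apply Hy.
  - destruct He as [H1 H2]. apply @is_derive_plus; auto.
  - destruct He as [H1 H2].
    apply (is_derive_mult _ _ _ _ _ (IHe1 H1) (IHe2 H2)).
    intros; apply Rmult_comm.
  - destruct He as [H1 H2].
    evar_last; [apply is_derive_inv; [exact (IHe H1) | exact H2] | req; field; exact H2].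
  - destruct He as [H1 H2].
    evar_last; [apply is_derive_sqrt; [exact (IHe H1) | exact H2] |].
    assert (0 < sqrt (ev (fun j => y j z) e)) by now apply sqrt_lt_R0.
    req; field; lra.
  - destruct He as [H1 H2].
    evar_last; [apply (is_derive_comp ln _ _ _ _ (is_derive_ln _ H2) (IHe H1)) |].
    unfold scal; simpl; unfold mult; simpl. req; ring.
Qed.

Lemma taylor_coef_S P v e n :
  INR (S n) * taylor_coef P v e (S n) = taylor_coef P v (lie P e) n.
Proof.
  unfold taylor_coef, lie_iter. rewrite Nat.iter_succ_r, fact_simpl, mult_INR.
  field. split; [apply INR_fact_neq_0 | now apply not_0_INR].
Qed.

Lemma taylor_coef_add P v e f n :
  taylor_coef P v (Add e f) n = taylor_coef P v e n + taylor_coef P v f n.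
Proof.
  unfold taylor_coef.
  assert (H : lie_iter P n (Add e f) = Add (lie_iter P n e) (lie_iter P n f)).
  { unfold lie_iter; induction n; simpl; [reflexivity | now rewrite IHn]. }
  rewrite H; simpl. field. apply INR_fact_neq_0.
Qed.

Lemma taylor_coef_cst P v a n :
  taylor_coef P v (Cst a) n = match n with O => a | S _ => 0 end.
Proof.
  destruct n as [|n].
  - unfold taylor_coef; simpl; field.
  - unfold taylor_coef.
    assert (H : lie_iter P (S n) (Cst a) = Cst 0).
    { unfold lie_iter; induction n; [reflexivity |].
      change (lie P (Nat.iter (S n) (lie P) (Cst a)) = Cst 0). now rewrite IHn. }
    rewrite H; simpl ev. unfold Rdiv; ring.
Qed.

(** Induction on [n] through (n+1) T_(n+1) (e f) = T_n (e' f) + T_n (e f'):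
    the two Cauchy products carry the factors k and n + 1 - k, which add up. *)
Lemma taylor_coef_mul P v e f n :
  taylor_coef P v (Mul e f) n
  = sum_f_R0 (fun k => taylor_coef P v e k * taylor_coef P v f (n - k)) n.
Proof.
  revert e f; induction n as [|n IH]; intros e f.
  - unfold taylor_coef; simpl; field.
  - apply Rmult_eq_reg_l with (INR (S n)); [| now apply not_0_INR].
    rewrite taylor_coef_S; simpl lie; rewrite taylor_coef_add, !IH.
    set (a := taylor_coef P v e); set (b := taylor_coef P v f).
    rewrite (sum_eq _ (fun k => INR (S k) * a (S k) * b (n - k)%nat)) by
      (intros i _; unfold a; rewrite taylor_coef_S; reflexivity).
    rewrite (sum_eq (fun k => a k * taylor_coef P v (lie P f) (n - k))
       (fun k => a k * (INR (S n - k) * b (S n - k)%nat))) by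
      (intros i Hi; rewrite <- taylor_coef_S, Nat.sub_succ_l by easy; reflexivity).
    assert (E1 : sum_f_R0 (fun k => INR (S k) * a (S k) * b (n - k)%nat) n
      = sum_f_R0 (fun k => INR k * (a k * b (S n - k)%nat)) (S n)).
    { rewrite (decomp_sum _ (S n)) by lia. simpl (INR 0). rewrite Rmult_0_l, Rplus_0_l.
      apply sum_eq; intros i Hi; simpl Nat.sub; ring. }
    assert (E2 : sum_f_R0 (fun k => a k * (INR (S n - k) * b (S n - k)%nat)) n
      = sum_f_R0 (fun k => INR (S n - k) * (a k * b (S n - k)%nat)) (S n)).
    { rewrite tech5, Nat.sub_diag. simpl (INR 0). rewrite Rmult_0_l, Rplus_0_r.
      apply sum_eq; intros; ring. }
    rewrite E1, E2, <- sum_plus, scal_sum.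
    apply sum_eq; intros i Hi. rewrite minus_INR by easy. ring.
Qed.

(** The factor 1/(n+1)^2 makes the sequences bounded by a multiple of [weight K]
    an algebra under the Cauchy product; a pure geometric bound would lose a
    factor n + 1 at each product. *)
Definition weight (K : R) (n : nat) : R := K ^ n / INR (S n) ^ 2.

Lemma weight_pos K n : 0 <= K -> 0 <= weight K n.
Proof.
  intros HK; unfold weight. apply Rmult_le_pos; [now apply pow_le |].
  left; apply Rinv_0_lt_compat, pow_lt, lt_0_INR; lia.
Qed.

Lemma sum_inv_sq_le n : sum_f_R0 (fun k => / INR (S k) ^ 2) n <= 2 - / INR (S n).
Proof.
  induction n as [|n IH].
  - simpl; lra.
  - rewrite tech5. apply Rle_trans with (2 - / INR (S n) + / INR (S (S n)) ^ 2); [lra |].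
    rewrite (S_INR (S n)). assert (0 < INR (S n)) by (apply lt_0_INR; lia).
    set (x := INR (S n)) in *.
    assert (/ (x + 1) ^ 2 <= / x - / (x + 1)); [|lra].
    replace (/ x - / (x + 1)) with (/ (x * (x + 1))) by (field; lra).
    apply Rinv_le_contravar; [apply Rmult_lt_0_compat; lra | simpl; nra].
Qed.

Lemma sum_f_R0_rev (f : nat -> R) n : sum_f_R0 (fun k => f (n - k)%nat) n = sum_f_R0 f n.
Proof.
  revert f; induction n as [|n IH]; intros f; [reflexivity |].
  rewrite (decomp_sum _ (S n)) by lia. simpl pred. rewrite tech5, Nat.sub_0_r, <- (IH f).
  rewrite Rplus_comm; f_equal.
Qed.

(** Since (n+2) / ((i+1)(j+1)) = 1/(i+1) + 1/(j+1) for i + j = n, the product of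
    two weights is at most 2/(n+1)^2 times a sum of two terms of the convergent
    series of inverse squares, whose sum is at most 2. *)
Lemma weight_conv K n :
  0 <= K ->
  sum_f_R0 (fun k => weight K k * weight K (n - k)) n <= 8 * weight K n.
Proof.
  intros HK.
  apply Rle_trans with (sum_f_R0
    (fun k => (/ INR (S k) ^ 2 + / INR (S (n - k)) ^ 2) * (2 * weight K n)) n).
  - apply sum_Rle; intros k Hk. rewrite (Rmult_comm (_ + _)). unfold weight.
    assert (Hx : 0 < INR (S k)) by (apply lt_0_INR; lia).
    assert (Hy : 0 < INR (S (n - k))) by (apply lt_0_INR; lia).
    assert (Hn : INR (S n) = INR (S k) + INR (S (n - k)) - 1).
    { rewrite <- plus_INR. rewrite <- (minus_INR _ 1) by lia. f_equal; lia. }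
    assert (H1 : 1 <= INR (S k)) by (apply (le_INR 1); lia).
    assert (H2 : 1 <= INR (S (n - k))) by (apply (le_INR 1); lia).
    replace (K ^ n) with (K ^ k * K ^ (n - k)) by (rewrite <- pow_add; f_equal; lia).
    rewrite Hn. set (x := INR (S k)) in *; set (y := INR (S (n - k))) in *.
    set (A := K ^ k); set (B := K ^ (n - k)).
    assert (0 <= A * B) by (apply Rmult_le_pos; apply pow_le; lra).
    replace (A / x ^ 2 * (B / y ^ 2)) with (A * B * / (x ^ 2 * y ^ 2)) by (field; lra).
    replace (2 * (A * B / (x + y - 1) ^ 2) * (/ x ^ 2 + / y ^ 2))
      with (A * B * (2 * (x ^ 2 + y ^ 2) / (x + y - 1) ^ 2 * / (x ^ 2 * y ^ 2)))
      by (field; lra).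
    apply Rmult_le_compat_l; [easy |].
    rewrite <- (Rmult_1_l (/ (x ^ 2 * y ^ 2))) at 1.
    apply Rmult_le_compat_r.
    { left; apply Rinv_0_lt_compat, Rmult_lt_0_compat; apply pow_lt; lra. }
    apply Rmult_le_reg_r with ((x + y - 1) ^ 2); [apply pow_lt; lra |].
    unfold Rdiv; rewrite Rmult_assoc, Rinv_l by (apply pow_nonzero; lra).
    pose proof (pow2_ge_0 (x - y)). nra.
  - rewrite <- scal_sum. rewrite sum_plus, (sum_f_R0_rev (fun k => / INR (S k) ^ 2)).
    pose proof (sum_inv_sq_le n) as H.
    assert (0 < / INR (S n)) by (apply Rinv_0_lt_compat, lt_0_INR; lia).
    pose proof (weight_pos K n HK). nra.
Qed.

(** Inverses, roots and logarithms are treated as independent variables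
    (atoms), so that every expression is a polynomial over a list of atoms. *)
Fixpoint over (l : list elem) (e : elem) : Prop :=
  match e with
  | Cst _ => True
  | Add e f | Mul e f => over l e /\ over l f
  | _ => In e l
  end.

(** The constant 8 is the one of [weight_conv]. *)
Fixpoint majorant (C : R) (e : elem) : R :=
  match e with
  | Cst a => Rabs a
  | Add e f => majorant C e + majorant C f
  | Mul e f => 8 * (majorant C e * majorant C f)
  | _ => C
  end.

Lemma majorant_pos C e : 0 <= C -> 0 <= majorant C e.
Proof.
  intros HC; induction e; simpl; auto using Rabs_pos; try lra. nra.
Qed.

Lemma taylor_coef_over P v l C K n :
  0 <= C -> 0 <= K ->
  (forall a k, In a l -> (k <= n)%nat -> Rabs (taylor_coef P v a k) <= C * weight K k) ->
  forall e k, over l e -> (k <= n)%nat ->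
    Rabs (taylor_coef P v e k) <= majorant C e * weight K k.
Proof.
  intros HC HK Hl; induction e as [a|i|e1 IH1 e2 IH2|e1 IH1 e2 IH2|e|e|e];
    intros k He Hk; try (now apply Hl).
  - rewrite taylor_coef_cst. simpl majorant.
    destruct k as [|k]; [unfold weight; simpl; lra |].
    rewrite Rabs_R0. apply Rmult_le_pos; [apply Rabs_pos | now apply weight_pos].
  - destruct He as [H1 H2]. rewrite taylor_coef_add.
    eapply Rle_trans; [apply Rabs_triang |]. simpl majorant.
    specialize (IH1 k H1 Hk); specialize (IH2 k H2 Hk); lra.
  - destruct He as [H1 H2]. rewrite taylor_coef_mul.
    eapply Rle_trans; [apply sum_f_R0_triangle |].
    apply Rle_trans with (sum_f_R0 (fun j => weight K j * weight K (k - j)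
       * (majorant C e1 * majorant C e2)) k).
    + apply sum_Rle; intros j Hj. rewrite Rabs_mult.
      replace (weight K j * weight K (k - j) * (majorant C e1 * majorant C e2))
        with ((majorant C e1 * weight K j) * (majorant C e2 * weight K (k - j))) by ring.
      apply Rmult_le_compat; auto using Rabs_pos.
      * apply IH1; auto; lia.
      * apply IH2; auto; lia.
    + rewrite <- scal_sum. simpl majorant.
      pose proof (weight_conv K k HK).
      pose proof (majorant_pos C e1 HC); pose proof (majorant_pos C e2 HC).
      assert (0 <= majorant C e1 * majorant C e2) by now apply Rmult_le_pos.
      nra.
Qed.

(** The method of majorants: (n+1) T_(n+1) a = T_n (a'), and a' is a polynomial
    in atoms already bounded up to order [n].  The gain n + 1 pays for the
    passage from [weight K n] to [weight K (S n)], up to the factor 4 that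
    bounds ((n+2)/(n+1))^2. *)
Lemma taylor_coef_bound P v l C K :
  1 <= C -> 0 <= K ->
  (forall a, In a l -> over l (lie P a)) ->
  (forall a, In a l -> 4 * majorant C (lie P a) <= K) ->
  (forall a, In a l -> Rabs (ev v a) <= C) ->
  forall n a, In a l -> Rabs (taylor_coef P v a n) <= C * weight K n.
Proof.
  intros HC HK Hcl HM H0 n.
  enough (forall k, (k <= n)%nat -> forall a, In a l ->
    Rabs (taylor_coef P v a k) <= C * weight K k) by (intros; auto).
  induction n as [|n IH]; intros k Hk a Ha.
  - replace k with O by lia. unfold taylor_coef, weight; simpl.
    replace (ev v a / 1) with (ev v a) by field.
    specialize (H0 a Ha). lra.
  - destruct (Nat.eq_dec k (S n)) as [->|Hne]; [| apply IH; auto; lia].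
    assert (HL : Rabs (taylor_coef P v (lie P a) n)
              <= majorant C (lie P a) * weight K n).
    { apply taylor_coef_over with l n; auto; lra. }
    rewrite <- taylor_coef_S, Rabs_mult, (Rabs_pos_eq (INR (S n))) in HL by apply pos_INR.
    assert (Hx : 1 <= INR (S n)) by (apply (le_INR 1); lia).
    specialize (HM a Ha). pose proof (majorant_pos C (lie P a) ltac:(lra)) as HN.
    unfold weight in *. rewrite (S_INR (S n)). simpl (K ^ S n).
    set (x := INR (S n)) in *. set (N := majorant C (lie P a)) in *.
    set (t := Rabs _) in *.
    assert (Hp : 0 <= K ^ n) by now apply pow_le.
    set (p := K ^ n) in *.
    assert (Ht : t <= N * p / x ^ 2).
    { apply Rle_trans with (x * t); [assert (0 <= t) by apply Rabs_pos; nra |].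
      unfold Rdiv in *; lra. }
    apply Rle_trans with (1 := Ht).
    apply Rle_trans with (K * p / (x + 1) ^ 2).
    + apply Rle_trans with (4 * N * p / (x + 1) ^ 2).
      * replace (4 * N * p / (x + 1) ^ 2)
          with (N * p / x ^ 2 * (4 * x ^ 2 / (x + 1) ^ 2)) by (field; lra).
        rewrite <- (Rmult_1_r (N * p / x ^ 2)) at 1.
        apply Rmult_le_compat_l.
        { apply Rmult_le_pos; [nra | left; apply Rinv_0_lt_compat, pow_lt; lra]. }
        apply Rmult_le_reg_r with ((x + 1) ^ 2); [apply pow_lt; lra |].
        unfold Rdiv; rewrite Rmult_assoc, Rinv_l by (apply pow_nonzero; lra). nra.
      * apply Rmult_le_compat_r; [left; apply Rinv_0_lt_compat, pow_lt; lra | nra].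
    + rewrite <- (Rmult_1_l (K * p / _)) at 1.
      apply Rmult_le_compat_r; [|lra].
      apply Rmult_le_pos; [nra | left; apply Rinv_0_lt_compat, pow_lt; lra].
Qed.

(** A root and a logarithm bring along the inverse that occurs in their
    derivative; this makes the finite set of atoms of a system closed under
    [lie], see [atoms_lie]. *)
Fixpoint atoms (e : elem) : list elem :=
  match e with
  | Cst _ => nil
  | Var i => Var i :: nil
  | Add e f | Mul e f => atoms e ++ atoms f
  | Inv e => Inv e :: atoms e
  | Sqrt e => Sqrt e :: Inv (Sqrt e) :: atoms e
  | Ln e => Ln e :: Inv e :: atoms e
  end.

Lemma over_atoms l e : incl (atoms e) l -> over l e.
Proof.
  induction e; simpl; intros H; auto using in_eq;
    split; (apply IHe1 || apply IHe2);
    intros x Hx; apply H, in_or_app; auto.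
Qed.

Lemma atoms_atom e a : In a (atoms e) -> incl (atoms a) (atoms e).
Proof.
  induction e; simpl; intros H.
  - easy.
  - destruct H as [<-|[]]. simpl; apply incl_refl.
  - apply in_app_or in H as [H|H]; [apply incl_appl | apply incl_appr]; auto.
  - apply in_app_or in H as [H|H]; [apply incl_appl | apply incl_appr]; auto.
  - destruct H as [<-|H]; [apply incl_refl | apply incl_tl; auto].
  - destruct H as [<-|[<-|H]].
    + apply incl_refl.
    + simpl. intros x Hx; simpl in *; tauto.
    + apply incl_tl, incl_tl; auto.
  - destruct H as [<-|[<-|H]].
    + apply incl_refl.
    + simpl. intros x Hx; simpl in *; tauto.
    + apply incl_tl, incl_tl; auto.
Qed.

Lemma atoms_lie P l e :
  incl (flat_map atoms P) l -> incl (atoms e) l -> incl (atoms (lie P e)) l.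
Proof.
  intros HP; induction e; simpl; intros He.
  - easy.
  - intros x Hx. unfold field_at in Hx.
    destruct (Nat.lt_ge_cases i (length P)) as [Hi|Hi].
    + apply HP, in_flat_map. exists (nth i P (Cst 0)). split; [now apply nth_In | easy].
    + rewrite nth_overflow in Hx by easy. easy.
  - apply incl_app_inv in He as [H1 H2]. apply incl_app; auto.
  - apply incl_app_inv in He as [H1 H2]. repeat apply incl_app; auto.
  - apply incl_cons_inv in He as [H1 H2].
    assert (incl (atoms (lie P e)) l) by auto.
    repeat (apply incl_app || apply incl_cons); auto.
  - apply incl_cons_inv in He as [H1 H2]. apply incl_cons_inv in H2 as [H2 H3].
    assert (incl (atoms (lie P e)) l) by auto.
    repeat (apply incl_app || apply incl_cons); auto.
  - apply incl_cons_inv in He as [H1 H2]. apply incl_cons_inv in H2 as [H2 H3].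
    assert (incl (atoms (lie P e)) l) by auto.
    repeat (apply incl_app || apply incl_cons); auto.
Qed.

Lemma regular_atoms v e : regular v e -> forall a, In a (atoms e) -> regular v a.
Proof.
  induction e; simpl; intros He b Ha.
  - easy.
  - now destruct Ha as [<-|[]].
  - apply in_app_or in Ha as [H|H]; [apply IHe1 | apply IHe2]; tauto.
  - apply in_app_or in Ha as [H|H]; [apply IHe1 | apply IHe2]; tauto.
  - destruct Ha as [<-|H]; [easy | apply IHe; tauto].
  - destruct Ha as [<-|[<-|H]]; [easy | | apply IHe; tauto].
    simpl; split; [easy |]. apply Rgt_not_eq, sqrt_lt_R0; tauto.
  - destruct Ha as [<-|[<-|H]]; [easy | | apply IHe; tauto].
    simpl; split; [easy |]. apply Rgt_not_eq; tauto.
Qed.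

Lemma locally_Rabs (z : R) (Q : R -> Prop) :
  locally z Q <-> exists eps, 0 < eps /\ forall u, Rabs (u - z) < eps -> Q u.
Proof.
  split.
  - intros [eps H]. exists eps; split; [apply cond_pos | exact H].
  - intros [eps [H0 H]]. exists (mkposreal eps H0). exact H.
Qed.

Lemma list_upper_bound (A : Type) (f : A -> R) (l : list A) :
  exists K, 1 <= K /\ forall a, In a l -> f a <= K.
Proof.
  induction l as [|a l [K [HK IH]]].
  - exists 1; split; [lra | easy].
  - exists (Rmax (f a) K). split.
    + apply Rle_trans with (1 := HK), Rmax_r.
    + intros b [<-|Hb]; [apply Rmax_l | apply Rle_trans with (1 := IH b Hb), Rmax_r].
Qed.

Lemma locally_forall_list (A : Type) (Q : A -> R -> Prop) z (l : list A) :
  (forall a, In a l -> locally z (Q a)) ->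
  locally z (fun x => forall a, In a l -> Q a x).
Proof.
  induction l as [|a l IH]; intros H.
  - apply filter_forall; easy.
  - assert (H1 := H a (in_eq _ _)).
    assert (H2 := IH (fun b Hb => H b (in_cons _ _ _ Hb))).
    generalize (filter_and _ _ H1 H2). apply filter_imp.
    intros x [Ha Hl] b [<-|Hb]; auto.
Qed.

(** The Lagrange form of the remainder on the right of the centre is transported to
    the left by the reflection u -> -u. *)
Lemma taylor_lagrange_sym (f : R -> R) (z0 x M : R) (n : nat) :
  (forall t, Rabs (t - z0) <= Rabs (x - z0) ->
     locally t (fun u => forall k, ex_derive_n f k u)) ->
  (forall t, Rabs (t - z0) <= Rabs (x - z0) -> Rabs (Derive_n f (S n) t) <= M) ->
  Rabs (f x - sum_f_R0 (fun k => (x - z0) ^ k / INR (fact k) * Derive_n f k z0) n)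
  <= Rabs (x - z0) ^ S n / INR (fact (S n)) * M.
Proof.
  intros Hd HM.
  assert (HM0 : 0 <= M).
  { eapply Rle_trans; [apply Rabs_pos | apply (HM z0)].
    unfold Rminus at 1; rewrite Rplus_opp_r, Rabs_R0; apply Rabs_pos. }
  assert (Hex : forall t, Rabs (t - z0) <= Rabs (x - z0) -> forall k, ex_derive_n f k t).
  { intros t Ht; exact (locally_singleton _ _ (Hd t Ht)). }
  assert (Hf : 0 < INR (fact (S n))) by apply INR_fact_lt_0.
  destruct (Rtotal_order z0 x) as [Hlt|[->|Hgt]].
  - assert (Hin : forall t, z0 <= t <= x -> Rabs (t - z0) <= Rabs (x - z0)).
    { intros t Ht; rewrite !Rabs_pos_eq; lra. }
    destruct (Taylor_Lagrange f n z0 x Hlt) as [u [Hu ->]].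
    { intros; apply Hex; auto. }
    match goal with |- Rabs (?a + ?b - ?a) <= _ => replace (a + b - a) with b by ring end.
    rewrite Rabs_mult. apply Rmult_le_compat; auto using Rabs_pos.
    + rewrite Rabs_div by lra. rewrite RPow_abs, (Rabs_pos_eq (INR _)); lra.
    + apply HM, Hin; lra.
  - replace (f x - _) with 0; [rewrite Rabs_R0 |].
    + apply Rmult_le_pos; auto. apply Rmult_le_pos; [apply pow_le, Rabs_pos |].
      left; now apply Rinv_0_lt_compat.
    + clear - f. induction n as [|n IH].
      * simpl; field.
      * rewrite tech5. transitivity (f x - (f x + 0)); [ring |]. f_equal. f_equal; [lra |].
        rewrite Rminus_diag. simpl pow. unfold Rdiv. ring.
  - assert (Hin : forall t, x <= t <= z0 -> Rabs (t - z0) <= Rabs (x - z0)).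
    { intros t Ht; rewrite !Rabs_left1; lra. }
    assert (Hg : forall t, - z0 <= t <= - x -> forall k,
      Derive_n (fun u => f (- u)) k t = (-1) ^ k * Derive_n f k (- t)).
    { intros t Ht k. apply Derive_n_comp_opp.
      generalize (Hd (- t) (Hin (- t) ltac:(lra))). apply filter_imp. auto. }
    destruct (Taylor_Lagrange (fun u => f (- u)) n (- z0) (- x)) as [u [Hu Heq]]; [lra | |].
    { intros t Ht k _. apply ex_derive_n_comp_opp.
      generalize (Hd (- t) (Hin (- t) ltac:(lra))). apply filter_imp. auto. }
    rewrite Ropp_involutive in Heq. rewrite Heq, (Hg u) by lra.
    assert (Hs : sum_f_R0 (fun m => (- x - - z0) ^ m / INR (fact m)
        * Derive_n (fun u => f (- u)) m (- z0)) n
      = sum_f_R0 (fun k => (x - z0) ^ k / INR (fact k) * Derive_n f k z0) n).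
    { apply sum_eq; intros k _. rewrite (Hg (- z0)), Ropp_involutive by lra.
      replace (- x - - z0) with ((-1) * (x - z0)) by ring. rewrite Rpow_mult_distr.
      assert (H1 : (-1) ^ k * (-1) ^ k = 1).
      { rewrite <- Rpow_mult_distr. replace (-1 * -1) with 1 by ring. apply pow1. }
      unfold Rdiv.
      transitivity (((-1) ^ k * (-1) ^ k) * ((x - z0) ^ k * / INR (fact k) * Derive_n f k z0));
        [ring | rewrite H1; ring]. }
    rewrite Hs.
    match goal with |- Rabs (?a + ?b - ?a) <= _ => replace (a + b - a) with b by ring end.
    rewrite !Rabs_mult. apply Rmult_le_compat; auto using Rabs_pos.
    + apply Rmult_le_pos; apply Rabs_pos.
    + rewrite Rabs_div by lra. rewrite (Rabs_pos_eq (INR _)) by lra.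
      rewrite <- RPow_abs. replace (- x - - z0) with (- (x - z0)) by ring.
      rewrite Rabs_Ropp. lra.
    + rewrite pow_1_abs, Rmult_1_l. apply HM, Hin; lra.
Qed.

(** With |f^(n)| <= n! C K^n near the centre the remainder is at most
    C (K |x - z0|)^(n+1), which tends to 0 once |x - z0| < 1/(2K). *)
Lemma is_pseries_of_derive_bound (f : R -> R) (a : nat -> R -> R) (z0 C K eps : R) :
  0 < eps -> 1 <= K -> 0 <= C ->
  (forall z, Rabs (z - z0) < eps -> f z = a O z) ->
  (forall n z, Rabs (z - z0) < eps -> is_derive (a n) z (a (S n) z)) ->
  (forall n z, Rabs (z - z0) < eps -> Rabs (a n z) <= INR (fact n) * (C * K ^ n)) ->
  forall x, Rabs (x - z0) < Rmin eps (/ (2 * K)) ->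
    is_pseries (fun n => a n z0 / INR (fact n)) (x - z0) (f x).
Proof.
  intros He HK HC Hf Ha Hb x Hx.
  assert (Hx1 : Rabs (x - z0) < eps) by (eapply Rlt_le_trans; [exact Hx | apply Rmin_l]).
  assert (Hx2 : Rabs (x - z0) < / (2 * K)) by (eapply Rlt_le_trans; [exact Hx | apply Rmin_r]).
  assert (Hopen : forall t, Rabs (t - z0) < eps -> locally t (fun u => Rabs (u - z0) < eps)).
  { intros t Ht. apply locally_Rabs. exists (eps - Rabs (t - z0)). split; [lra |].
    intros u Hu.
    replace (u - z0) with ((u - t) + (t - z0)) by ring.
    eapply Rle_lt_trans; [apply Rabs_triang | lra]. }
  assert (HD : forall n t, Rabs (t - z0) < eps -> is_derive_n f n t (a n t)).
  { induction n as [|n IH]; intros t Ht; [now apply Hf |].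
    simpl. apply is_derive_ext_loc with (a n); [| now apply Ha].
    generalize (Hopen t Ht). apply filter_imp. intros u Hu. symmetry.
    now apply is_derive_n_unique, IH. }
  apply is_pseries_Reals. intros e Hep.
  assert (Hrem : forall n,
    Rabs (f x - sum_f_R0 (fun k => (x - z0) ^ k / INR (fact k) * Derive_n f k z0) n)
      <= C * (/ 2) ^ S n).
  { intros n. eapply Rle_trans.
    - apply (taylor_lagrange_sym f z0 x (INR (fact (S n)) * (C * K ^ S n)) n).
      + intros t Ht. generalize (Hopen t (Rle_lt_trans _ _ _ Ht Hx1)). apply filter_imp.
        intros u Hu [|k]; [exact I |]. eexists. exact (HD (S k) u Hu).
      + intros t Ht. rewrite (is_derive_n_unique f (S n) t (a (S n) t)).
        * apply Hb. lra.
        * apply HD; lra.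
    - assert (Hfa : 0 < INR (fact (S n))) by apply INR_fact_lt_0.
      replace (Rabs (x - z0) ^ S n / INR (fact (S n)) * (INR (fact (S n)) * (C * K ^ S n)))
        with (C * (Rabs (x - z0) * K) ^ S n) by (rewrite Rpow_mult_distr; field; lra).
      apply Rmult_le_compat_l; auto. apply pow_incr. split.
      + apply Rmult_le_pos; [apply Rabs_pos | lra].
      + apply Rle_trans with (/ (2 * K) * K); [apply Rmult_le_compat_r; lra |].
        right; field; lra. }
  destruct (pow_lt_1_zero (/ 2) ltac:(rewrite Rabs_pos_eq; lra) (e / (C + 1))) as [N HN].
  { apply Rdiv_lt_0_compat; lra. }
  exists N. intros n Hn. unfold R_dist. rewrite Rabs_minus_sym.
  replace (sum_f_R0 _ n)
    with (sum_f_R0 (fun k => (x - z0) ^ k / INR (fact k) * Derive_n f k z0) n).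
  - apply Rle_lt_trans with (1 := Hrem n).
    assert (HS : Rabs ((/ 2) ^ S n) < e / (C + 1)) by (apply HN; lia).
    rewrite Rabs_pos_eq in HS by (apply pow_le; lra).
    assert (0 <= (/ 2) ^ S n) by (apply pow_le; lra).
    apply Rle_lt_trans with ((C + 1) * (/ 2) ^ S n); [nra |].
    apply Rmult_lt_compat_l with (r := C + 1) in HS; [|lra].
    replace ((C + 1) * (e / (C + 1))) with e in HS by (field; lra). exact HS.
  - apply sum_eq; intros k _.
    rewrite (is_derive_n_unique f k z0 (a k z0)).
    + unfold Rdiv; ring.
    + apply HD. rewrite Rminus_diag, Rabs_R0; exact He.
Qed.

(** The coefficients depend on the solution only through its value at [z0]: this
    single statement is both the analyticity of solutions and their local
    uniqueness.  The majorant is applied at every point near [z0], with a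
    common bound on the finitely many atoms, which are continuous there. *)
Theorem solution_is_pseries (P : list elem) (y : nat -> R -> R) (e : elem) (z0 : R) :
  locally z0 (fun z =>
    (forall i, is_derive (y i) z (ev (fun j => y j z) (field_at P i))) /\
    regular_field P (fun j => y j z) /\ regular (fun j => y j z) e) ->
  locally z0 (fun z =>
    is_pseries (taylor_coef P (fun j => y j z0) e) (z - z0) (ev (fun j => y j z) e)).
Proof.
  intros H. pose (val z a := ev (fun j => y j z) a).
  set (l := atoms e ++ flat_map atoms P).
  assert (Hlie : forall a, In a l -> over l (lie P a)).
  { intros a Ha. apply over_atoms, atoms_lie.
    - apply incl_appr, incl_refl.
    - apply in_app_or in Ha as [Ha|Ha].
      + apply incl_appl. now apply atoms_atom.
      + apply incl_appr. apply in_flat_map in Ha as [b [Hb Ha]].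
        intros c Hc. apply in_flat_map. exists b; split; [easy |].
        now apply (atoms_atom b a Ha). }
  assert (He : over l e) by (apply over_atoms, incl_appl, incl_refl).
  assert (Hreg : forall v, regular_field P v -> regular v e -> forall a, In a l -> regular v a).
  { intros v HP Hv a Ha. apply in_app_or in Ha as [Ha|Ha].
    - now apply regular_atoms with e.
    - apply in_flat_map in Ha as [b [Hb Ha]]. apply regular_atoms with b; [|easy].
      destruct (In_nth _ _ (Cst 0) Hb) as [i [_ <-]]. apply HP. }
  destruct (list_upper_bound elem (fun a => Rabs (val z0 a) + 1) l) as [C [HC HCl]].
  destruct (list_upper_bound elem (fun a => 4 * majorant C (lie P a)) l) as [K [HK HKl]].
  assert (Hbd : locally z0 (fun z => forall a, In a l -> Rabs (val z a) <= C)).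
  { apply (locally_forall_list elem (fun a z => Rabs (val z a) <= C)). intros a Ha.
    assert (Hc : continuous (fun z => val z a) z0).
    { apply @ex_derive_continuous. eexists.
      destruct (locally_singleton _ _ H) as [H1 [H2 H3]].
      apply (is_derive_ev P y z0 a H1). now apply Hreg. }
    specialize (HCl a Ha).
    assert (Hn : locally (val z0 a) (fun u => Rabs u <= C)).
    { apply locally_Rabs. exists 1. split; [lra |]. intros u Hu.
      replace u with ((u - val z0 a) + val z0 a) by ring.
      eapply Rle_trans; [apply Rabs_triang | lra]. }
    exact (Hc _ Hn). }
  destruct (proj1 (locally_Rabs z0 _) (filter_and _ _ H Hbd)) as [eps [Hep Heps]].
  pose (M := majorant C e). assert (HM : 0 <= M) by (apply majorant_pos; lra).
  assert (Hp : 0 < Rmin eps (/ (2 * K))).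
  { apply Rmin_glb_lt; [easy | apply Rinv_0_lt_compat; lra]. }
  apply locally_Rabs. exists (Rmin eps (/ (2 * K))); split; [exact Hp |]. intros x Hx.
  apply (is_pseries_of_derive_bound (fun z => val z e)
    (fun n z => val z (lie_iter P n e)) z0 M K eps); auto.
  - intros n z Hz. destruct (Heps z Hz) as [[H1 [H2 H3]] _].
    apply (is_derive_ev P y z (lie_iter P n e) H1). now apply regular_lie_iter.
  - intros n z Hz. destruct (Heps z Hz) as [[H1 [H2 H3]] H4].
    assert (Hf : 0 < INR (fact n)) by apply INR_fact_lt_0.
    assert (Ht : Rabs (taylor_coef P (fun j => y j z) e n) <= M * weight K n).
    { apply taylor_coef_over with l n; auto; try lra.
      intros a k Ha _. apply (taylor_coef_bound P _ l C K); auto; lra. }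
    unfold taylor_coef in Ht. rewrite Rabs_div in Ht by lra.
    rewrite (Rabs_pos_eq (INR _)) in Ht by lra.
    apply Rmult_le_compat_l with (r := INR (fact n)) in Ht; [|lra].
    unfold val. replace (INR (fact n) * (Rabs (ev (fun j => y j z) (lie_iter P n e)) / INR (fact n)))
      with (Rabs (ev (fun j => y j z) (lie_iter P n e))) in Ht by (field; lra).
    apply Rle_trans with (1 := Ht). apply Rmult_le_compat_l; [lra |].
    apply Rmult_le_compat_l; [easy |]. unfold weight.
    rewrite <- (Rmult_1_r (K ^ n)) at 2. apply Rmult_le_compat_l; [apply pow_le; lra |].
    rewrite <- Rinv_1. apply Rinv_le_contravar; [lra |].
    apply pow_R1_Rle. apply (le_INR 1); lia.
Qed.

(** * Picard iteration with an integrable weight *)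

Definition is_open_interval (I : R -> Prop) : Prop :=
  (forall z, I z -> locally z I) /\
  (forall x y z, I x -> I y -> x <= z <= y -> I z).

(** Boundedness and the Lipschitz condition hold with a time-dependent weight
    whose integral from the initial time never exceeds 1/2.  No local step is
    needed then: the Picard operator contracts on the whole, possibly
    unbounded, interval. *)
Record contracting (V : CompleteNormedModule R_AbsRing) (I : R -> Prop) (g : R -> R)
    (z0 : R) (x0 : V) (rad : R) (f : R -> V -> V) : Prop := {
  ctr_interval : is_open_interval I;
  ctr_start : I z0;
  ctr_rad : 0 < rad;
  ctr_weight : forall z, I z -> continuous g z /\ 0 <= g z /\ Rabs (RInt g z0 z) <= / 2;
  ctr_bound : forall z x, I z -> norm (minus x x0) <= rad -> norm (f z x) <= rad * g z;
  ctr_lip : forall z x y, I z -> norm (minus x x0) <= rad -> norm (minus y x0) <= rad ->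
    norm (minus (f z x) (f z y)) <= norm (minus x y) * g z;
  ctr_cont : forall z x, I z -> norm (minus x x0) <= rad -> continuous (fun s => f s x) z
}.

Arguments contracting {V}.
Arguments ctr_interval {V I g z0 x0 rad f}.
Arguments ctr_start {V I g z0 x0 rad f}.
Arguments ctr_rad {V I g z0 x0 rad f}.
Arguments ctr_weight {V I g z0 x0 rad f}.
Arguments ctr_bound {V I g z0 x0 rad f}.
Arguments ctr_lip {V I g z0 x0 rad f}.
Arguments ctr_cont {V I g z0 x0 rad f}.

Lemma continuous_norm_iff (V : CompleteNormedModule R_AbsRing) (h : R -> V) z :
  continuous h z <->
  forall eps, 0 < eps -> locally z (fun u => norm (minus (h u) (h z)) < eps).
Proof.
  unfold continuous. rewrite (filterlim_locally_ball_norm h (h z)). split.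
  - intros H eps He. exact (H (mkposreal eps He)).
  - intros H eps. apply H, cond_pos.
Qed.

Lemma norm_minus_triangle (V : CompleteNormedModule R_AbsRing) (a b c : V) :
  norm (minus a c) <= norm (minus a b) + norm (minus b c).
Proof. rewrite (minus_trans b a c). apply (@norm_triangle R_AbsRing V). Qed.

Lemma norm_minus_sym (V : CompleteNormedModule R_AbsRing) (a b : V) :
  norm (minus a b) = norm (minus b a).
Proof. rewrite <- opp_minus. apply (@norm_opp R_AbsRing V). Qed.

Lemma norm_minus_diag (V : CompleteNormedModule R_AbsRing) (a : V) : norm (minus a a) = 0.
Proof. rewrite minus_eq_zero. apply (@norm_zero R_AbsRing V). Qed.

Lemma interval_segment I x y z :
  is_open_interval I -> I x -> I y -> Rmin x y <= z <= Rmax x y -> I z.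
Proof.
  intros [_ H] Hx Hy. destruct (Rle_dec x y) as [Hxy|Hxy].
  - rewrite Rmin_left, Rmax_right by lra. now apply H.
  - rewrite Rmin_right, Rmax_left by lra. now apply H.
Qed.

Lemma interval_ex_RInt (V : CompleteNormedModule R_AbsRing) I (h : R -> V) x y :
  is_open_interval I -> I x -> I y -> (forall z, I z -> continuous h z) -> ex_RInt h x y.
Proof.
  intros HI Hx Hy Hh. apply @ex_RInt_continuous. intros z Hz.
  now apply Hh, (interval_segment I x y z).
Qed.

(** The absolute value on the right covers both orientations of the segment. *)
Lemma norm_RInt_weight (V : CompleteNormedModule R_AbsRing) I (h : R -> V) (g : R -> R) C x y :
  is_open_interval I -> I x -> I y ->
  (forall z, I z -> continuous h z) -> (forall z, I z -> continuous g z) ->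
  (forall z, I z -> norm (h z) <= C * g z) ->
  norm (RInt h x y) <= Rabs (C * RInt g x y).
Proof.
  intros HI Hx Hy Hh Hg Hb.
  assert (main : forall a b, I a -> I b -> a <= b ->
    norm (RInt h a b) <= C * RInt g a b).
  { intros a b Ha Hb' Hab.
    apply (norm_RInt_le h (fun z => C * g z) a b); auto.
    - intros z Hz. apply Hb. now apply (proj2 HI a b z).
    - apply (@RInt_correct V). now apply (interval_ex_RInt V I).
    - apply (is_RInt_scal g a b C (RInt g a b)).
      apply (@RInt_correct R_CompleteNormedModule).
      now apply (interval_ex_RInt R_CompleteNormedModule I). }
  destruct (Rle_dec x y) as [Hxy|Hxy].
  - eapply Rle_trans; [apply main; auto | apply Rle_abs].
  - rewrite <- opp_RInt_swap by (now apply (interval_ex_RInt V I)).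
    eapply Rle_trans; [right; apply (@norm_opp R_AbsRing V) |].
    eapply Rle_trans; [apply (main y x); auto; lra |].
    rewrite <- (opp_RInt_swap (V := R_CompleteNormedModule) g y x)
      by (now apply (interval_ex_RInt R_CompleteNormedModule I)).
    unfold opp; simpl. rewrite Ropp_mult_distr_r_reverse, Rabs_Ropp. apply Rle_abs.
Qed.

(** Separate continuity in time and the Lipschitz condition in space, whose
    constant is locally bounded, give continuity along a curve. *)
Lemma contracting_cont (V : CompleteNormedModule R_AbsRing) I g z0 (x0 : V) rad f (X : R -> V) :
  contracting I g z0 x0 rad f ->
  (forall z, I z -> continuous X z) ->
  (forall z, I z -> norm (minus (X z) x0) <= rad) ->
  forall z, I z -> continuous (fun s => f s (X s)) z.
Proof.
  intros Hf HX HB z Hz. apply continuous_norm_iff. intros eps He.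
  destruct (ctr_weight Hf z Hz) as [Hg [Hg0 _]].
  assert (H1 := proj1 (continuous_norm_iff _ _ _) (ctr_cont Hf z (X z) Hz (HB z Hz))
    (eps / 2) ltac:(lra)).
  assert (Hp : 0 < eps / (2 * (g z + 1))) by (apply Rdiv_lt_0_compat; lra).
  assert (H2 := proj1 (continuous_norm_iff _ _ _) (HX z Hz) _ Hp).
  assert (H3 := proj1 (continuous_norm_iff R_CompleteNormedModule g z) Hg 1 Rlt_0_1).
  assert (H4 := proj1 (ctr_interval Hf) z Hz).
  generalize (filter_and _ _ (filter_and _ _ H1 H2) (filter_and _ _ H3 H4)).
  apply filter_imp. intros u [[K1 K2] [K3 K4]].
  apply Rle_lt_trans with (1 := norm_minus_triangle _ _ (f u (X z)) _).
  apply Rlt_le_trans with (eps / 2 + eps / 2); [|lra].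
  apply Rplus_le_lt_compat; [|exact K1].
  apply Rle_trans with (1 := ctr_lip Hf u _ _ K4 (HB u K4) (HB z Hz)).
  assert (Hgu : g u <= g z + 1).
  { unfold norm, minus, plus, opp in K3; simpl in K3; unfold abs in K3; simpl in K3.
    apply Rabs_def2 in K3; lra. }
  apply Rle_trans with (eps / (2 * (g z + 1)) * (g z + 1)).
  - apply Rmult_le_compat; [apply @norm_ge_0 | apply (ctr_weight Hf u K4) | lra | lra].
  - right; field; lra.
Qed.

Definition picard_step (V : CompleteNormedModule R_AbsRing) (f : R -> V -> V) (z0 : R) (x0 : V)
    (X : R -> V) (z : R) : V :=
  plus x0 (RInt (fun s => f s (X s)) z0 z).

Definition picard_iter (V : CompleteNormedModule R_AbsRing) (f : R -> V -> V) (z0 : R) (x0 : V)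
    (n : nat) : R -> V :=
  Nat.iter n (picard_step V f z0 x0) (fun _ => x0).

Definition stays_near (V : CompleteNormedModule R_AbsRing) (I : R -> Prop) (x0 : V) (rad : R)
    (X : R -> V) : Prop :=
  forall z, I z -> continuous X z /\ norm (minus (X z) x0) <= rad.

Lemma picard_step_derive (V : CompleteNormedModule R_AbsRing) I g z0 (x0 : V) rad f (X : R -> V) :
  contracting I g z0 x0 rad f -> stays_near V I x0 rad X ->
  forall z, I z -> is_derive (picard_step V f z0 x0 X) z (f z (X z)).
Proof.
  intros Hf HX z Hz.
  assert (Hc := contracting_cont V I g z0 x0 rad f X Hf
    (fun z Hz => proj1 (HX z Hz)) (fun z Hz => proj2 (HX z Hz))).
  unfold picard_step.
  rewrite <- (plus_zero_l (f z (X z))).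
  apply @is_derive_plus; [apply @is_derive_const |].
  apply (is_derive_RInt (fun s => f s (X s)) _ z0); [| now apply Hc].
  generalize (proj1 (ctr_interval Hf) z Hz). apply filter_imp. intros u Hu.
  apply (@RInt_correct V). apply (interval_ex_RInt V I); auto.
  - apply (ctr_interval Hf).
  - apply (ctr_start Hf).
Qed.

Lemma minus_plus_cancel (G : AbelianGroup) (a b : G) : minus (plus a b) a = b.
Proof. unfold minus. rewrite (plus_comm a b), <- plus_assoc.
  etransitivity; [apply f_equal, (plus_opp_r a) | apply plus_zero_r].
Qed.

Lemma minus_plus_l (G : AbelianGroup) (a b c : G) :
  minus (plus a b) (plus a c) = minus b c.
Proof.
  unfold minus. rewrite opp_plus, (plus_comm a b), <- plus_assoc, (plus_assoc a).
  apply f_equal. etransitivity; [| apply plus_zero_l].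
  apply (f_equal (fun u => plus u (opp c))), (plus_opp_r a).
Qed.

(** A step maps the ball of radius [rad] into the ball of half that radius; the
    margin lets the uniform limit of the iterates stay in the large ball. *)
Lemma picard_step_near (V : CompleteNormedModule R_AbsRing) I g z0 (x0 : V) rad f (X : R -> V) :
  contracting I g z0 x0 rad f -> stays_near V I x0 rad X ->
  stays_near V I x0 (rad / 2) (picard_step V f z0 x0 X).
Proof.
  intros Hf HX z Hz. split.
  - apply @ex_derive_continuous. eexists. now apply (picard_step_derive V I g z0 x0 rad f X).
  - unfold picard_step. rewrite minus_plus_cancel.
    pose proof (ctr_rad Hf) as Hr.
    eapply Rle_trans.
    + apply (norm_RInt_weight V I _ g rad); auto.
      * apply (ctr_interval Hf).
      * apply (ctr_start Hf).
      * intros s Hs. apply (contracting_cont V I g z0 x0 rad f X Hf); auto; apply HX.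
      * intros s Hs; apply (ctr_weight Hf s Hs).
      * intros s Hs. apply (ctr_bound Hf); auto. now apply HX.
    + rewrite Rabs_mult, (Rabs_pos_eq rad) by lra.
      destruct (ctr_weight Hf z Hz) as [_ [_ H]]. nra.
Qed.

Lemma stays_near_le (V : CompleteNormedModule R_AbsRing) I (x0 : V) r1 r2 (X : R -> V) :
  r1 <= r2 -> stays_near V I x0 r1 X -> stays_near V I x0 r2 X.
Proof. intros Hr H z Hz. destruct (H z Hz). split; auto; lra. Qed.

Lemma picard_step_contract (V : CompleteNormedModule R_AbsRing) I g z0 (x0 : V) rad f (X Y : R -> V) C :
  contracting I g z0 x0 rad f -> stays_near V I x0 rad X -> stays_near V I x0 rad Y ->
  0 <= C -> (forall z, I z -> norm (minus (X z) (Y z)) <= C) ->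
  forall z, I z ->
    norm (minus (picard_step V f z0 x0 X z) (picard_step V f z0 x0 Y z)) <= C / 2.
Proof.
  intros Hf HX HY HC HXY z Hz. unfold picard_step. rewrite minus_plus_l.
  assert (HcX : forall s, I s -> continuous (fun s => f s (X s)) s).
  { apply (contracting_cont V I g z0 x0 rad f X Hf); apply HX. }
  assert (HcY : forall s, I s -> continuous (fun s => f s (Y s)) s).
  { apply (contracting_cont V I g z0 x0 rad f Y Hf); apply HY. }
  pose proof (ctr_interval Hf) as HI. pose proof (ctr_start Hf) as H0.
  rewrite <- RInt_minus by (now apply (interval_ex_RInt V I)).
  eapply Rle_trans.
  - apply (norm_RInt_weight V I _ g C); auto.
    + intros s Hs. apply @continuous_minus; auto.
    + intros s Hs; apply (ctr_weight Hf s Hs).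
    + intros s Hs. eapply Rle_trans.
      * apply (ctr_lip Hf); auto; [now apply HX | now apply HY].
      * apply Rmult_le_compat_r; [apply (ctr_weight Hf s Hs) | auto].
  - rewrite Rabs_mult, (Rabs_pos_eq C) by lra.
    destruct (ctr_weight Hf z Hz) as [_ [_ H]]. nra.
Qed.

Lemma half_pow_small C eps : 0 < eps -> exists N, forall n, (N <= n)%nat -> C * (/ 2) ^ n < eps.
Proof.
  intros He.
  destruct (pow_lt_1_zero (/ 2) ltac:(rewrite Rabs_pos_eq; lra) (eps / (Rabs C + 1))) as [N HN].
  { apply Rdiv_lt_0_compat; [lra | pose proof (Rabs_pos C); lra]. }
  exists N. intros n Hn. specialize (HN n ltac:(lia)).
  assert (0 <= (/ 2) ^ n) by (apply pow_le; lra).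
  rewrite Rabs_pos_eq in HN by lra. pose proof (Rabs_pos C). pose proof (Rle_abs C).
  apply Rle_lt_trans with ((Rabs C + 1) * (/ 2) ^ n); [nra |].
  apply Rmult_lt_compat_l with (r := Rabs C + 1) in HN; [|lra].
  replace ((Rabs C + 1) * (eps / (Rabs C + 1))) with eps in HN by (field; lra). lra.
Qed.

(** Consecutive iterates differ by at most rad / 2^n at all times of the interval
    simultaneously. *)
Theorem picard (V : CompleteNormedModule R_AbsRing) I g z0 (x0 : V) rad f :
  contracting I g z0 x0 rad f ->
  exists X : R -> V, X z0 = x0 /\
    forall z, I z -> norm (minus (X z) x0) <= rad /\ is_derive X z (f z (X z)).
Proof.
  intros Hf. pose proof (ctr_rad Hf) as Hr.
  pose (Xn := picard_iter V f z0 x0).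
  assert (Hnear : forall n, stays_near V I x0 (rad / 2) (Xn n)).
  { induction n as [|n IH].
    - intros z _. split; [apply @continuous_const |].
      unfold Xn; simpl. rewrite norm_minus_diag. lra.
    - apply (picard_step_near V I g z0 x0 rad f (Xn n) Hf).
      apply stays_near_le with (rad / 2); auto; lra. }
  assert (Hnear' : forall n, stays_near V I x0 rad (Xn n)).
  { intros n. apply stays_near_le with (rad / 2); auto; lra. }
  assert (Hstep : forall n z, I z -> norm (minus (Xn (S n) z) (Xn n z)) <= rad * (/ 2) ^ n).
  { induction n as [|n IH]; intros z Hz.
    - destruct (Hnear' 1%nat z Hz) as [_ H]. rewrite Rmult_1_r. exact H.
    - replace (rad * (/ 2) ^ S n) with (rad * (/ 2) ^ n / 2) by (simpl; field).
      apply (picard_step_contract V I g z0 x0 rad f (Xn (S n)) (Xn n)); auto.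
      apply Rmult_le_pos; [lra | apply pow_le; lra]. }
  assert (Hcauchy : forall n k z, I z ->
    norm (minus (Xn (n + k)%nat z) (Xn n z)) <= 2 * rad * (/ 2) ^ n).
  { intros n k z Hz.
    enough (norm (minus (Xn (n + k)%nat z) (Xn n z))
       <= 2 * rad * (/ 2) ^ n - 2 * rad * (/ 2) ^ (n + k)).
    { assert (0 <= (/ 2) ^ (n + k)) by (apply pow_le; lra). nra. }
    induction k as [|k IH].
    - rewrite Nat.add_0_r, norm_minus_diag. lra.
    - eapply Rle_trans; [apply (norm_minus_triangle _ _ (Xn (n + k)%nat z)) |].
      specialize (Hstep (n + k)%nat z Hz). rewrite Nat.add_succ_r. simpl pow. lra. }
  pose (X z := lim (filtermap (fun n => Xn n z) eventually) : V).
  assert (Hlim : forall n z, I z -> norm (minus (X z) (Xn n z)) <= 2 * rad * (/ 2) ^ n).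
  { intros n z Hz. apply Rnot_lt_le; intros Hlt.
    set (gap := norm (minus (X z) (Xn n z)) - 2 * rad * (/ 2) ^ n).
    assert (Hg : 0 < gap) by (unfold gap; lra).
    pose proof (@norm_factor_gt_0 _ V) as Hnf.
    assert (Hg2 : 0 < gap / @norm_factor _ V) by (apply Rdiv_lt_0_compat; lra).
    assert (Hc : filtermap (fun n => Xn n z) eventually (ball (X z) (mkposreal _ Hg2))).
    { apply (@complete_cauchy V).
      - apply filtermap_proper_filter, eventually_filter.
      - intros eps. destruct (half_pow_small (2 * rad) eps (cond_pos eps)) as [N HN].
        exists (Xn N z), N. intros m Hm. apply (@norm_compat1 R_AbsRing V).
        replace m with (N + (m - N))%nat by lia.
        eapply Rle_lt_trans; [now apply Hcauchy | now apply HN]. }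
    destruct Hc as [N HN]. specialize (HN (n + N)%nat ltac:(lia)).
    apply (@norm_compat2 R_AbsRing V) in HN.
    assert (HN' : norm (minus (Xn (n + N)%nat z) (X z)) < gap).
    { eapply Rlt_le_trans; [exact HN | right; simpl; field; lra]. }
    pose proof (norm_minus_triangle _ (X z) (Xn (n + N)%nat z) (Xn n z)) as Ht.
    rewrite (norm_minus_sym _ (X z) (Xn (n + N)%nat z)) in Ht.
    specialize (Hcauchy n N z Hz). unfold gap in *. lra. }
  assert (HX : stays_near V I x0 rad X).
  { intros z Hz. split.
    - apply continuous_norm_iff. intros eps He.
      destruct (half_pow_small (2 * rad) (eps / 3) ltac:(lra)) as [N HN].
      specialize (HN N (le_n N)).
      assert (H1 := proj1 (continuous_norm_iff _ _ _) (proj1 (Hnear N z Hz)) (eps / 3) ltac:(lra)).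
      generalize (filter_and _ _ H1 (proj1 (ctr_interval Hf) z Hz)). apply filter_imp.
      intros u [Hu1 Hu2].
      pose proof (norm_minus_triangle _ (X u) (Xn N u) (X z)).
      pose proof (norm_minus_triangle _ (Xn N u) (Xn N z) (X z)).
      pose proof (Hlim N u Hu2). pose proof (Hlim N z Hz).
      rewrite (norm_minus_sym _ (Xn N z) (X z)) in *. lra.
    - pose proof (norm_minus_triangle _ (X z) (Xn 2%nat z) x0).
      pose proof (Hlim 2%nat z Hz) as H2. destruct (Hnear 2%nat z Hz). simpl pow in H2. lra. }
  assert (Hfix : forall z, I z -> X z = picard_step V f z0 x0 X z).
  { intros z Hz. apply (@eq_close R_AbsRing V). intros eps. apply (@norm_compat1 R_AbsRing V). rewrite norm_minus_sym.
    destruct (half_pow_small (2 * rad) eps (cond_pos eps)) as [N HN].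
    specialize (HN N (le_n N)).
    eapply Rle_lt_trans; [| exact HN].
    eapply Rle_trans; [apply (norm_minus_triangle _ _ (Xn (S N) z)) |].
    apply Rle_trans with (2 * rad * (/ 2) ^ S N + 2 * rad * (/ 2) ^ N / 2);
      [| simpl pow; lra].
    apply Rplus_le_compat; [now apply Hlim |].
    apply (picard_step_contract V I g z0 x0 rad f (Xn N) X); auto.
    - apply Rmult_le_pos; [lra | apply pow_le; lra].
    - intros s Hs. rewrite norm_minus_sym. now apply Hlim. }
  exists X. split.
  - rewrite (Hfix z0 (ctr_start Hf)). unfold picard_step. rewrite RInt_point. apply plus_zero_r.
  - intros z Hz. split; [now apply HX |].
    apply is_derive_ext_loc with (picard_step V f z0 x0 X).
    + generalize (proj1 (ctr_interval Hf) z Hz). apply filter_imp.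
      intros u Hu. symmetry; now apply Hfix.
    + now apply (picard_step_derive V I g z0 x0 rad f X).
Qed.

(** * Uniformly bounded and Lipschitz functions of a small parameter *)

Definition plane_lim (F : (R * R -> Prop) -> Prop) : R * R :=
  (lim (filtermap fst F), lim (filtermap snd F)).

Lemma plane_lim_cauchy (F : (R * R -> Prop) -> Prop) :
  ProperFilter F -> @cauchy (prod_UniformSpace R_UniformSpace R_UniformSpace) F ->
  forall eps : posreal,
    F (@ball (prod_UniformSpace R_UniformSpace R_UniformSpace) (plane_lim F) eps).
Proof.
  intros HF HC eps.
  assert (H1 : filtermap fst F (ball (lim (filtermap fst F)) eps)).
  { apply (@complete_cauchy R_CompleteSpace); [now apply filtermap_proper_filter |].
    intros e. destruct (HC e) as [x Hx]. exists (fst x).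
    unfold filtermap. generalize Hx. apply filter_imp. intros y Hy; apply Hy. }
  assert (H2 : filtermap snd F (ball (lim (filtermap snd F)) eps)).
  { apply (@complete_cauchy R_CompleteSpace); [now apply filtermap_proper_filter |].
    intros e. destruct (HC e) as [x Hx]. exists (snd x).
    unfold filtermap. generalize Hx. apply filter_imp. intros y Hy; apply Hy. }
  unfold filtermap in H1, H2.
  generalize (filter_and _ _ H1 H2). apply filter_imp. intros x Hx; exact Hx.
Qed.

Lemma plane_lim_close (F1 F2 : (R * R -> Prop) -> Prop) :
  filter_le F1 F2 -> filter_le F2 F1 ->
  @close (prod_UniformSpace R_UniformSpace R_UniformSpace) (plane_lim F1) (plane_lim F2).
Proof.
  intros H12 H21 eps. split; apply (@close_lim R_CompleteSpace);
    intros Q HQ; (apply H12 || apply H21); exact HQ.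
Qed.

Definition plane : CompleteNormedModule R_AbsRing :=
  CompleteNormedModule.Pack R_AbsRing (R * R)
    (CompleteNormedModule.Class R_AbsRing (R * R)
      (NormedModule.class R_AbsRing (prod_NormedModule R_AbsRing R_NormedModule R_NormedModule))
      (CompleteSpace.Mixin (prod_UniformSpace R_UniformSpace R_UniformSpace)
        plane_lim plane_lim_cauchy plane_lim_close))
    (R * R).

Definition gap (x y : plane) : R := norm (minus x y).

Lemma gap_fst (x y : plane) : Rabs (fst x - fst y) <= gap x y.
Proof.
  destruct x as [x1 x2], y as [y1 y2]. unfold gap.
  eapply Rle_trans; [| apply (@norm_prod R_AbsRing R_NormedModule R_NormedModule)].
  apply Rmax_l.
Qed.

Lemma gap_snd (x y : plane) : Rabs (snd x - snd y) <= gap x y.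
Proof.
  destruct x as [x1 x2], y as [y1 y2]. unfold gap.
  eapply Rle_trans; [| apply (@norm_prod R_AbsRing R_NormedModule R_NormedModule)].
  apply Rmax_r.
Qed.

Lemma gap_pos (x y : plane) : 0 <= gap x y.
Proof. apply @norm_ge_0. Qed.

Definition box (b B : R) (x : plane) : Prop := b <= fst x <= B /\ b <= snd x <= B.

(** The arguments are the parameter c, the areal radius q and a point of the plane.
    Uniformity in q down to 0 is what matters, because q tends to 0 at both ends
    of the time axis; uniformity in c makes the factor sqrt c of the equations
    decisive. *)
Definition tame (b B T : R) (f : R -> R -> plane -> R) : Prop :=
  exists C c0, 0 < C /\ 0 < c0 /\
    forall c q x, 0 < c < c0 -> 0 < q < T -> box b B x ->
      Rabs (f c q x) <= C /\
      (forall y, box b B y -> Rabs (f c q x - f c q y) <= C * gap x y) /\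
      continuous (fun u => f c u x) q.

(** The lower bound that allows a [tame] function to be inverted or put under a
    square root. *)
Definition away (b B T : R) (f : R -> R -> plane -> R) : Prop :=
  exists beta c0, 0 < beta /\ 0 < c0 /\
    forall c q x, 0 < c < c0 -> 0 < q < T -> box b B x -> beta <= f c q x.

Lemma tame_param b B T (h : R -> R -> R) C c0 :
  0 < c0 ->
  (forall c q, 0 < c < c0 -> 0 < q < T -> Rabs (h c q) <= C /\ continuous (h c) q) ->
  tame b B T (fun c q _ => h c q).
Proof.
  intros Hc H. exists (Rmax C 1), c0. split; [|split; auto].
  - apply Rlt_le_trans with 1; [lra | apply Rmax_r].
  - intros c q x Hc' Hq Hx. destruct (H c q Hc' Hq) as [H1 H2].
    split; [|split]; auto.
    + apply Rle_trans with (1 := H1), Rmax_l.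
    + intros y _. rewrite Rminus_diag, Rabs_R0. apply Rmult_le_pos; [| apply gap_pos].
      apply Rle_trans with 1; [lra | apply Rmax_r].
Qed.

Lemma tame_const b B T a : tame b B T (fun _ _ _ => a).
Proof.
  apply (tame_param b B T (fun _ _ => a) (Rabs a) 1); [lra |].
  intros; split; [lra | apply continuous_const].
Qed.

Lemma tame_c b B T : tame b B T (fun c _ _ => c).
Proof.
  apply (tame_param b B T (fun c _ => c) 1 1); [lra |].
  intros c q Hc Hq; split; [rewrite Rabs_pos_eq; lra | apply continuous_const].
Qed.

Lemma tame_sqrt_c b B T : tame b B T (fun c _ _ => sqrt c).
Proof.
  apply (tame_param b B T (fun c _ => sqrt c) 1 1); [lra |].
  intros c q Hc Hq; split; [| apply continuous_const].
  rewrite Rabs_pos_eq by apply sqrt_pos. rewrite <- sqrt_1. apply sqrt_le_1_alt; lra.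
Qed.

Lemma tame_q b B T : tame b B T (fun _ q _ => q).
Proof.
  apply (tame_param b B T (fun _ q => q) T 1); [lra |].
  intros c q Hc Hq; split; [rewrite Rabs_pos_eq; lra | apply continuous_id].
Qed.

Lemma tame_sqrt_q b B T : tame b B T (fun _ q _ => sqrt q).
Proof.
  apply (tame_param b B T (fun _ q => sqrt q) (sqrt T) 1); [lra |].
  intros c q Hc Hq; split; [| apply continuous_sqrt].
  rewrite Rabs_pos_eq by apply sqrt_pos. apply sqrt_le_1_alt; lra.
Qed.

Lemma tame_fst b B T : tame b B T (fun _ _ x => fst x).
Proof.
  exists (Rmax (Rabs b) (Rabs B) + 1), 1.
  assert (H : 0 <= Rmax (Rabs b) (Rabs B)).
  { apply Rle_trans with (Rabs b); [apply Rabs_pos | apply Rmax_l]. }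
  split; [lra | split; [lra |]]. intros c q x _ _ [Hx _]. split; [|split].
  - assert (Rabs (fst x) <= Rmax (Rabs b) (Rabs B)) by now apply RmaxAbs. lra.
  - intros y _. pose proof (gap_fst x y). pose proof (gap_pos x y). nra.
  - apply continuous_const.
Qed.

Lemma tame_snd b B T : tame b B T (fun _ _ x => snd x).
Proof.
  exists (Rmax (Rabs b) (Rabs B) + 1), 1.
  assert (H : 0 <= Rmax (Rabs b) (Rabs B)).
  { apply Rle_trans with (Rabs b); [apply Rabs_pos | apply Rmax_l]. }
  split; [lra | split; [lra |]]. intros c q x _ _ [_ Hx]. split; [|split].
  - assert (Rabs (snd x) <= Rmax (Rabs b) (Rabs B)) by now apply RmaxAbs. lra.
  - intros y _. pose proof (gap_snd x y). pose proof (gap_pos x y). nra.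
  - apply continuous_const.
Qed.

Lemma tame_plus b B T f g :
  tame b B T f -> tame b B T g -> tame b B T (fun c q x => f c q x + g c q x).
Proof.
  intros [C1 [c1 [HC1 [Hc1 H1]]]] [C2 [c2 [HC2 [Hc2 H2]]]].
  exists (C1 + C2), (Rmin c1 c2). split; [lra | split; [now apply Rmin_glb_lt |]].
  intros c q x Hc Hq Hx.
  pose proof (Rmin_l c1 c2); pose proof (Rmin_r c1 c2).
  destruct (H1 c q x ltac:(lra) Hq Hx) as [A1 [L1 K1]].
  destruct (H2 c q x ltac:(lra) Hq Hx) as [A2 [L2 K2]].
  split; [|split].
  - eapply Rle_trans; [apply Rabs_triang | lra].
  - intros y Hy. specialize (L1 y Hy); specialize (L2 y Hy).
    replace (_ - _) with ((f c q x - f c q y) + (g c q x - g c q y)) by ring.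
    eapply Rle_trans; [apply Rabs_triang | lra].
  - apply @continuous_plus; auto.
Qed.

Lemma tame_mult b B T f g :
  tame b B T f -> tame b B T g -> tame b B T (fun c q x => f c q x * g c q x).
Proof.
  intros [C1 [c1 [HC1 [Hc1 H1]]]] [C2 [c2 [HC2 [Hc2 H2]]]].
  exists (2 * (C1 * C2)), (Rmin c1 c2). split; [nra | split; [now apply Rmin_glb_lt |]].
  intros c q x Hc Hq Hx.
  pose proof (Rmin_l c1 c2); pose proof (Rmin_r c1 c2).
  destruct (H1 c q x ltac:(lra) Hq Hx) as [A1 [L1 K1]].
  destruct (H2 c q x ltac:(lra) Hq Hx) as [A2 [L2 K2]].
  split; [|split].
  - rewrite Rabs_mult. pose proof (Rabs_pos (f c q x)); pose proof (Rabs_pos (g c q x)).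
    apply Rle_trans with (C1 * C2); [apply Rmult_le_compat; auto | nra].
  - intros y Hy. specialize (L1 y Hy); specialize (L2 y Hy).
    destruct (H1 c q y ltac:(lra) Hq Hy) as [A1' _].
    replace (_ - _) with ((f c q x - f c q y) * g c q x + f c q y * (g c q x - g c q y)) by ring.
    eapply Rle_trans; [apply Rabs_triang |]. rewrite !Rabs_mult.
    replace (2 * (C1 * C2) * gap x y) with (C1 * gap x y * C2 + C1 * (C2 * gap x y)) by ring.
    apply Rplus_le_compat; apply Rmult_le_compat; auto using Rabs_pos.
  - apply @continuous_mult; auto.
Qed.

Lemma tame_opp b B T f : tame b B T f -> tame b B T (fun c q x => - f c q x).
Proof.
  intros [C1 [c1 [HC1 [Hc1 H1]]]]. exists C1, c1. split; [|split]; auto.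
  intros c q x Hc Hq Hx. destruct (H1 c q x Hc Hq Hx) as [A1 [L1 K1]]. split; [|split].
  - now rewrite Rabs_Ropp.
  - intros y Hy. replace (_ - _) with (- (f c q x - f c q y)) by ring.
    rewrite Rabs_Ropp; auto.
  - apply @continuous_opp; auto.
Qed.

Lemma tame_minus b B T f g :
  tame b B T f -> tame b B T g -> tame b B T (fun c q x => f c q x - g c q x).
Proof. intros; apply tame_plus; auto; now apply tame_opp. Qed.

Lemma tame_inv b B T f :
  tame b B T f -> away b B T f -> tame b B T (fun c q x => / f c q x).
Proof.
  intros [C1 [c1 [HC1 [Hc1 H1]]]] [k [c2 [Hk [Hc2 H2]]]].
  exists (/ k + C1 * / k ^ 2), (Rmin c1 c2).
  assert (Hk1 : 0 < / k) by now apply Rinv_0_lt_compat.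
  assert (Hk2 : 0 < / k ^ 2) by now apply Rinv_0_lt_compat, pow_lt.
  split; [nra | split; [now apply Rmin_glb_lt |]].
  intros c q x Hc Hq Hx.
  pose proof (Rmin_l c1 c2); pose proof (Rmin_r c1 c2).
  destruct (H1 c q x ltac:(lra) Hq Hx) as [A1 [L1 K1]].
  pose proof (H2 c q x ltac:(lra) Hq Hx) as P1. split; [|split].
  - rewrite Rabs_pos_eq by (left; apply Rinv_0_lt_compat; lra).
    assert (/ f c q x <= / k) by (apply Rinv_le_contravar; lra). nra.
  - intros y Hy. specialize (L1 y Hy).
    pose proof (H2 c q y ltac:(lra) Hq Hy) as P2.
    set (u := f c q x) in *; set (v := f c q y) in *.
    replace (/ u - / v) with (- (u - v) * / (u * v)) by (field; lra).
    rewrite Rabs_mult, Rabs_Ropp.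
    rewrite (Rabs_pos_eq (/ _)) by (left; apply Rinv_0_lt_compat; nra).
    assert (/ (u * v) <= / k ^ 2) by (apply Rinv_le_contravar; [apply pow_lt; lra | simpl; nra]).
    assert (0 < / (u * v)) by (apply Rinv_0_lt_compat; nra).
    pose proof (gap_pos x y). pose proof (Rabs_pos (u - v)).
    apply Rle_trans with (C1 * gap x y * / k ^ 2).
    + apply Rmult_le_compat; lra.
    + assert (0 <= / k * gap x y) by nra. nra.
  - apply continuous_Rinv_comp; auto. lra.
Qed.

Lemma tame_sqrt b B T f :
  tame b B T f -> away b B T f -> tame b B T (fun c q x => sqrt (f c q x)).
Proof.
  intros [C1 [c1 [HC1 [Hc1 H1]]]] [k [c2 [Hk [Hc2 H2]]]].
  exists (sqrt C1 + C1 * / sqrt k), (Rmin c1 c2).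
  assert (Hk0 : 0 < sqrt k) by now apply sqrt_lt_R0.
  assert (HC0 : 0 < sqrt C1) by now apply sqrt_lt_R0.
  assert (Hk1 : 0 < / sqrt k) by now apply Rinv_0_lt_compat.
  split; [nra | split; [now apply Rmin_glb_lt |]].
  intros c q x Hc Hq Hx.
  pose proof (Rmin_l c1 c2); pose proof (Rmin_r c1 c2).
  destruct (H1 c q x ltac:(lra) Hq Hx) as [A1 [L1 K1]].
  pose proof (H2 c q x ltac:(lra) Hq Hx) as P1. split; [|split].
  - rewrite Rabs_pos_eq by apply sqrt_pos.
    assert (sqrt (f c q x) <= sqrt C1).
    { apply sqrt_le_1_alt. pose proof (Rle_abs (f c q x)). lra. }
    nra.
  - intros y Hy. specialize (L1 y Hy).
    pose proof (H2 c q y ltac:(lra) Hq Hy) as P2.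
    set (u := f c q x) in *; set (v := f c q y) in *.
    assert (Hu : sqrt k <= sqrt u) by (apply sqrt_le_1_alt; lra).
    pose proof (sqrt_pos v) as Hv.
    assert (Hs : sqrt u - sqrt v = (u - v) * / (sqrt u + sqrt v)).
    { rewrite <- (sqrt_sqrt u) at 2 by lra. rewrite <- (sqrt_sqrt v) at 2 by lra. field; lra. }
    rewrite Hs, Rabs_mult.
    rewrite (Rabs_pos_eq (/ _)) by (left; apply Rinv_0_lt_compat; lra).
    assert (/ (sqrt u + sqrt v) <= / sqrt k) by (apply Rinv_le_contravar; lra).
    assert (0 < / (sqrt u + sqrt v)) by (apply Rinv_0_lt_compat; lra).
    pose proof (gap_pos x y). pose proof (Rabs_pos (u - v)).
    apply Rle_trans with (C1 * gap x y * / sqrt k).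
    + apply Rmult_le_compat; lra.
    + assert (0 <= sqrt C1 * gap x y) by nra. nra.
  - apply continuous_comp; [exact K1 | apply continuous_sqrt].
Qed.

Lemma open_interval_Ioo (lo hi : R) : is_open_interval (fun z : R => lo < z < hi).
Proof.
  split.
  - intros z Hz. apply locally_Rabs. exists (Rmin (z - lo) (hi - z)). split.
    + apply Rmin_glb_lt; lra.
    + intros u Hu. pose proof (Rmin_l (z - lo) (hi - z)); pose proof (Rmin_r (z - lo) (hi - z)).
      apply Rabs_lt_between in Hu. lra.
  - intros; lra.
Qed.

(** The lower limit of integration depends on the point, hence the hypothesis
    [B < T], which keeps the segment of integration inside (0, T). *)
Lemma tame_RInt b B T f :
  0 < b -> B < T ->
  tame b B T f -> tame b B T (fun c q x => RInt (fun u => f c u x) (fst x) q).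
Proof.
  intros Hb HT [C [c0 [HC [Hc0 H]]]].
  destruct (Rle_lt_dec T 0) as [HT0|HT0].
  { exists 1, 1. split; [lra | split; [lra |]]. intros; lra. }
  exists (C * (T + 1)), c0. split; [nra | split; [auto |]].
  intros c q x Hc Hq Hx.
  assert (HI := open_interval_Ioo 0 T).
  assert (Hcont : forall z, box b B z -> forall u, 0 < u < T -> continuous (fun u => f c u z) u).
  { intros z Hz u Hu. now apply (H c u z). }
  assert (Hin : forall z, box b B z -> 0 < fst z < T) by (intros z [Hz _]; lra).
  assert (Hbd : forall (k : R -> R) M y1 y2, 0 < y1 < T -> 0 < y2 < T ->
     (forall u, 0 < u < T -> continuous k u) ->
     (forall u, 0 < u < T -> Rabs (k u) <= M) -> 0 <= M ->
     Rabs (RInt k y1 y2) <= M * Rabs (y2 - y1)).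
  { intros k M y1 y2 H1 H2 Hk HM HM0.
    eapply Rle_trans.
    - apply (norm_RInt_weight R_CompleteNormedModule (fun u => 0 < u < T) k (fun _ => 1) M); auto.
      + intros; apply continuous_const.
      + intros u Hu. rewrite Rmult_1_r. now apply HM.
    - rewrite Rabs_mult, (Rabs_pos_eq M) by auto. rewrite RInt_const.
      unfold scal; simpl; unfold mult; simpl. rewrite Rmult_1_r. lra. }
  assert (Hex : forall z y1 y2, box b B z -> 0 < y1 < T -> 0 < y2 < T ->
     ex_RInt (fun u => f c u z) y1 y2).
  { intros z y1 y2 Hz H1 H2.
    apply (interval_ex_RInt R_CompleteNormedModule (fun u => 0 < u < T)); auto. }
  split; [|split].
  - apply Rle_trans with (C * Rabs (q - fst x)).
    + apply Hbd; auto; [| lra]. intros u Hu. now apply (H c u x).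
    + assert (Rabs (q - fst x) <= T) by (apply Rabs_le; specialize (Hin x Hx); lra). nra.
  - intros y Hy.
    assert (Hsplit : RInt (fun u => f c u x) (fst x) q
      = RInt (fun u => f c u x) (fst x) (fst y) + RInt (fun u => f c u x) (fst y) q).
    { symmetry. apply (RInt_Chasles (fun u => f c u x)); auto. }
    assert (Hdiff : RInt (fun u => f c u x) (fst y) q - RInt (fun u => f c u y) (fst y) q
      = RInt (fun u => f c u x - f c u y) (fst y) q).
    { symmetry. apply (RInt_minus (fun u => f c u x) (fun u => f c u y)); auto. }
    rewrite Hsplit.
    match goal with |- Rabs ?e <= _ => replace e with
      (RInt (fun u => f c u x) (fst x) (fst y) + RInt (fun u => f c u x - f c u y) (fst y) q)
      by (rewrite <- Hdiff; ring) end.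
    eapply Rle_trans; [apply Rabs_triang |].
    pose proof (gap_pos x y) as Hg.
    apply Rle_trans with (C * gap x y + C * gap x y * T); [| nra].
    apply Rplus_le_compat.
    + apply Rle_trans with (C * Rabs (fst y - fst x)).
      * apply Hbd; auto; [| lra]. intros u Hu. now apply (H c u x).
      * apply Rmult_le_compat_l; [lra |]. rewrite Rabs_minus_sym. apply gap_fst.
    + apply Rle_trans with (C * gap x y * Rabs (q - fst y)).
      * apply Hbd; auto; [| | nra].
        -- intros u Hu. apply @continuous_minus; apply Hcont; auto.
        -- intros u Hu. now apply (H c u x).
      * apply Rmult_le_compat_l; [nra |]. apply Rabs_le; specialize (Hin y Hy); lra.
  - apply @ex_derive_continuous. eexists.
    apply (is_derive_RInt (fun u => f c u x) _ (fst x)); [| now apply Hcont].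
    generalize (proj1 HI q Hq). apply filter_imp. intros v Hv.
    apply (@RInt_correct R_CompleteNormedModule). now apply Hex; auto.
Qed.

Lemma away_fst b B T : 0 < b -> away b B T (fun _ _ x => fst x).
Proof. intros Hb. exists b, 1. repeat split; try lra. intros c q x _ _ [H _]; lra. Qed.

Lemma away_snd b B T : 0 < b -> away b B T (fun _ _ x => snd x).
Proof. intros Hb. exists b, 1. repeat split; try lra. intros c q x _ _ [_ H]; lra. Qed.

Lemma away_plus_nonneg b B T f g :
  away b B T f ->
  (forall c q x, 0 < c -> 0 < q -> box b B x -> 0 <= g c q x) ->
  away b B T (fun c q x => f c q x + g c q x).
Proof.
  intros [k [c0 [Hk [Hc0 H]]]] Hg. exists k, c0. repeat split; auto.
  intros c q x Hc Hq Hx. specialize (H c q x Hc Hq Hx).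
  specialize (Hg c q x ltac:(lra) ltac:(lra) Hx). lra.
Qed.

Lemma away_mult b B T f g :
  away b B T f -> away b B T g -> away b B T (fun c q x => f c q x * g c q x).
Proof.
  intros [k1 [c1 [Hk1 [Hc1 H1]]]] [k2 [c2 [Hk2 [Hc2 H2]]]].
  exists (k1 * k2), (Rmin c1 c2). split; [nra | split; [now apply Rmin_glb_lt |]].
  intros c q x Hc Hq Hx.
  pose proof (Rmin_l c1 c2); pose proof (Rmin_r c1 c2).
  apply Rmult_le_compat; try lra; [apply H1 | apply H2]; auto; lra.
Qed.

Lemma away_inv b B T f :
  tame b B T f -> away b B T f -> away b B T (fun c q x => / f c q x).
Proof.
  intros [C1 [c1 [HC1 [Hc1 H1]]]] [k [c2 [Hk [Hc2 H2]]]].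
  exists (/ C1), (Rmin c1 c2).
  split; [now apply Rinv_0_lt_compat | split; [now apply Rmin_glb_lt |]].
  intros c q x Hc Hq Hx.
  pose proof (Rmin_l c1 c2); pose proof (Rmin_r c1 c2).
  specialize (H2 c q x ltac:(lra) Hq Hx). apply Rinv_le_contravar; [lra |].
  destruct (H1 c q x ltac:(lra) Hq Hx) as [A1 _]. pose proof (Rle_abs (f c q x)). lra.
Qed.

Lemma away_sqrt b B T f : away b B T f -> away b B T (fun c q x => sqrt (f c q x)).
Proof.
  intros [k [c2 [Hk [Hc2 H2]]]]. exists (sqrt k), c2.
  split; [now apply sqrt_lt_R0 | split; [auto |]].
  intros c q x Hc Hq Hx. apply sqrt_le_1_alt; auto.
Qed.

(** This is where c has to be small: a term of order sqrt c cannot destroy a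
    lower bound. *)
Lemma away_perturb b B T f g :
  away b B T f -> tame b B T g -> away b B T (fun c q x => f c q x + sqrt c * g c q x).
Proof.
  intros [k [c1 [Hk [Hc1 H1]]]] [C [c2 [HC [Hc2 H2]]]].
  pose (e := k / (2 * C)). assert (He : 0 < e) by (apply Rdiv_lt_0_compat; lra).
  exists (k / 2), (Rmin (e ^ 2) (Rmin c1 c2)). split; [lra | split].
  { repeat apply Rmin_glb_lt; auto. now apply pow_lt. }
  intros c q x Hc Hq Hx.
  pose proof (Rmin_l (e ^ 2) (Rmin c1 c2)); pose proof (Rmin_r (e ^ 2) (Rmin c1 c2)).
  pose proof (Rmin_l c1 c2); pose proof (Rmin_r c1 c2).
  specialize (H1 c q x ltac:(lra) Hq Hx). destruct (H2 c q x ltac:(lra) Hq Hx) as [A2 _].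
  assert (Hs : sqrt c <= e).
  { rewrite <- (sqrt_pow2 e) by lra. apply sqrt_le_1_alt; lra. }
  pose proof (sqrt_pos c).
  assert (Hb : Rabs (sqrt c * g c q x) <= e * C).
  { rewrite Rabs_mult, (Rabs_pos_eq (sqrt c)) by lra.
    apply Rmult_le_compat; auto using Rabs_pos. }
  replace (e * C) with (k / 2) in Hb by (unfold e; field; lra).
  apply Rabs_le_between in Hb. lra.
Qed.

(** * The partial derivatives of J *)

(** Up to the factor -1/2, the derivatives of sqrt (tau / (tau E + M)) with
    respect to M and to E. *)
Definition kernelM (E M tau : R) : R := sqrt tau / ((tau * E + M) * sqrt (tau * E + M)).
Definition kernelE (E M tau : R) : R := tau * kernelM E M tau.

Lemma between_pos (x y t : R) : 0 < x -> 0 < y -> Rmin x y <= t -> 0 < t.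
Proof. intros Hx Hy Ht. apply Rlt_le_trans with (Rmin x y); auto. now apply Rmin_glb_lt. Qed.

Lemma lin_pos E M t : 0 < E -> 0 < M -> 0 < t -> 0 < t * E + M.
Proof. intros. assert (0 < t * E) by now apply Rmult_lt_0_compat. lra. Qed.

(** The affine dependence on the parameter [x] covers the derivative with respect
    to M and the one with respect to E at once. *)
Lemma is_derive_sqrt_quot (e0 e1 m0 m1 v u : R) :
  0 < v -> 0 < v * (e0 + e1 * u) + (m0 + m1 * u) ->
  is_derive (fun x => sqrt (v / (v * (e0 + e1 * x) + (m0 + m1 * x)))) u
    (- / 2 * ((v * e1 + m1) * kernelM (e0 + e1 * u) (m0 + m1 * u) v)).
Proof.
  intros Hv HY. unfold kernelM.
  set (Y := v * (e0 + e1 * u) + (m0 + m1 * u)) in *.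
  assert (HsY : 0 < sqrt Y) by now apply sqrt_lt_R0.
  assert (Hsv : 0 < sqrt v) by now apply sqrt_lt_R0.
  evar_last.
  { apply is_derive_sqrt.
    - auto_derive; [unfold Y in HY; lra | reflexivity].
    - apply Rdiv_lt_0_compat; auto. }
  fold Y. req. rewrite sqrt_div_alt by auto.
  assert (E1 : v = sqrt v * sqrt v) by (rewrite sqrt_sqrt; lra).
  assert (E2 : Y = sqrt Y * sqrt Y) by (rewrite sqrt_sqrt; lra).
  set (a := sqrt v) in *; set (b := sqrt Y) in *.
  fold Y; fold b. rewrite E2, E1. field. split; lra.
Qed.

Lemma continuity_2d_kernelM (e0 e1 m0 m1 u v : R) :
  0 < v -> 0 < v * (e0 + e1 * u) + (m0 + m1 * u) ->
  continuity_2d_pt (fun x t => - / 2 * ((t * e1 + m1) * kernelM (e0 + e1 * x) (m0 + m1 * x) t)) u v.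
Proof.
  intros Hv HY. unfold kernelM, Rdiv.
  assert (Hlin : continuity_2d_pt (fun x t => t * (e0 + e1 * x) + (m0 + m1 * x)) u v).
  { repeat first [apply continuity_2d_pt_plus | apply continuity_2d_pt_mult
      | apply continuity_2d_pt_const | apply continuity_2d_pt_id1 | apply continuity_2d_pt_id2]. }
  assert (HsY := sqrt_lt_R0 _ HY).
  repeat first [apply continuity_2d_pt_plus | apply continuity_2d_pt_mult
      | apply continuity_2d_pt_const | apply continuity_2d_pt_id1 | apply continuity_2d_pt_id2].
  - apply (continuity_1d_2d_pt_comp sqrt (fun _ t => t)).
    + apply continuity_pt_sqrt; lra.
    + apply continuity_2d_pt_id2.
  - apply continuity_2d_pt_inv.
    + apply continuity_2d_pt_mult; [exact Hlin |].
      apply (continuity_1d_2d_pt_comp sqrt (fun x t => t * (e0 + e1 * x) + (m0 + m1 * x)));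
        [apply continuity_pt_sqrt; lra | exact Hlin].
    + apply Rgt_not_eq. now apply Rmult_lt_0_compat.
Qed.

Lemma continuous_sqrt_quot (E M t : R) :
  0 < E -> 0 < M -> 0 < t -> continuous (fun tau => sqrt (tau / (tau * E + M))) t.
Proof.
  intros HE HM Ht. pose proof (lin_pos E M t HE HM Ht).
  apply @ex_derive_continuous. auto_derive. split; [lra |]. split; [| easy].
  now apply Rdiv_lt_0_compat.
Qed.

Lemma ex_RInt_sqrt_quot (E M a b : R) :
  0 < E -> 0 < M -> 0 < a -> 0 < b -> ex_RInt (fun tau => sqrt (tau / (tau * E + M))) a b.
Proof.
  intros HE HM Ha Hb. apply @ex_RInt_continuous. intros t [Ht _].
  apply continuous_sqrt_quot; auto. now apply (between_pos a b).
Qed.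

(** Differentiation under the integral sign; the segment of integration stays away
    from tau = 0, where the integrand is not differentiable. *)
Lemma is_derive_RInt_sqrt_quot (e0 e1 m0 m1 a b u : R) :
  0 < a -> 0 < b ->
  locally u (fun x => 0 < e0 + e1 * x /\ 0 < m0 + m1 * x) ->
  is_derive (fun x => RInt (fun t => sqrt (t / (t * (e0 + e1 * x) + (m0 + m1 * x)))) a b) u
    (- / 2 * RInt (fun t => (t * e1 + m1) * kernelM (e0 + e1 * u) (m0 + m1 * u) t) a b).
Proof.
  intros Ha Hb Hpos.
  assert (Hu := locally_singleton _ _ Hpos).
  assert (Ht : forall t, Rmin a b <= t <= Rmax a b -> 0 < t).
  { intros t [H _]. now apply (between_pos a b). }
  evar_last.
  { apply (is_derive_RInt_param (fun x t => sqrt (t / (t * (e0 + e1 * x) + (m0 + m1 * x))))).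
    - generalize Hpos. apply filter_imp. intros x [H1 H2] t Hab. eexists.
      apply is_derive_sqrt_quot; auto. apply lin_pos; auto.
    - intros t Hab. specialize (Ht t Hab).
      apply continuity_2d_pt_ext_loc with
        (fun x t => - / 2 * ((t * e1 + m1) * kernelM (e0 + e1 * x) (m0 + m1 * x) t)).
      + apply locally_Rabs in Hpos as [d [Hd Hpos]].
        assert (Hm : 0 < Rmin d t) by now apply Rmin_glb_lt.
        exists (mkposreal _ Hm). simpl. intros x s Hx Hs. symmetry. apply is_derive_unique.
        assert (0 < s).
        { pose proof (Rmin_r d t). apply Rabs_lt_between in Hs. lra. }
        apply is_derive_sqrt_quot; auto. pose proof (Rmin_l d t).
        apply lin_pos; auto; apply Hpos; lra.
      + apply continuity_2d_kernelM; auto. apply lin_pos; [apply Hu | apply Hu | exact Ht].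
    - generalize Hpos. apply filter_imp. intros x [H1 H2]. apply ex_RInt_sqrt_quot; auto. }
  symmetry. rewrite <- (RInt_scal (V := R_CompleteNormedModule)).
  - apply RInt_ext. intros t Hab. symmetry. apply is_derive_unique.
    apply is_derive_sqrt_quot; [| apply lin_pos; [apply Hu | apply Hu |]]; apply Ht; lra.
  - apply @ex_RInt_continuous. intros t Hab. specialize (Ht t Hab).
    pose proof (lin_pos _ _ _ (proj1 Hu) (proj2 Hu) Ht) as HY.
    pose proof (sqrt_lt_R0 _ HY).
    apply @ex_derive_continuous. unfold kernelM. auto_derive.
    repeat split; auto. apply Rgt_not_eq. now apply Rmult_lt_0_compat.
Qed.

Lemma dJ_dR_eq c q q0 M E t : 0 < q -> 0 < q0 -> 0 < E -> 0 < M ->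
  dJ_dR c q q0 M E t = - sqrt (q / (q * E + M)).
Proof.
  intros Hq Hq0 HE HM. apply is_derive_unique. unfold J, sigma.
  assert (H : is_derive (fun u => RInt (fun tau => sqrt (tau / (tau * E + M))) q0 u) q
    (sqrt (q / (q * E + M)))).
  { apply (is_derive_RInt (fun tau => sqrt (tau / (tau * E + M))) _ q0).
    - apply locally_Rabs. exists q. split; auto. intros u Hu. apply Rabs_lt_between in Hu.
      apply (@RInt_correct R_CompleteNormedModule). apply ex_RInt_sqrt_quot; auto; lra.
    - now apply continuous_sqrt_quot. }
  evar_last.
  { apply @is_derive_minus; [apply @is_derive_const |].
    apply (is_derive_scal _ _ 1 _ H). }
  unfold minus, plus, opp, zero; simpl. ring.
Qed.

Lemma dJ_dR0_eq c q q0 M E t : 0 < q -> 0 < q0 -> 0 < E -> 0 < M ->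
  dJ_dR0 c q q0 M E t = sqrt (q0 / (q0 * E + M)).
Proof.
  intros Hq Hq0 HE HM. apply is_derive_unique. unfold J, sigma.
  assert (H : is_derive (fun u => RInt (fun tau => sqrt (tau / (tau * E + M))) u q) q0
    (- sqrt (q0 / (q0 * E + M)))).
  { apply (is_derive_RInt' (fun tau => sqrt (tau / (tau * E + M))) _ q0 q).
    - apply locally_Rabs. exists q0. split; auto. intros u Hu. apply Rabs_lt_between in Hu.
      apply (@RInt_correct R_CompleteNormedModule). apply ex_RInt_sqrt_quot; auto; lra.
    - now apply continuous_sqrt_quot. }
  evar_last.
  { apply @is_derive_minus; [apply @is_derive_const |].
    apply (is_derive_scal _ _ 1 _ H). }
  unfold minus, plus, opp, zero; simpl. ring.
Qed.

Lemma dJ_dM_eq c q q0 M E t : 0 < q -> 0 < q0 -> 0 < E -> 0 < M ->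
  dJ_dM c q q0 M E t = / 2 * RInt (kernelM E M) q0 q.
Proof.
  intros Hq Hq0 HE HM. apply is_derive_unique. unfold J, sigma.
  assert (H := is_derive_RInt_sqrt_quot E 0 0 1 q0 q M Hq0 Hq).
  evar_last.
  { apply @is_derive_minus; [apply @is_derive_const |].
    apply (is_derive_scal _ _ 1).
    eapply is_derive_ext; [| apply H].
    - intros x. apply RInt_ext. intros s _. simpl. do 2 f_equal. ring.
    - apply locally_Rabs. exists M. split; auto. intros u Hu. apply Rabs_lt_between in Hu. lra. }
  unfold minus, plus, opp, zero; simpl.
  rewrite (RInt_ext _ (kernelM E M)).
  - ring.
  - intros s _. simpl. rewrite Rmult_0_l, Rplus_0_r, Rmult_0_r, Rplus_0_l, Rmult_1_l, Rmult_1_l, Rplus_0_l. reflexivity.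
Qed.

Lemma dJ_dE_eq c q q0 M E t : 0 < q -> 0 < q0 -> 0 < E -> 0 < M ->
  dJ_dE c q q0 M E t = / 2 * RInt (kernelE E M) q0 q.
Proof.
  intros Hq Hq0 HE HM. apply is_derive_unique. unfold J, sigma.
  assert (H := is_derive_RInt_sqrt_quot 0 1 M 0 q0 q E Hq0 Hq).
  evar_last.
  { apply @is_derive_minus; [apply @is_derive_const |].
    apply (is_derive_scal _ _ 1).
    eapply is_derive_ext; [| apply H].
    - intros x. apply RInt_ext. intros s _. simpl. do 2 f_equal. ring.
    - apply locally_Rabs. exists E. split; auto. intros u Hu. apply Rabs_lt_between in Hu. lra. }
  unfold minus, plus, opp, zero; simpl.
  rewrite (RInt_ext _ (kernelE E M)).
  - ring.
  - intros s _. unfold kernelE. simpl.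
    rewrite Rmult_0_l, !Rplus_0_r, Rplus_0_l, Rmult_1_l, Rmult_1_r. reflexivity.
Qed.

(** The derivative of sqrt (tau / Y), with Y = tau E + M, reduces the kernel to
    1 / sqrt (tau Y), whose primitive is the logarithm. *)
Definition primM (E M tau : R) : R :=
  2 / E * (/ sqrt E * ln (sqrt (tau * E) + sqrt (tau * E + M))
           - sqrt tau / sqrt (tau * E + M)).

(** A primitive of [kernelE E M], obtained from
    tau^(3/2) Y^(-3/2) = (sqrt (tau / Y) - M sqrt tau / Y^(3/2)) / E
    with Y = tau E + M. *)
Definition primE (E M tau : R) : R :=
  / E * (/ E * (sqrt tau * sqrt (tau * E + M)
         - M / sqrt E * ln (sqrt (tau * E) + sqrt (tau * E + M))) - M * primM E M tau).

Lemma is_derive_log_term E M tau : 0 < E -> 0 < M -> 0 < tau ->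
  is_derive (fun t => ln (sqrt (t * E) + sqrt (t * E + M))) tau
    (sqrt E / (2 * sqrt tau * sqrt (tau * E + M))).
Proof.
  intros HE HM Ht. pose proof (lin_pos E M tau HE HM Ht) as HY.
  assert (HtE : 0 < tau * E) by now apply Rmult_lt_0_compat.
  assert (HsE := sqrt_lt_R0 _ HE). assert (Hst := sqrt_lt_R0 _ Ht).
  assert (HsY := sqrt_lt_R0 _ HY). assert (HstE := sqrt_lt_R0 _ HtE).
  auto_derive; [repeat split; auto; lra |].
  rewrite (sqrt_mult tau E) in * by lra.
  assert (E1 : E = sqrt E * sqrt E) by (rewrite sqrt_sqrt; lra).
  set (Y := tau * E + M) in *.
  set (a := sqrt E) in *; set (s := sqrt tau) in *; set (y := sqrt Y) in *.
  rewrite E1. field. repeat split; try lra; nra.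
Qed.

Lemma is_derive_primM E M tau : 0 < E -> 0 < M -> 0 < tau ->
  is_derive (primM E M) tau (kernelM E M tau).
Proof.
  intros HE HM Ht. pose proof (lin_pos E M tau HE HM Ht) as HY.
  assert (HsE := sqrt_lt_R0 _ HE). assert (Hst := sqrt_lt_R0 _ Ht).
  assert (HsY := sqrt_lt_R0 _ HY).
  assert (H1 := is_derive_log_term E M tau HE HM Ht).
  assert (H2 : is_derive (fun t => sqrt t / sqrt (t * E + M)) tau
    (/ (2 * sqrt tau * sqrt (tau * E + M))
      - E * sqrt tau / (2 * (tau * E + M) * sqrt (tau * E + M)))).
  { auto_derive; [repeat split; auto; lra |].
    assert (E2 : tau * E + M = sqrt (tau * E + M) * sqrt (tau * E + M)) by (rewrite sqrt_sqrt; lra).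
    set (s := sqrt tau) in *; set (y := sqrt (tau * E + M)) in *.
    rewrite E2. field. repeat split; lra. }
  unfold primM. evar_last.
  { apply (is_derive_scal (fun t => / sqrt E * ln (sqrt (t * E) + sqrt (t * E + M))
           - sqrt t / sqrt (t * E + M)) tau (2 / E)).
    apply @is_derive_minus; [apply (is_derive_scal _ _ (/ sqrt E) _ H1) | exact H2]. }
  unfold minus, plus, opp, kernelM; simpl. field. repeat split; lra.
Qed.

Lemma is_derive_primE E M tau : 0 < E -> 0 < M -> 0 < tau ->
  is_derive (primE E M) tau (kernelE E M tau).
Proof.
  intros HE HM Ht. pose proof (lin_pos E M tau HE HM Ht) as HY.
  assert (HsE := sqrt_lt_R0 _ HE). assert (Hst := sqrt_lt_R0 _ Ht).
  assert (HsY := sqrt_lt_R0 _ HY).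
  assert (H1 := is_derive_log_term E M tau HE HM Ht).
  assert (H3 := is_derive_primM E M tau HE HM Ht).
  assert (H2 : is_derive (fun t => sqrt t * sqrt (t * E + M)) tau
    (sqrt (tau * E + M) / (2 * sqrt tau) + E * sqrt tau / (2 * sqrt (tau * E + M)))).
  { auto_derive; [repeat split; auto; lra |]. field. repeat split; lra. }
  unfold primE. evar_last.
  { apply (is_derive_scal (fun t => / E * (sqrt t * sqrt (t * E + M)
         - M / sqrt E * ln (sqrt (t * E) + sqrt (t * E + M))) - M * primM E M t) tau (/ E)).
    apply @is_derive_minus; [| apply (is_derive_scal _ _ M _ H3)].
    apply (is_derive_scal (fun t => sqrt t * sqrt (t * E + M)
         - M / sqrt E * ln (sqrt (t * E) + sqrt (t * E + M))) tau (/ E)).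
    apply @is_derive_minus; [exact H2 | apply (is_derive_scal _ _ (M / sqrt E) _ H1)]. }
  unfold minus, plus, opp, kernelE, kernelM; simpl.
  assert (E1 : tau = sqrt tau * sqrt tau) by (rewrite sqrt_sqrt; lra).
  assert (E2 : M = sqrt (tau * E + M) * sqrt (tau * E + M) - sqrt tau * sqrt tau * E).
  { rewrite !sqrt_sqrt; lra. }
  assert (E3 : tau * E + M = sqrt (tau * E + M) * sqrt (tau * E + M)) by (rewrite sqrt_sqrt; lra).
  set (s := sqrt tau) in *; set (y := sqrt (tau * E + M)) in *.
  rewrite E3.
  transitivity (/ E * (/ E * (y / (2 * s) + E * s / (2 * y) - (y * y - s * s * E) / (2 * s * y))
    - (y * y - s * s * E) * (s / (y * y * y)))).
  - rewrite <- E2. field. repeat split; lra.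
  - rewrite E1 at 1. field. repeat split; lra.
Qed.

Lemma RInt_kernelM E M a b : 0 < E -> 0 < M -> 0 < a -> 0 < b ->
  RInt (kernelM E M) a b = primM E M b - primM E M a.
Proof.
  intros HE HM Ha Hb. apply is_RInt_unique. apply (is_RInt_derive (primM E M)).
  - intros t [Ht _]. apply is_derive_primM; auto. now apply (between_pos a b).
  - intros t [Ht _]. assert (H : 0 < t) by now apply (between_pos a b).
    pose proof (lin_pos E M t HE HM H) as HY. pose proof (sqrt_lt_R0 _ HY).
    apply @ex_derive_continuous. unfold kernelM. auto_derive.
    repeat split; auto. apply Rgt_not_eq. now apply Rmult_lt_0_compat.
Qed.

Lemma RInt_kernelE E M a b : 0 < E -> 0 < M -> 0 < a -> 0 < b ->
  RInt (kernelE E M) a b = primE E M b - primE E M a.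
Proof.
  intros HE HM Ha Hb. apply is_RInt_unique. apply (is_RInt_derive (primE E M)).
  - intros t [Ht _]. apply is_derive_primE; auto. now apply (between_pos a b).
  - intros t [Ht _]. assert (H : 0 < t) by now apply (between_pos a b).
    pose proof (lin_pos E M t HE HM H) as HY. pose proof (sqrt_lt_R0 _ HY).
    apply @ex_derive_continuous. unfold kernelE, kernelM. auto_derive.
    repeat split; auto. apply Rgt_not_eq. now apply Rmult_lt_0_compat.
Qed.

(** * The right-hand sides as elementary functions *)

Definition half_sq (r : R) : R := r ^ 2 / 2.

Definition speed_at (q r M : R) : R := sqrt (2 * half_sq r + 2 * M / q).
Definition lapse_at (r : R) : R := sqrt (1 + 2 * half_sq r).
(** The value of - dJ/dR at areal radius [q], and of dJ/dR_0 at radius [c * r]. *)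
Definition root_at (q r M : R) : R := sqrt (q / (q * half_sq r + M)).

Definition slopeG (q r M k1 : R) : R := / 2 * k1 / root_at q r M.
Definition slopeF (c q r M k2 : R) : R :=
  (r * (/ 2 * k2) + c * root_at (c * r) r M) / root_at q r M.
(** Minus the determinant of the two linear equations
      F r' + G M' = - R_z sqrt (1+2E) / (sqrt (2E+2M/R) - sqrt (1+2E)),
      R E' r' + M' = R A - R_z M sqrt (1+2E) / (R (sqrt (2E+2M/R) - sqrt (1+2E)))
    of which the equations for r and M are the solution by Cramer's rule. *)
Definition slope_det (c q r M k1 k2 : R) : R :=
  slopeG q r M k1 * r * q - slopeF c q r M k2.
(** It vanishes at an apparent horizon. *)
Definition horizon (q r M : R) : R := speed_at q r M - lapse_at r.

(** Here [dq] and [y] stand for dR/dz and 1 + z, and [k1], [k2] for the integrals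
    of the two kernels: the integral form serves the estimates, the closed form
    the analyticity. *)
Definition flow_r (c q dq y r M k1 k2 : R) : R :=
  slopeG q r M k1 * (speed_at q r M / y * lapse_at r) * q / slope_det c q r M k1 k2
  - dq * (M * slopeG q r M k1 - q) * lapse_at r
    / (q * horizon q r M * slope_det c q r M k1 k2).

Definition flow_t (q dq r M : R) : R := dq / horizon q r M.

Definition flow_M (c q dq y r M k1 k2 : R) : R :=
  - slopeF c q r M k2 * q * (speed_at q r M / y * lapse_at r) / slope_det c q r M k1 k2
  - dq * (q ^ 2 * r - slopeF c q r M k2 * M) * lapse_at r
    / (q * horizon q r M * slope_det c q r M k1 k2).

Definition kM (c q r M : R) : R := RInt (kernelM (half_sq r) M) (c * r) q.
Definition kE (c q r M : R) : R := RInt (kernelE (half_sq r) M) (c * r) q.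

Lemma half_sq_pos r : 0 < r -> 0 < half_sq r.
Proof. intros Hr. unfold half_sq. assert (0 < r ^ 2) by now apply pow_lt. lra. Qed.

Lemma Derive_half_sq r : Derive half_sq r = r.
Proof. apply is_derive_unique. unfold half_sq. auto_derive; [easy | field]. Qed.

Lemma Derive_scale c R0 r : (forall x, R0 x = c * x) -> Derive R0 r = c.
Proof.
  intros H. rewrite (Derive_ext R0 (fun x => c * x)) by auto.
  apply is_derive_unique. auto_derive; [easy | ring].
Qed.

Lemma calG_eq c R0 q X :
  0 < c -> 0 < q -> 0 < sr X -> 0 < sM X -> (forall x, R0 x = c * x) ->
  calG c half_sq R0 q X = slopeG q (sr X) (sM X) (kM c q (sr X) (sM X)).
Proof.
  intros Hc Hq Hr HM HR. unfold calG, slopeG, kM, root_at.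
  assert (0 < c * sr X) by now apply Rmult_lt_0_compat.
  rewrite HR, dJ_dM_eq, dJ_dR_eq, Ropp_involutive by auto using half_sq_pos. reflexivity.
Qed.

Lemma calF_eq c R0 q X :
  0 < c -> 0 < q -> 0 < sr X -> 0 < sM X -> (forall x, R0 x = c * x) ->
  calF c half_sq R0 q X = slopeF c q (sr X) (sM X) (kE c q (sr X) (sM X)).
Proof.
  intros Hc Hq Hr HM HR. unfold calF, slopeF, kE, root_at.
  assert (0 < c * sr X) by now apply Rmult_lt_0_compat.
  rewrite Derive_half_sq, (Derive_scale c R0), HR, dJ_dE_eq, dJ_dR_eq, dJ_dR0_eq,
    Ropp_involutive by auto using half_sq_pos. reflexivity.
Qed.

Lemma den1_eq q X : den1 half_sq q X = horizon q (sr X) (sM X).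
Proof.
  unfold den1, delta, sigma, horizon, speed, speed_at, lapse, lapse_at.
  now rewrite !Rmult_1_l.
Qed.

Lemma coefA_eq q z X :
  coefA half_sq q z X = speed_at q (sr X) (sM X) / (1 + z) * lapse_at (sr X).
Proof. unfold coefA, coefB, sigma. now rewrite Rmult_1_l. Qed.

Lemma den2_eq c R0 q X :
  0 < c -> 0 < q -> 0 < sr X -> 0 < sM X -> (forall x, R0 x = c * x) ->
  den2 c half_sq R0 q X
  = slope_det c q (sr X) (sM X) (kM c q (sr X) (sM X)) (kE c q (sr X) (sM X)).
Proof.
  intros. unfold den2. now rewrite calG_eq, calF_eq, Derive_half_sq.
Qed.

Lemma rhs_r_eq Om c R0 z X :
  0 < c -> 0 < areal Om z -> 0 < sr X -> 0 < sM X -> (forall x, R0 x = c * x) ->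
  let q := areal Om z in
  rhs_r Om c half_sq R0 z X
  = flow_r c q (Derive (areal Om) z) (1 + z) (sr X) (sM X)
      (kM c q (sr X) (sM X)) (kE c q (sr X) (sM X)).
Proof.
  intros Hc Hq Hr HM HR q. unfold rhs_r. fold q.
  rewrite coefA_eq, calG_eq, den1_eq, den2_eq by auto. reflexivity.
Qed.

Lemma rhs_t_eq Om z X :
  rhs_t Om half_sq z X = flow_t (areal Om z) (Derive (areal Om) z) (sr X) (sM X).
Proof. unfold rhs_t, delta, flow_t. now rewrite den1_eq, Rmult_1_l. Qed.

Lemma rhs_M_eq Om c R0 z X :
  0 < c -> 0 < areal Om z -> 0 < sr X -> 0 < sM X -> (forall x, R0 x = c * x) ->
  let q := areal Om z in
  rhs_M Om c half_sq R0 z X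
  = flow_M c q (Derive (areal Om) z) (1 + z) (sr X) (sM X)
      (kM c q (sr X) (sM X)) (kE c q (sr X) (sM X)).
Proof.
  intros Hc Hq Hr HM HR q. unfold rhs_M. fold q.
  rewrite coefA_eq, calF_eq, den1_eq, den2_eq, Derive_half_sq by auto. reflexivity.
Qed.

(** The combinators mirror the real operations so closely that the values of the
    expressions below reduce to the functions above, up to -1 * x = - x. *)
Definition ePow2 (e : elem) : elem := Mul e (Mul e (Cst 1)).
Definition eDiv (e f : elem) : elem := Mul e (Inv f).
Definition eNeg (e : elem) : elem := Mul (Cst (-1)) e.
Definition eSub (e f : elem) : elem := Add e (eNeg f).

(** The unknowns are, in order, 1 + z, the areal radius, r and M.  Making 1 + z an
    unknown renders the system autonomous; t occurs only as a last component. *)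
Definition eY := Var 0.
Definition eQ := Var 1.
Definition eR := Var 2.
Definition eM := Var 3.

Definition eE : elem := eDiv (ePow2 eR) (Cst 2).
Definition eSpeed : elem := Sqrt (Add (Mul (Cst 2) eE) (eDiv (Mul (Cst 2) eM) eQ)).
Definition eLapse : elem := Sqrt (Add (Cst 1) (Mul (Cst 2) eE)).
Definition eRoot (q : elem) : elem := Sqrt (eDiv q (Add (Mul q eE) eM)).
Definition ePrimLog (tau : elem) : elem :=
  Ln (Add (Sqrt (Mul tau eE)) (Sqrt (Add (Mul tau eE) eM))).
Definition ePrimM (tau : elem) : elem :=
  Mul (eDiv (Cst 2) eE)
    (eSub (Mul (Inv (Sqrt eE)) (ePrimLog tau))
          (eDiv (Sqrt tau) (Sqrt (Add (Mul tau eE) eM)))).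
Definition ePrimE (tau : elem) : elem :=
  Mul (Inv eE)
    (eSub (Mul (Inv eE)
             (eSub (Mul (Sqrt tau) (Sqrt (Add (Mul tau eE) eM)))
                   (Mul (eDiv eM (Sqrt eE)) (ePrimLog tau))))
          (Mul eM (ePrimM tau))).
Definition eKM (c : R) : elem := eSub (ePrimM eQ) (ePrimM (Mul (Cst c) eR)).
Definition eKE (c : R) : elem := eSub (ePrimE eQ) (ePrimE (Mul (Cst c) eR)).
Definition eG (c : R) : elem := eDiv (Mul (Cst (/ 2)) (eKM c)) (eRoot eQ).
Definition eF (c : R) : elem :=
  eDiv (Add (Mul eR (Mul (Cst (/ 2)) (eKE c))) (Mul (Cst c) (eRoot (Mul (Cst c) eR))))
       (eRoot eQ).
Definition eCross (c : R) : elem := eSub (Mul (Mul (eG c) eR) eQ) (eF c).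
Definition eHor : elem := eSub eSpeed eLapse.
Definition eI (Om : R) : elem :=
  eDiv (Cst 1) (Sqrt (Add (Cst Om) (Mul (Cst (1 - Om)) (Mul eY (ePow2 eY))))).
Definition eDQ (Om : R) : elem := eDiv (eSub (eI Om) eQ) eY.
Definition eFlowDen (c : R) : elem := Mul (Mul eQ eHor) (eCross c).
Definition eFlowR (Om c : R) : elem :=
  eSub (eDiv (Mul (Mul (eG c) (Mul (eDiv eSpeed eY) eLapse)) eQ) (eCross c))
       (eDiv (Mul (Mul (eDQ Om) (eSub (Mul eM (eG c)) eQ)) eLapse) (eFlowDen c)).
Definition eFlowT (Om : R) : elem := eDiv (eDQ Om) eHor.
Definition eFlowM (Om c : R) : elem :=
  eSub (eDiv (Mul (Mul (eNeg (eF c)) eQ) (Mul (eDiv eSpeed eY) eLapse)) (eCross c))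
       (eDiv (Mul (Mul (eDQ Om) (eSub (Mul (ePow2 eQ) eR) (Mul (eF c) eM))) eLapse)
             (eFlowDen c)).

Definition ltb_field (Om c : R) : list elem :=
  Cst 1 :: eDQ Om :: eFlowR Om c :: eFlowM Om c :: eFlowT Om :: nil.

Lemma neg1_mult x : -1 * x = - x.
Proof. ring. Qed.

Definition kM_closed (c q r M : R) : R := primM (half_sq r) M q - primM (half_sq r) M (c * r).
Definition kE_closed (c q r M : R) : R := primE (half_sq r) M q - primE (half_sq r) M (c * r).
Definition areal_slope (Om y q : R) : R := (calI Om y - q) / y.

Lemma ev_eKM v c : ev v (eKM c) = kM_closed c (v 1%nat) (v 2%nat) (v 3%nat).
Proof. cbn -[pow]. rewrite !neg1_mult. reflexivity. Qed.
Lemma ev_eKE v c : ev v (eKE c) = kE_closed c (v 1%nat) (v 2%nat) (v 3%nat).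
Proof. cbn -[pow]. rewrite !neg1_mult. reflexivity. Qed.
Lemma ev_eG v c : ev v (eG c) =
  slopeG (v 1%nat) (v 2%nat) (v 3%nat) (kM_closed c (v 1%nat) (v 2%nat) (v 3%nat)).
Proof. rewrite <- ev_eKM. reflexivity. Qed.
Lemma ev_eF v c : ev v (eF c) =
  slopeF c (v 1%nat) (v 2%nat) (v 3%nat) (kE_closed c (v 1%nat) (v 2%nat) (v 3%nat)).
Proof. rewrite <- ev_eKE. reflexivity. Qed.
Lemma ev_eSub v e f : ev v (eSub e f) = ev v e - ev v f.
Proof. cbn. now rewrite neg1_mult. Qed.
Lemma ev_eCross v c : ev v (eCross c) =
  slope_det c (v 1%nat) (v 2%nat) (v 3%nat)
    (kM_closed c (v 1%nat) (v 2%nat) (v 3%nat)) (kE_closed c (v 1%nat) (v 2%nat) (v 3%nat)).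
Proof.
  unfold eCross, slope_det. rewrite ev_eSub. cbn [ev]. now rewrite ev_eG, ev_eF.
Qed.
Lemma ev_eHor v : ev v eHor = horizon (v 1%nat) (v 2%nat) (v 3%nat).
Proof. unfold eHor. rewrite ev_eSub. reflexivity. Qed.
Lemma ev_eDQ v Om : ev v (eDQ Om) = areal_slope Om (v 0%nat) (v 1%nat).
Proof. unfold eDQ, areal_slope. cbn -[pow eSub]. rewrite ev_eSub. reflexivity. Qed.
Lemma ev_eFlowDen v c : ev v (eFlowDen c) =
  v 1%nat * horizon (v 1%nat) (v 2%nat) (v 3%nat) *
  slope_det c (v 1%nat) (v 2%nat) (v 3%nat)
    (kM_closed c (v 1%nat) (v 2%nat) (v 3%nat)) (kE_closed c (v 1%nat) (v 2%nat) (v 3%nat)).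
Proof. unfold eFlowDen. cbn [ev]. now rewrite ev_eHor, ev_eCross. Qed.

Lemma ev_eFlowR v Om c : ev v (eFlowR Om c) =
  flow_r c (v 1%nat) (areal_slope Om (v 0%nat) (v 1%nat)) (v 0%nat) (v 2%nat) (v 3%nat)
    (kM_closed c (v 1%nat) (v 2%nat) (v 3%nat)) (kE_closed c (v 1%nat) (v 2%nat) (v 3%nat)).
Proof.
  unfold eFlowR, flow_r. rewrite ev_eSub.
  cbn [ev eDiv]. rewrite ev_eSub. cbn [ev]. rewrite ev_eG, ev_eCross, ev_eDQ, ev_eFlowDen.
  reflexivity.
Qed.

Lemma ev_eFlowM v Om c : ev v (eFlowM Om c) =
  flow_M c (v 1%nat) (areal_slope Om (v 0%nat) (v 1%nat)) (v 0%nat) (v 2%nat) (v 3%nat)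
    (kM_closed c (v 1%nat) (v 2%nat) (v 3%nat)) (kE_closed c (v 1%nat) (v 2%nat) (v 3%nat)).
Proof.
  unfold eFlowM, flow_M. rewrite ev_eSub.
  cbn [ev eDiv]. rewrite ev_eSub. cbn [ev eNeg]. rewrite neg1_mult, ev_eF, ev_eCross, ev_eDQ, ev_eFlowDen.
  reflexivity.
Qed.

Lemma ev_eFlowT v Om : ev v (eFlowT Om) =
  flow_t (v 1%nat) (areal_slope Om (v 0%nat) (v 1%nat)) (v 2%nat) (v 3%nat).
Proof. unfold eFlowT, flow_t. cbn [ev eDiv]. now rewrite ev_eDQ, ev_eHor. Qed.

Lemma regular_eDiv v e f : regular v e -> regular v f -> ev v f <> 0 -> regular v (eDiv e f).
Proof. cbn; tauto. Qed.
Lemma regular_eSub v e f : regular v e -> regular v f -> regular v (eSub e f).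
Proof. cbn; tauto. Qed.

Lemma root_at_pos q r M : 0 < q -> 0 < r -> 0 < M -> 0 < root_at q r M.
Proof.
  intros. apply sqrt_lt_R0, Rdiv_lt_0_compat; auto. apply lin_pos; auto using half_sq_pos.
Qed.

Definition nondegenerate (Om c : R) (v : nat -> R) : Prop :=
  0 < c /\ 1 <= v 0%nat /\ 0 < v 1%nat /\ 0 < v 2%nat /\ 0 < v 3%nat /\
  horizon (v 1%nat) (v 2%nat) (v 3%nat) <> 0 /\
  slope_det c (v 1%nat) (v 2%nat) (v 3%nat)
    (kM_closed c (v 1%nat) (v 2%nat) (v 3%nat)) (kE_closed c (v 1%nat) (v 2%nat) (v 3%nat)) <> 0.

Lemma hubble_sq_ge_1 Om y : 0 <= Om < 1 -> 1 <= y -> 1 <= Om + (1 - Om) * y ^ 3.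
Proof.
  intros HOm Hy. assert (1 <= y ^ 3) by now apply pow_R1_Rle. nra.
Qed.

Lemma regular_prim v tau : regular v tau -> 0 < ev v tau ->
  0 < v 2%nat -> 0 < v 3%nat -> regular v (ePrimM tau) /\ regular v (ePrimE tau).
Proof.
  intros Hreg Ht Hr HM.
  assert (HE : 0 < ev v eE) by (apply (half_sq_pos _ Hr)).
  assert (HtE : 0 < ev v tau * ev v eE) by now apply Rmult_lt_0_compat.
  assert (HsE := sqrt_lt_R0 _ HE).
  assert (HY : 0 < ev v tau * ev v eE + v 3%nat) by lra.
  assert (HsY := sqrt_lt_R0 _ HY). assert (HsEt := sqrt_lt_R0 _ HtE).
  assert (HrE : regular v eE) by (cbn; repeat split; lra).
  assert (HSY : regular v (Sqrt (Add (Mul tau eE) eM))).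
  { split; [split; [split; assumption | exact I] | exact HY]. }
  assert (HST : regular v (Sqrt (Mul tau eE))).
  { split; [split; assumption | exact HtE]. }
  assert (HSt : regular v (Sqrt tau)) by (split; assumption).
  assert (HSE : regular v (Sqrt eE)) by (split; assumption).
  assert (HL : regular v (ePrimLog tau)).
  { split; [split; [exact HST | exact HSY] |]. exact (Rplus_lt_0_compat _ _ HsEt HsY). }
  assert (HpM : regular v (ePrimM tau)).
  { unfold ePrimM. split; [apply regular_eDiv; auto; [exact I | lra] |].
    apply regular_eSub.
    - split; [split; [exact HSE |] | exact HL]. apply Rgt_not_eq; exact HsE.
    - apply regular_eDiv; [exact HSt | exact HSY |]. apply Rgt_not_eq; exact HsY. }
  split; [exact HpM |].
  assert (HiE : regular v (Inv eE)) by (split; [auto | lra]).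
  unfold ePrimE. split; [exact HiE |]. apply regular_eSub.
  - split; [exact HiE |]. apply regular_eSub.
    + split; [exact HSt | exact HSY].
    + split; [| exact HL]. apply regular_eDiv; [exact I | exact HSE |].
      apply Rgt_not_eq; exact HsE.
  - split; [exact I | exact HpM].
Qed.

Lemma regular_ltb_field Om c v :
  0 <= Om < 1 -> nondegenerate Om c v -> regular_field (ltb_field Om c) v.
Proof.
  intros HOm (Hc & Hy & Hq & Hr & HM & Hh & Hx).
  assert (Hcr : 0 < c * v 2%nat) by now apply Rmult_lt_0_compat.
  assert (HE : 0 < ev v eE) by (apply (half_sq_pos _ Hr)).
  assert (HrE : regular v eE) by (cbn; repeat split; lra).
  assert (HcrE : regular v (Mul (Cst c) eR)) by (cbn; auto).
  assert (HqE : regular v eQ) by exact I.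
  destruct (regular_prim v eQ HqE Hq Hr HM) as [HM1 HE1].
  destruct (regular_prim v (Mul (Cst c) eR) HcrE Hcr Hr HM) as [HM2 HE2].
  assert (Hroot : forall t, regular v t -> 0 < ev v t -> regular v (eRoot t)).
  { intros t Ht Ht0.
    assert (HY : 0 < ev v t * ev v eE + v 3%nat).
    { assert (0 < ev v t * ev v eE) by now apply Rmult_lt_0_compat. lra. }
    split; [apply regular_eDiv; [auto | split; [split; assumption | exact I] |] |].
    - cbn -[eE]; lra.
    - cbn -[eE]. apply Rmult_lt_0_compat; [auto | now apply Rinv_0_lt_compat]. }
  assert (Hrq : ev v (eRoot eQ) <> 0).
  { apply Rgt_not_eq. exact (root_at_pos _ _ _ Hq Hr HM). }
  assert (HG : regular v (eG c)).
  { apply regular_eDiv; auto. split; [exact I | now apply regular_eSub]. }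
  assert (HF : regular v (eF c)).
  { apply regular_eDiv; auto. split.
    - split; [exact I |]. split; [exact I | now apply regular_eSub].
    - split; [exact I | now apply Hroot]. }
  assert (HC : regular v (eCross c)).
  { apply regular_eSub; [| exact HF]. split; [split; [exact HG | exact I] | exact I]. }
  assert (HV : regular v eSpeed).
  { split.
    - split; [split; [exact I | auto] |]. apply regular_eDiv; [split; exact I | exact I |].
      cbn; lra.
    - cbn -[eE]. assert (0 < 2 * v 3%nat * / v 1%nat).
      { apply Rmult_lt_0_compat; [lra | now apply Rinv_0_lt_compat]. }
      lra. }
  assert (HL : regular v eLapse).
  { split; [split; [exact I | split; [exact I | exact HrE]] | cbn -[eE]; lra]. }
  assert (HH : regular v eHor) by now apply regular_eSub.
  assert (HDQ : regular v (eDQ Om)).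
  { pose proof (hubble_sq_ge_1 Om _ HOm Hy) as Hp.
    apply regular_eDiv; [apply regular_eSub; [| exact I] | exact I | cbn; lra].
    apply regular_eDiv; [exact I | |].
    - split; [cbn; tauto |]. cbn -[pow]. change (0 < Om + (1 - Om) * v 0%nat ^ 3). lra.
    - apply Rgt_not_eq. apply sqrt_lt_R0. change (0 < Om + (1 - Om) * v 0%nat ^ 3). lra. }
  assert (HA : regular v (Mul (eDiv eSpeed eY) eLapse)).
  { split; [| auto]. apply regular_eDiv; [auto | exact I | cbn; lra]. }
  assert (HD : regular v (eFlowDen c)) by (split; [split; [exact I | exact HH] | exact HC]).
  assert (HC0 : ev v (eCross c) <> 0) by now rewrite ev_eCross.
  assert (HD0 : ev v (eFlowDen c) <> 0).
  { rewrite ev_eFlowDen. apply Rmult_integral_contrapositive_currified; auto.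
    apply Rmult_integral_contrapositive_currified; auto. lra. }
  intros [|[|[|[|[|i]]]]]; cbn [field_at nth ltb_field].
  - exact I.
  - exact HDQ.
  - apply regular_eSub; apply regular_eDiv; auto.
    + split; [split; auto | exact I].
    + split; [split; [auto |] | auto]. apply regular_eSub; [split; [exact I | auto] | exact I].
  - apply regular_eSub; apply regular_eDiv; auto.
    + split; [split; [split; [exact I | auto] | exact I] | auto].
    + split; [split; [auto |] | auto].
      apply regular_eSub; [cbn; tauto | split; [auto | exact I]].
  - apply regular_eDiv; auto. now rewrite ev_eHor.
  - destruct i; exact I.
Qed.

(** * The areal radius as a function of the redshift *)

Lemma cube_sqrt y : 0 < y -> sqrt (y ^ 3) = y * sqrt y.
Proof.
  intros Hy. replace (y ^ 3) with ((y * y) * y) by ring.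
  rewrite sqrt_mult by nra. now rewrite sqrt_square by lra.
Qed.

Lemma continuous_calI Om y : 0 <= Om < 1 -> 0 < y -> continuous (calI Om) y.
Proof.
  intros HOm Hy. assert (Hp : 0 < Om + (1 - Om) * y ^ 3).
  { assert (0 < y ^ 3) by now apply pow_lt. nra. }
  pose proof (sqrt_lt_R0 _ Hp). apply @ex_derive_continuous. unfold calI. auto_derive.
  split; [exact Hp |]. split; [|easy]. apply Rgt_not_eq; assumption.
Qed.

Lemma ex_RInt_calI Om a b : 0 <= Om < 1 -> 0 < a -> 0 < b -> ex_RInt (calI Om) a b.
Proof.
  intros HOm Ha Hb. apply @ex_RInt_continuous. intros t [Ht _].
  apply continuous_calI; auto. now apply (between_pos a b).
Qed.

Lemma is_derive_areal Om z : 0 <= Om < 1 -> -1 < z ->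
  is_derive (areal Om) z (areal_slope Om (1 + z) (areal Om z)).
Proof.
  intros HOm Hz. unfold areal, areal_slope.
  assert (H : is_derive (fun x => RInt (calI Om) 1 x) (1 + z) (calI Om (1 + z))).
  { apply (is_derive_RInt (calI Om) _ 1).
    - apply locally_Rabs. exists (1 + z). split; [lra |]. intros u Hu. apply Rabs_lt_between in Hu.
      apply (@RInt_correct R_CompleteNormedModule). apply ex_RInt_calI; auto; lra.
    - apply continuous_calI; auto; lra. }
  assert (H1 : is_derive (fun x => RInt (calI Om) 1 (1 + x)) z (calI Om (1 + z))).
  { evar_last.
    - apply (is_derive_comp (fun x => RInt (calI Om) 1 x) (fun x => 1 + x) z _ 1 H).
      auto_derive; [easy | ring].
    - unfold scal; simpl; unfold mult; simpl. ring. }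
  assert (H2 : is_derive (fun x => / (1 + x)) z (- / (1 + z) ^ 2)).
  { auto_derive; [lra | field; lra]. }
  evar_last; [apply (is_derive_mult _ _ _ _ _ H2 H1); intros; apply Rmult_comm |].
  unfold plus, mult; simpl. field. lra.
Qed.

(** From 1 <= Om + (1 - Om) y^3 and (1 - Om) y^3 <= Om + (1 - Om) y^3 <= y^3.  The
    decay like y^(-3/2), which needs [Om < 1], makes the areal radius O(1/z). *)
Lemma calI_bounds Om y : 0 <= Om < 1 -> 1 <= y ->
  / (y * sqrt y) <= calI Om y /\ calI Om y <= 1 /\
  calI Om y <= / sqrt (1 - Om) * / (y * sqrt y).
Proof.
  intros HOm Hy. pose proof (hubble_sq_ge_1 Om y HOm Hy) as Hp. unfold calI.
  assert (H3 : 1 <= y ^ 3) by now apply pow_R1_Rle.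
  assert (Hs : 0 < sqrt (Om + (1 - Om) * y ^ 3)) by (apply sqrt_lt_R0; lra).
  assert (Hsy := sqrt_lt_R0 y ltac:(lra)).
  unfold Rdiv; rewrite Rmult_1_l. rewrite <- (cube_sqrt y) by lra. split; [|split].
  - apply Rinv_le_contravar; auto. apply sqrt_le_1_alt. nra.
  - apply Rle_trans with (/ 1); [| lra]. apply Rinv_le_contravar; [lra |].
    apply Rle_trans with (sqrt 1); [rewrite sqrt_1; lra | apply sqrt_le_1_alt; lra].
  - rewrite <- Rinv_mult. rewrite <- sqrt_mult by lra.
    apply Rinv_le_contravar; [apply sqrt_lt_R0; nra |]. apply sqrt_le_1_alt. lra.
Qed.

Lemma is_RInt_inv_sqrt_cube y : 1 <= y ->
  is_RInt (fun x => / (x * sqrt x)) 1 y (2 * (1 - / sqrt y)).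
Proof.
  intros Hy. evar_last.
  { apply (is_RInt_derive (fun x => - 2 * / sqrt x)); rewrite Rmin_left, Rmax_right by lra.
    - intros x Hx. assert (Hs := sqrt_lt_R0 x ltac:(lra)).
      auto_derive; [split; [lra |]; split; [|easy]; apply Rgt_not_eq; exact Hs |].
      assert (E : x = sqrt x * sqrt x) by (rewrite sqrt_sqrt; lra).
      set (s := sqrt x) in *. rewrite E. field. lra.
    - intros x Hx. assert (Hs := sqrt_lt_R0 x ltac:(lra)).
      apply @ex_derive_continuous. auto_derive. split; [lra |]. split; [|easy]. nra. }
  unfold minus, plus, opp; simpl. rewrite sqrt_1. field.
  apply Rgt_not_eq, sqrt_lt_R0; lra.
Qed.

(** The derivative of 2 atan (sqrt z), hence of total integral pi over
    (0, infinity). *)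
Definition time_weight (z : R) : R := / ((1 + z) * sqrt z).

(** The first and the last bound compare [calI] with y^(-3/2), whose integral from 1
    to y = 1 + z is 2 (1 - 1/sqrt y); the second uses [calI Om <= 1]. *)
Lemma areal_bounds Om z : 0 <= Om < 1 -> 0 < z ->
  z / (1 + z) ^ 2 <= areal Om z /\ areal Om z < 1 /\
  areal Om z <= 2 * / sqrt (1 - Om) / (1 + z).
Proof.
  intros HOm Hz. set (y := 1 + z). assert (Hy : 1 <= y) by (unfold y; lra).
  assert (Hex := ex_RInt_calI Om 1 y HOm ltac:(lra) ltac:(lra)).
  assert (Hi := is_RInt_inv_sqrt_cube y Hy).
  assert (Hk : 0 < / sqrt (1 - Om)) by (apply Rinv_0_lt_compat, sqrt_lt_R0; lra).
  assert (Hsy := sqrt_lt_R0 y ltac:(lra)).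
  assert (Hs1 : 1 <= sqrt y) by (apply Rle_trans with (sqrt 1); [rewrite sqrt_1; lra | apply sqrt_le_1_alt; lra]).
  assert (Hss : sqrt y * sqrt y = y) by (apply sqrt_sqrt; lra).
  assert (L : 2 * (1 - / sqrt y) <= RInt (calI Om) 1 y).
  { rewrite <- (is_RInt_unique _ _ _ _ Hi). apply RInt_le; auto.
    - eexists; exact Hi.
    - intros x Hx. apply calI_bounds; auto; lra. }
  assert (U1 : RInt (calI Om) 1 y <= z).
  { replace z with (RInt (fun _ => 1) 1 y).
    - apply RInt_le; auto; [apply ex_RInt_const |]. intros x Hx. apply calI_bounds; auto; lra.
    - rewrite RInt_const. unfold scal; simpl; unfold mult; simpl. unfold y; ring. }
  assert (U2 : RInt (calI Om) 1 y <= / sqrt (1 - Om) * (2 * (1 - / sqrt y))).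
  { apply (is_RInt_scal _ _ _ (/ sqrt (1 - Om))) in Hi.
    assert (Hu := is_RInt_unique _ _ _ _ Hi).
    unfold scal in Hu, Hi; simpl in Hu, Hi; unfold mult in Hu, Hi; simpl in Hu, Hi. rewrite <- Hu.
    apply RInt_le; auto.
    - eexists; exact Hi.
    - intros x Hx. apply calI_bounds; auto; lra. }
  assert (Hyi : 0 < / y) by (apply Rinv_0_lt_compat; lra).
  unfold areal. fold y. set (I := RInt (calI Om) 1 y) in *. split; [|split].
  - replace (z / y ^ 2) with (/ y * (z / y)) by (field; lra).
    apply Rmult_le_compat_l; [lra |]. apply Rle_trans with (2 := L).
    apply Rmult_le_reg_r with y; [lra |]. unfold Rdiv. rewrite Rmult_assoc, Rinv_l by lra.
    assert (Hd : / sqrt y * y = sqrt y) by (rewrite <- Hss at 2; field; lra).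
    replace (2 * (1 - / sqrt y) * y) with (2 * (y - / sqrt y * y)) by ring.
    rewrite Hd. replace z with (y - 1) by (unfold y; ring). nra.
  - apply Rmult_lt_reg_l with y; [lra |]. rewrite <- Rmult_assoc, Rinv_r by lra. unfold y in *; lra.
  - replace (2 * / sqrt (1 - Om) / y) with (/ y * (2 * / sqrt (1 - Om))) by (field; split; [apply Rgt_not_eq, sqrt_lt_R0|]; lra).
    apply Rmult_le_compat_l; [lra |]. apply Rle_trans with (1 := U2).
    assert (0 < / sqrt y) by now apply Rinv_0_lt_compat. nra.
Qed.

(** q behaves like z at 0 and like 1/z at infinity, while dq/dz is O(1/(1+z)^2);
    so both weights are O(z^(-1/2)) at 0 and O(z^(-3/2)) at infinity. *)
Lemma areal_weights Om : 0 <= Om < 1 ->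
  exists C, 0 < C /\ forall z, 0 < z ->
    sqrt (areal Om z) / (1 + z) <= C * time_weight z /\
    Rabs (areal_slope Om (1 + z) (areal Om z)) / sqrt (areal Om z) <= C * time_weight z.
Proof.
  intros HOm. set (k := / sqrt (1 - Om)).
  assert (Hso : 0 < sqrt (1 - Om)) by (apply sqrt_lt_R0; lra).
  assert (Hk : 1 <= k).
  { apply Rle_trans with (/ 1); [lra |]. apply Rinv_le_contravar; auto.
    apply Rle_trans with (sqrt 1); [apply sqrt_le_1_alt; lra | rewrite sqrt_1; lra]. }
  exists (3 * k). split; [lra |]. intros z Hz.
  destruct (areal_bounds Om z HOm Hz) as [L [U1 U2]]. fold k in U2.
  destruct (calI_bounds Om (1 + z) HOm ltac:(lra)) as [I1 [I2 I3]]. fold k in I3.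
  set (q := areal Om z) in *. set (h := calI Om (1 + z)) in *.
  assert (Hsz := sqrt_lt_R0 z Hz). assert (Hzz : sqrt z * sqrt z = z) by (apply sqrt_sqrt; lra).
  assert (Hy : 0 < / (1 + z)) by (apply Rinv_0_lt_compat; lra).
  assert (Hq : 0 < q).
  { apply Rlt_le_trans with (2 := L). apply Rdiv_lt_0_compat; [lra | apply pow_lt; lra]. }
  assert (Hsq := sqrt_lt_R0 q Hq).
  unfold time_weight. rewrite Rinv_mult. split.
  - assert (Hle : sqrt q <= 2 * k * / sqrt z).
    { rewrite <- (sqrt_pow2 (2 * k * / sqrt z)).
      - apply sqrt_le_1_alt. apply Rle_trans with (1 := U2).
        replace ((2 * k * / sqrt z) ^ 2) with ((2 * k) * (2 * k * / z)) by (rewrite <- Hzz at 1; field; lra).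
        assert (0 < / z) by now apply Rinv_0_lt_compat.
        assert (/ (1 + z) <= / z) by (apply Rinv_le_contravar; lra).
        unfold Rdiv. nra.
      - assert (0 < / sqrt z) by now apply Rinv_0_lt_compat. nra. }
    assert (0 < / sqrt z) by now apply Rinv_0_lt_compat.
    unfold Rdiv. assert (0 < k * (/ (1 + z) * / sqrt z)).
    { apply Rmult_lt_0_compat; [lra |]. now apply Rmult_lt_0_compat. }
    apply Rle_trans with (2 * k * / sqrt z * / (1 + z)); [apply Rmult_le_compat_r; lra | lra].
  - assert (Hlow : / (1 + z) * sqrt z <= sqrt q).
    { rewrite <- (sqrt_pow2 (/ (1 + z) * sqrt z)) by nra. apply sqrt_le_1_alt.
      apply Rle_trans with (2 := L). right.
      replace ((/ (1 + z) * sqrt z) ^ 2) with (/ (1 + z) ^ 2 * (sqrt z * sqrt z)) by (field; lra).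
      rewrite Hzz. field. lra. }
    assert (Hh : h <= k * / (1 + z)).
    { apply Rle_trans with (1 := I3). apply Rmult_le_compat_l; [lra |].
      apply Rinv_le_contravar; [lra |].
      assert (1 <= sqrt (1 + z)) by (apply Rle_trans with (sqrt 1); [rewrite sqrt_1; lra | apply sqrt_le_1_alt; lra]). nra. }
    assert (Hh0 : 0 < h).
    { apply Rlt_le_trans with (2 := I1). apply Rinv_0_lt_compat.
      apply Rmult_lt_0_compat; [lra | apply sqrt_lt_R0; lra]. }
    assert (Hd : Rabs (areal_slope Om (1 + z) q) <= 3 * k * (/ (1 + z) * / (1 + z))).
    { unfold areal_slope. fold h. unfold Rdiv. rewrite Rabs_mult, (Rabs_pos_eq (/ (1 + z))) by lra.
      assert (Rabs (h - q) <= 3 * k * / (1 + z)).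
      { apply Rabs_le. unfold Rdiv in U2. lra. }
      rewrite <- Rmult_assoc. apply Rmult_le_compat_r; lra. }
    assert (Hw : 0 < / (1 + z) * sqrt z) by now apply Rmult_lt_0_compat.
    apply Rle_trans with (3 * k * (/ (1 + z) * / (1 + z)) * / (/ (1 + z) * sqrt z)).
    + apply Rmult_le_compat; [apply Rabs_pos | left; now apply Rinv_0_lt_compat | exact Hd |].
      now apply Rinv_le_contravar.
    + right. field. lra.
Qed.

Lemma continuous_time_weight z : 0 < z -> continuous time_weight z.
Proof.
  intros Hz. pose proof (sqrt_lt_R0 z Hz). apply @ex_derive_continuous.
  unfold time_weight. auto_derive. split; [lra |]. split; [|easy].
  apply Rgt_not_eq, Rmult_lt_0_compat; lra.
Qed.

Lemma RInt_time_weight a b : 0 < a -> 0 < b -> Rabs (RInt time_weight a b) <= 4.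
Proof.
  intros Ha Hb.
  rewrite (is_RInt_unique _ _ _ (minus (2 * atan (sqrt b)) (2 * atan (sqrt a)))).
  - unfold minus, plus, opp; simpl.
    pose proof (atan_bound (sqrt a)) as [_ Ba]. pose proof (atan_bound (sqrt b)) as [_ Bb].
    pose proof (sqrt_lt_R0 a Ha) as Sa. pose proof (sqrt_lt_R0 b Hb) as Sb.
    apply atan_increasing in Sa. apply atan_increasing in Sb. rewrite atan_0 in Sa, Sb.
    pose proof PI_4. apply Rabs_le. lra.
  - apply (is_RInt_derive (fun x => 2 * atan (sqrt x))).
    + intros x [Hx _]. assert (Hx0 : 0 < x) by now apply (between_pos a b).
      pose proof (sqrt_lt_R0 x Hx0) as Hs. unfold time_weight.
      evar_last.
      * apply (is_derive_scal (fun x => atan (sqrt x))).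
        apply (is_derive_comp atan sqrt x); [apply is_derive_atan | apply is_derive_Reals, derivable_pt_lim_sqrt; exact Hx0].
      * unfold scal; simpl; unfold mult; simpl.
        assert (E : x = sqrt x * sqrt x) by (rewrite sqrt_sqrt; lra).
        unfold Rsqr. set (s := sqrt x) in *. rewrite E. field. nra.
    + intros x [Hx _]. apply continuous_time_weight. now apply (between_pos a b).
Qed.

(** * Local uniqueness and analyticity of solutions *)

Definition coords (Om z : R) (X : state) (i : nat) : R :=
  match i with
  | 0%nat => 1 + z
  | 1%nat => areal Om z
  | 2%nat => sr X
  | 3%nat => sM X
  | 4%nat => st X
  | _ => 0
  end.

Definition solves_at (Om c : R) (E R0 : R -> R) (X : R -> state) (z : R) : Prop :=
  admissible c E R0 (areal Om z) (X z) /\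
  is_derive (fun y => sr (X y)) z (rhs_r Om c E R0 z (X z)) /\
  is_derive (fun y => st (X y)) z (rhs_t Om E z (X z)) /\
  is_derive (fun y => sM (X y)) z (rhs_M Om c E R0 z (X z)).

Lemma locally_pos z : 0 < z -> locally z (fun x => 0 < x).
Proof.
  intros Hz. apply locally_Rabs. exists z. split; auto. intros u Hu.
  apply Rabs_lt_between in Hu. lra.
Qed.

Lemma locally_pos_continuous (f : R -> R) z :
  continuous f z -> 0 < f z -> locally z (fun x => 0 < f x).
Proof. intros Hf Hz. exact (Hf _ (locally_pos _ Hz)). Qed.

Lemma kM_eq c q r M : 0 < c -> 0 < q -> 0 < r -> 0 < M -> kM c q r M = kM_closed c q r M.
Proof.
  intros. apply RInt_kernelM; auto using half_sq_pos. now apply Rmult_lt_0_compat.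
Qed.

Lemma kE_eq c q r M : 0 < c -> 0 < q -> 0 < r -> 0 < M -> kE c q r M = kE_closed c q r M.
Proof.
  intros. apply RInt_kernelE; auto using half_sq_pos. now apply Rmult_lt_0_compat.
Qed.

(** A solution of the original system solves the elementary one wherever r and M
    are positive; admissibility supplies the nonvanishing of the denominators. *)
Lemma solution_coords Om c R0 X z :
  0 <= Om < 1 -> 0 < c -> (forall r, R0 r = c * r) -> 0 < z ->
  solves_at Om c half_sq R0 X z -> 0 < sr (X z) -> 0 < sM (X z) ->
  (forall i, is_derive (fun y => coords Om y (X y) i) z
     (ev (coords Om z (X z)) (field_at (ltb_field Om c) i))) /\
  regular_field (ltb_field Om c) (coords Om z (X z)).
Proof.
  intros HOm Hc HR Hz (Hadm & Hr & Ht & HM) Hrp HMp.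
  destruct Hadm as (Hq & _ & _ & _ & Hd1 & Hd2).
  assert (HDa := is_derive_areal Om z HOm ltac:(lra)).
  rewrite rhs_r_eq, (is_derive_unique _ _ _ HDa) in Hr by auto.
  rewrite rhs_t_eq, (is_derive_unique _ _ _ HDa) in Ht by auto.
  rewrite rhs_M_eq, (is_derive_unique _ _ _ HDa) in HM by auto.
  rewrite den1_eq in Hd1. rewrite den2_eq in Hd2 by auto.
  rewrite kM_eq, kE_eq in * by auto.
  assert (Hnd : nondegenerate Om c (coords Om z (X z))).
  { unfold nondegenerate; cbn [coords]. repeat split; auto; lra. }
  split; [| now apply regular_ltb_field].
  intros [|[|[|[|[|i]]]]]; cbn [field_at nth ltb_field].
  - cbn. auto_derive; [easy | ring].
  - rewrite ev_eDQ. exact HDa.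
  - rewrite ev_eFlowR. exact Hr.
  - rewrite ev_eFlowM. exact HM.
  - rewrite ev_eFlowT. exact Ht.
  - destruct i; exact (is_derive_const (V := R_NormedModule) 0 z).
Qed.

Lemma solution_coords_is_pseries Om c R0 X z1 :
  0 <= Om < 1 -> 0 < c -> (forall r, R0 r = c * r) -> 0 < z1 ->
  locally z1 (solves_at Om c half_sq R0 X) -> 0 < sr (X z1) -> 0 < sM (X z1) ->
  forall i, locally z1 (fun z =>
    is_pseries (taylor_coef (ltb_field Om c) (coords Om z1 (X z1)) (Var i)) (z - z1)
      (coords Om z (X z) i)).
Proof.
  intros HOm Hc HR Hz1 Hs Hr HM i.
  destruct (locally_singleton _ _ Hs) as (_ & Dr & _ & DM).
  assert (Hr' := locally_pos_continuous (fun y => sr (X y)) z1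
    (ex_derive_continuous _ _ (ex_intro _ _ Dr)) Hr).
  assert (HM' := locally_pos_continuous (fun y => sM (X y)) z1
    (ex_derive_continuous _ _ (ex_intro _ _ DM)) HM).
  apply (solution_is_pseries (ltb_field Om c) (fun i z => coords Om z (X z) i) (Var i) z1).
  generalize (filter_and _ _ (filter_and _ _ Hs (locally_pos z1 Hz1)) (filter_and _ _ Hr' HM')).
  apply filter_imp. intros z [[H1 H2] [H3 H4]].
  destruct (solution_coords Om c R0 X z HOm Hc HR H2 H1 H3 H4) as [A B].
  split; [exact A | split; [exact B | exact I]].
Qed.

Lemma state_eq X Y : sr X = sr Y -> st X = st Y -> sM X = sM Y -> X = Y.
Proof. destruct X, Y; simpl; intros; subst; reflexivity. Qed.

(** The two solutions have the same Taylor coefficients at [z1]. *)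
Lemma solution_local_unique Om c R0 X Y z1 :
  0 <= Om < 1 -> 0 < c -> (forall r, R0 r = c * r) -> 0 < z1 ->
  locally z1 (solves_at Om c half_sq R0 X) -> locally z1 (solves_at Om c half_sq R0 Y) ->
  0 < sr (X z1) -> 0 < sM (X z1) -> Y z1 = X z1 ->
  locally z1 (fun z => Y z = X z).
Proof.
  intros HOm Hc HR Hz1 HX HY Hr HM Heq.
  assert (SX := solution_coords_is_pseries Om c R0 X z1 HOm Hc HR Hz1 HX Hr HM).
  assert (SY := solution_coords_is_pseries Om c R0 Y z1 HOm Hc HR Hz1 HY
    ltac:(now rewrite Heq) ltac:(now rewrite Heq)).
  rewrite Heq in SY.
  assert (H : forall i, locally z1 (fun z => coords Om z (Y z) i = coords Om z (X z) i)).
  { intros i. generalize (filter_and _ _ (SX i) (SY i)). apply filter_imp.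
    intros z [A B]. apply is_pseries_unique in A, B. now rewrite <- A, <- B. }
  generalize (filter_and _ _ (H 2%nat) (filter_and _ _ (H 3%nat) (H 4%nat))).
  apply filter_imp. intros z (A & B & C). apply state_eq; auto.
Qed.

Lemma solution_analytic Om c R0 X z1 :
  0 <= Om < 1 -> 0 < c -> (forall r, R0 r = c * r) -> 0 < z1 ->
  locally z1 (solves_at Om c half_sq R0 X) -> 0 < sr (X z1) -> 0 < sM (X z1) ->
  analytic_at (fun y => sr (X y)) z1 /\ analytic_at (fun y => st (X y)) z1 /\
  analytic_at (fun y => sM (X y)) z1.
Proof.
  intros HOm Hc HR Hz1 HX Hr HM.
  assert (SX := solution_coords_is_pseries Om c R0 X z1 HOm Hc HR Hz1 HX Hr HM).
  assert (H : forall i, analytic_at (fun z => coords Om z (X z) i) z1).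
  { intros i. destruct (SX i) as [eps H]. eexists; exists eps. exact H. }
  exact (conj (H 2%nat) (conj (H 4%nat) (H 3%nat))).
Qed.

(** In either direction from [z0], the supremum of the times up to which [S] holds
    belongs to [S] because [S] is closed, and cannot be interior because [S] is
    open.  The sign [sgn] treats both directions at once. *)
Lemma interval_connected (I S : R -> Prop) z0 :
  is_open_interval I -> I z0 -> S z0 ->
  (forall z, I z -> S z -> locally z S) ->
  (forall z, I z -> (forall Q, locally z Q -> exists u, Q u /\ S u) -> S z) ->
  forall z, I z -> S z.
Proof.
  intros HI H0 HS0 Hopen Hclosed.
  assert (main : forall sgn, sgn = 1 \/ sgn = -1 ->
    forall d, 0 <= d -> I (z0 + sgn * d) -> S (z0 + sgn * d)).
  { intros sgn Hsgn d Hd Hz.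
    assert (Hseg : forall t, 0 <= t <= d -> I (z0 + sgn * t)).
    { intros t Ht. apply (interval_segment I z0 (z0 + sgn * d)); auto.
      destruct Hsgn as [-> | ->].
      - rewrite Rmin_left, Rmax_right; lra.
      - rewrite Rmin_right, Rmax_left; lra. }
    pose (E t := 0 <= t <= d /\ forall s, 0 <= s <= t -> S (z0 + sgn * s)).
    assert (HE0 : E 0).
    { split; [lra |]. intros s Hs. replace s with 0 by lra. now rewrite Rmult_0_r, Rplus_0_r. }
    destruct (completeness E) as [m [Hub Hleast]].
    { exists d. intros t [Ht _]; lra. }
    { exists 0; exact HE0. }
    assert (Hm : 0 <= m <= d).
    { split; [now apply Hub | apply Hleast; intros t [Ht _]; lra]. }
    assert (Hbelow : forall s, 0 <= s < m -> S (z0 + sgn * s)).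
    { intros s Hs. apply Classical_Prop.NNPP. intros Hn.
      enough (m <= s) by lra. apply Hleast. intros t [Ht1 Ht2].
      apply Rnot_lt_le. intros Hlt. apply Hn, Ht2. lra. }
    assert (Hdist : forall t u, Rabs (z0 + sgn * t - (z0 + sgn * u)) = Rabs (t - u)).
    { intros t u. replace (z0 + sgn * t - (z0 + sgn * u)) with (sgn * (t - u)) by ring.
      rewrite Rabs_mult. destruct Hsgn as [-> | ->];
        [rewrite Rabs_R1 | rewrite (Rabs_left1 (-1)) by lra]; ring. }
    assert (HSm : S (z0 + sgn * m)).
    { destruct (Req_dec m 0) as [->|Hm0]; [now rewrite Rmult_0_r, Rplus_0_r |].
      apply Hclosed; [now apply Hseg |]. intros Q HQ.
      apply locally_Rabs in HQ as [eps [He HQ]].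
      exists (z0 + sgn * Rmax 0 (m - eps / 2)). split.
      - apply HQ. rewrite Hdist.
        unfold Rmax; destruct (Rle_dec 0 (m - eps / 2));
          [rewrite Rabs_left1 by lra; lra | rewrite Rabs_left1 by lra; lra].
      - apply Hbelow. unfold Rmax; destruct (Rle_dec 0 (m - eps / 2)); lra. }
    assert (HEm : E m).
    { split; auto. intros s Hs. destruct (Req_dec s m) as [->|Hne]; auto. apply Hbelow; lra. }
    destruct (Rle_lt_or_eq_dec m d (proj2 Hm)) as [Hlt | ->]; [exfalso | exact HSm].
    assert (Hloc := Hopen _ (Hseg m Hm) HSm).
    apply locally_Rabs in Hloc as [eps [He Hloc]].
    assert (Hn : E (Rmin d (m + eps / 2))).
    { pose proof (Rmin_l d (m + eps / 2)); pose proof (Rmin_r d (m + eps / 2)).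
      split; [split; [apply Rmin_glb; lra | easy] |]. intros s Hs.
      destruct (Rle_lt_dec s m) as [Hsm|Hsm]; [apply HEm; lra |].
      apply Hloc. rewrite Hdist, Rabs_pos_eq; lra. }
    apply Hub in Hn. revert Hn. unfold Rmin; destruct (Rle_dec d (m + eps / 2)); lra. }
  intros z Hz. destruct (Rle_lt_dec z0 z) as [H|H].
  - replace z with (z0 + 1 * (z - z0)) by ring. apply main; auto; [lra |].
    now replace (z0 + 1 * (z - z0)) with z by ring.
  - replace z with (z0 + -1 * (z0 - z)) by ring. apply main; auto; [lra |].
    now replace (z0 + -1 * (z0 - z)) with z by ring.
Qed.

(** Near its centre the series is (y - z)^k times a continuous function with value
    [a k] at the centre. *)
Lemma pseries_nonzero_punctured (f : R -> R) (a : nat -> R) z eps k :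
  0 < eps -> (forall y, Rabs (y - z) < eps -> is_pseries a (y - z) (f y)) ->
  (forall j, (j < k)%nat -> a j = 0) -> a k <> 0 ->
  locally z (fun y => y <> z -> f y <> 0).
Proof.
  intros He Hf Hlow Hk.
  pose (b n := a (k + n)%nat).
  assert (Hb : forall y, Rabs (y - z) < eps -> f y = (y - z) ^ k * PSeries b (y - z)).
  { intros y Hy. specialize (Hf y Hy). apply is_pseries_unique in Hf. rewrite <- Hf.
    rewrite <- (PSeries_incr_n b k (y - z)). apply PSeries_ext. intros n.
    rewrite PS_incr_n_simplify. unfold b.
    destruct (Compare_dec.le_lt_dec k n) as [Hn|Hn]; [f_equal; lia | now apply Hlow]. }
  assert (Hrad : Rbar_lt 0 (CV_radius b)).
  { assert (Hra : Rbar_le (eps / 2) (CV_radius a)).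
    { assert (Hin : Rabs ((z + eps / 2) - z) < eps).
      { replace (z + eps / 2 - z) with (eps / 2) by ring. rewrite Rabs_pos_eq; lra. }
      assert (Hex : ex_pseries a (eps / 2)).
      { replace (eps / 2) with ((z + eps / 2) - z) by ring. eexists. now apply Hf. }
      apply Rbar_not_lt_le. intros Hlt.
      apply (CV_disk_outside a (eps / 2)).
      - rewrite Rabs_pos_eq by lra. exact Hlt.
      - apply ex_series_lim_0. destruct Hex as [l Hl]. exists l.
        revert Hl. apply is_series_ext. intros n. unfold scal; simpl; unfold mult; simpl.
        rewrite pow_n_pow. ring. }
    assert (Heq : CV_radius b = CV_radius a).
    { unfold b. clear. induction k as [|k IH]; [now apply CV_radius_ext |].
      rewrite <- IH. rewrite <- (CV_radius_decr_1 (fun n => a (k + n)%nat)).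
      apply CV_radius_ext. intros n. unfold PS_decr_1. f_equal. lia. }
    rewrite Heq. eapply Rbar_lt_le_trans; [| exact Hra]. simpl; lra. }
  assert (Hc : continuous (PSeries b) 0).
  { apply continuity_pt_filterlim, PSeries_continuity. rewrite Rabs_R0. exact Hrad. }
  assert (Hb0 : PSeries b 0 <> 0).
  { rewrite PSeries_0. unfold b. now rewrite Nat.add_0_r. }
  assert (Hloc : locally 0 (fun u => PSeries b u <> 0)).
  { assert (Hn : locally (PSeries b 0) (fun v => v <> 0)).
    { apply locally_Rabs. exists (Rabs (PSeries b 0)). split; [now apply Rabs_pos_lt |].
      intros u Hu ->. rewrite Rminus_0_l, Rabs_Ropp in Hu. lra. }
    exact (Hc _ Hn). }
  apply locally_Rabs in Hloc as [d [Hd Hloc]].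
  apply locally_Rabs. exists (Rmin eps d). split; [now apply Rmin_glb_lt |].
  intros y Hy Hne. pose proof (Rmin_l eps d); pose proof (Rmin_r eps d).
  rewrite Hb by lra. apply Rmult_integral_contrapositive_currified.
  - apply pow_nonzero. lra.
  - apply Hloc. rewrite Rminus_0_r. lra.
Qed.

(** A nonzero coefficient would make [z] an isolated zero or no zero at all. *)
Lemma analytic_zero_of_accumulation (f : R -> R) z :
  analytic_at f z ->
  (forall Q, locally z Q -> exists u, Q u /\ locally u (fun x => f x = 0)) ->
  locally z (fun x => f x = 0).
Proof.
  intros [a [eps Hf]] Hacc.
  destruct (Classical_Prop.classic (forall n, a n = 0)) as [Hall | Hex].
  - exists eps. intros y Hy. specialize (Hf y Hy). apply is_pseries_unique in Hf.
    rewrite <- Hf. rewrite (PSeries_ext a (fun _ => 0)) by auto. apply PSeries_const_0.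
  - exfalso. apply Classical_Pred_Type.not_all_ex_not in Hex.
    assert (Hk : exists k, a k <> 0 /\ forall j, (j < k)%nat -> a j = 0).
    { destruct Hex as [n Hn]. revert Hn. induction n as [n IH] using Wf_nat.lt_wf_ind. intros Hn.
      destruct (Classical_Prop.classic (exists j, (j < n)%nat /\ a j <> 0)) as [[j [Hj1 Hj2]]|Hno].
      - now apply (IH j).
      - exists n. split; auto. intros j Hj. apply Classical_Prop.NNPP. intros Ha.
        apply Hno. now exists j. }
    destruct Hk as [k [Hk Hlow]].
    assert (Hp := pseries_nonzero_punctured f a z eps k (cond_pos eps) Hf Hlow Hk).
    apply locally_Rabs in Hp as [d [Hd Hp]].
    destruct (Hacc (fun u => Rabs (u - z) < d)) as [u [Hu Hz]].
    { apply locally_Rabs. exists d; auto. }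
    apply locally_Rabs in Hz as [e [He Hz]].
    (* [u] may be [z] itself: the contradiction needs another zero close to it *)
    pose (m := Rmin (e / 2) ((d - Rabs (u - z)) / 2)).
    assert (Hm : 0 < m) by (apply Rmin_glb_lt; lra).
    pose proof (Rmin_l (e / 2) ((d - Rabs (u - z)) / 2)) as M1.
    pose proof (Rmin_r (e / 2) ((d - Rabs (u - z)) / 2)) as M2. fold m in M1, M2.
    assert (Hpt : exists y, Rabs (y - u) < e /\ Rabs (y - z) < d /\ y <> z).
    { destruct (Req_dec u z) as [->|Hne].
      - exists (z + m). replace (z + m - z) with m by ring. rewrite Rabs_pos_eq by lra.
        rewrite Rminus_diag, Rabs_R0 in M2. repeat split; lra.
      - exists u. rewrite Rminus_diag, Rabs_R0. auto. }
    destruct Hpt as [y [Hy1 [Hy2 Hy3]]]. apply (Hp y Hy2 Hy3). now apply Hz.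
Qed.

Lemma analytic_at_minus (f g : R -> R) z :
  analytic_at f z -> analytic_at g z -> analytic_at (fun x => f x - g x) z.
Proof.
  intros [a [e1 Ha]] [b [e2 Hb]].
  assert (Hp : 0 < Rmin e1 e2) by (apply Rmin_glb_lt; apply cond_pos).
  exists (PS_minus a b), (mkposreal _ Hp). intros y Hy. simpl in Hy.
  pose proof (Rmin_l e1 e2); pose proof (Rmin_r e1 e2).
  apply (is_pseries_minus a b (y - z) (f y) (g y)); [apply Ha | apply Hb]; lra.
Qed.

(** The set of points near which [f] and [g] agree is open by definition and closed
    because zeros of a nonzero analytic function are isolated. *)
Lemma analytic_identity (f g : R -> R) z0 :
  0 < z0 -> (forall z, 0 < z -> analytic_at f z) -> (forall z, 0 < z -> analytic_at g z) ->
  locally z0 (fun z => f z = g z) -> forall z, 0 < z -> f z = g z.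
Proof.
  intros Hz0 Hf Hg H0.
  assert (main : forall z, 0 < z -> locally z (fun x => f x - g x = 0)).
  { apply (interval_connected (fun z => 0 < z) (fun z => locally z (fun x => f x - g x = 0)) z0).
    - split; [intros z Hz; now apply locally_pos | intros; lra].
    - exact Hz0.
    - generalize H0. apply filter_imp. intros; lra.
    - intros z _ H. now apply locally_locally.
    - intros z Hz Hacc. apply analytic_zero_of_accumulation; auto.
      apply analytic_at_minus; auto. }
  intros z Hz. specialize (main z Hz). apply locally_singleton in main. lra.
Qed.

(** * The system in scaled variables *)

(** Here [x] stands for (rho, m) = (c r, 2 c^3 M).  In terms of the original
    quantities, 2 E + 2 M / R = [sP]^2 / (c^3 q) and 1 + 2 E = ([sL] / c)^2;
    [sPhi] and [sD] are positive multiples of calF and of minus the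
    determinant [slope_det], and [sH] of [horizon]. *)
Definition sY (c q : R) (x : plane) : R := snd x + c * (fst x * fst x) * q.
Definition sP (c q : R) (x : plane) : R := sqrt (sY c q x).
Definition sL (c q : R) (x : plane) : R := sqrt (fst x * fst x + c * c).
Definition sPsi (c q : R) (x : plane) : R :=
  sqrt (fst x * / (snd x + c * (fst x * fst x * fst x))).
Definition sKerM (c q : R) (x : plane) : R := sqrt q * / (sY c q x * sP c q x).
Definition sKM (c q : R) (x : plane) : R := RInt (fun u => sKerM c u x) (fst x) q.
Definition sKE (c q : R) (x : plane) : R := RInt (fun u => u * sKerM c u x) (fst x) q.
Definition sPhi (c q : R) (x : plane) : R := sPsi c q x + c * fst x * sKE c q x.
(** Written as a perturbation of [sPsi] of order sqrt c so that [away_perturb]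
    applies; likewise [sH] with respect to [sP]. *)
Definition sD (c q : R) (x : plane) : R :=
  sPsi c q x + sqrt c * (sqrt c * fst x * (sKE c q x - q * sKM c q x)).
Definition sH (c q : R) (x : plane) : R := sP c q x + sqrt c * - (sqrt q * sL c q x).

(** The coefficients of sqrt q / (1 + z) and of q' / sqrt q in the derivatives of
    rho and m, divided by sqrt c.  Splitting off these two weights leaves functions
    that stay regular as q tends to 0. *)
Definition coef_r1 (c q : R) (x : plane) : R :=
  - (sKM c q x * sP c q x * sL c q x) * / sD c q x.
Definition coef_r2 (c q : R) (x : plane) : R :=
  sL c q x * (snd x * sKM c q x * sP c q x * / 2 - q * sqrt q)
  * / (sP c q x * sH c q x * sD c q x).
Definition coef_M1 (c q : R) (x : plane) : R :=
  2 * sP c q x * sL c q x * sPhi c q x * / sD c q x.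
Definition coef_M2 (c q : R) (x : plane) : R :=
  2 * sL c q x * (c * (q * q) * sqrt q * fst x - sP c q x * sPhi c q x * snd x * / 2)
  * / (sP c q x * sH c q x * sD c q x).

Lemma away_sY b B T : 0 < b -> away b B T sY.
Proof.
  intros Hb. apply (away_plus_nonneg b B T (fun _ _ x => snd x)); [now apply away_snd |].
  intros c q x Hc Hq [Hx _]. apply Rmult_le_pos; [apply Rmult_le_pos; nra | lra].
Qed.

Lemma tame_sY b B T : tame b B T sY.
Proof.
  apply tame_plus; [apply tame_snd |].
  apply tame_mult; [apply tame_mult; [apply tame_c | apply tame_mult; apply tame_fst] | apply tame_q].
Qed.

Lemma tame_sP b B T : 0 < b -> tame b B T sP.
Proof. intros. apply tame_sqrt; [apply tame_sY | now apply away_sY]. Qed.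

Lemma away_sP b B T : 0 < b -> away b B T sP.
Proof. intros. apply away_sqrt; now apply away_sY. Qed.

Lemma tame_sL b B T : 0 < b -> tame b B T sL.
Proof.
  intros Hb. apply tame_sqrt.
  - apply tame_plus; apply tame_mult; auto using tame_fst, tame_c.
  - apply (away_plus_nonneg b B T (fun _ _ x => fst x * fst x)).
    + apply away_mult; now apply away_fst.
    + intros; nra.
Qed.

Lemma tame_psi_den b B T :
  tame b B T (fun c q x => snd x + c * (fst x * fst x * fst x)).
Proof.
  apply tame_plus; [apply tame_snd |]. apply tame_mult; [apply tame_c |].
  repeat apply tame_mult; apply tame_fst.
Qed.

Lemma away_psi_den b B T : 0 < b ->
  away b B T (fun c q x => snd x + c * (fst x * fst x * fst x)).
Proof.
  intros Hb. apply (away_plus_nonneg b B T (fun _ _ x => snd x)); [now apply away_snd |].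
  intros c q x Hc Hq [Hx _]. repeat apply Rmult_le_pos; lra.
Qed.

Lemma away_psi_arg b B T : 0 < b ->
  away b B T (fun c q x => fst x * / (snd x + c * (fst x * fst x * fst x))).
Proof.
  intros Hb. apply away_mult; [now apply away_fst |].
  apply away_inv; [apply tame_psi_den | now apply away_psi_den].
Qed.

Lemma tame_sPsi b B T : 0 < b -> tame b B T sPsi.
Proof.
  intros Hb. apply tame_sqrt; [| now apply away_psi_arg].
  apply tame_mult; [apply tame_fst |].
  apply tame_inv; [apply tame_psi_den | now apply away_psi_den].
Qed.

Lemma away_sPsi b B T : 0 < b -> away b B T sPsi.
Proof. intros Hb. apply away_sqrt; now apply away_psi_arg. Qed.

Lemma tame_sKerM b B T : 0 < b -> tame b B T sKerM.
Proof.
  intros Hb. apply tame_mult; [apply tame_sqrt_q |]. apply tame_inv.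
  - apply tame_mult; [apply tame_sY | now apply tame_sP].
  - apply away_mult; [now apply away_sY | now apply away_sP].
Qed.

Lemma tame_sKM b B T : 0 < b -> B < T -> tame b B T sKM.
Proof. intros Hb HT. apply (tame_RInt b B T sKerM); auto. now apply tame_sKerM. Qed.

Lemma tame_sKE b B T : 0 < b -> B < T -> tame b B T sKE.
Proof.
  intros Hb HT. apply (tame_RInt b B T (fun c q x => q * sKerM c q x)); auto.
  apply tame_mult; [apply tame_q | now apply tame_sKerM].
Qed.

Lemma tame_sPhi b B T : 0 < b -> B < T -> tame b B T sPhi.
Proof.
  intros Hb HT. apply tame_plus; [now apply tame_sPsi |].
  apply tame_mult; [apply tame_mult; [apply tame_c | apply tame_fst] | now apply tame_sKE].
Qed.

Lemma tame_sD_corr b B T : 0 < b -> B < T ->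
  tame b B T (fun c q x => sqrt c * fst x * (sKE c q x - q * sKM c q x)).
Proof.
  intros Hb HT. apply tame_mult; [apply tame_mult; [apply tame_sqrt_c | apply tame_fst] |].
  apply tame_minus; [now apply tame_sKE |]. apply tame_mult; [apply tame_q | now apply tame_sKM].
Qed.

Lemma tame_sD b B T : 0 < b -> B < T -> tame b B T sD.
Proof.
  intros Hb HT. apply tame_plus; [now apply tame_sPsi |].
  apply tame_mult; [apply tame_sqrt_c | now apply tame_sD_corr].
Qed.

Lemma away_sD b B T : 0 < b -> B < T -> away b B T sD.
Proof.
  intros Hb HT. apply (away_perturb b B T sPsi); [now apply away_sPsi | now apply tame_sD_corr].
Qed.

Lemma tame_sH_corr b B T : 0 < b -> tame b B T (fun c q x => - (sqrt q * sL c q x)).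
Proof. intros Hb. apply tame_opp, tame_mult; [apply tame_sqrt_q | now apply tame_sL]. Qed.

Lemma tame_sH b B T : 0 < b -> tame b B T sH.
Proof.
  intros Hb. apply tame_plus; [now apply tame_sP |].
  apply tame_mult; [apply tame_sqrt_c | now apply tame_sH_corr].
Qed.

Lemma away_sH b B T : 0 < b -> away b B T sH.
Proof. intros Hb. apply (away_perturb b B T sP); [now apply away_sP | now apply tame_sH_corr]. Qed.

Lemma tame_inv_PHD b B T : 0 < b -> B < T ->
  tame b B T (fun c q x => / (sP c q x * sH c q x * sD c q x)).
Proof.
  intros Hb HT. apply tame_inv.
  - apply tame_mult; [apply tame_mult; [now apply tame_sP | now apply tame_sH] | now apply tame_sD].
  - apply away_mult; [apply away_mult; [now apply away_sP | now apply away_sH] | now apply away_sD].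
Qed.

Lemma tame_inv_sD b B T : 0 < b -> B < T -> tame b B T (fun c q x => / sD c q x).
Proof. intros. apply tame_inv; [now apply tame_sD | now apply away_sD]. Qed.

(** Apart from constants, the coefficients invert only [sP], bounded below on the
    box, and [sH] and [sD], which are perturbations of order sqrt c of [sP] and [sPsi]. *)
Lemma tame_coefs b B T : 0 < b -> B < T ->
  tame b B T coef_r1 /\ tame b B T coef_r2 /\ tame b B T coef_M1 /\ tame b B T coef_M2.
Proof.
  intros Hb HT.
  pose proof (tame_sP b B T Hb) as HP. pose proof (tame_sL b B T Hb) as HL.
  pose proof (tame_sKM b B T Hb HT) as HK. pose proof (tame_sPhi b B T Hb HT) as HF.
  pose proof (tame_inv_PHD b B T Hb HT) as HI. pose proof (tame_inv_sD b B T Hb HT) as HD.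
  pose proof (tame_fst b B T) as H1. pose proof (tame_snd b B T) as H2.
  pose proof (tame_q b B T) as Hq. pose proof (tame_sqrt_q b B T) as Hs.
  pose proof (tame_c b B T) as Hc. pose proof (fun a => tame_const b B T a) as Ha.
  repeat split.
  - apply tame_mult; [| exact HD]. apply tame_opp. now repeat apply tame_mult.
  - apply tame_mult; [| exact HI]. apply tame_mult; [exact HL |].
    apply tame_minus; [| now apply tame_mult].
    apply tame_mult; [now repeat apply tame_mult | apply Ha].
  - apply tame_mult; [| exact HD]. apply tame_mult; [| exact HF].
    apply tame_mult; [| exact HL]. apply tame_mult; [apply Ha | exact HP].
  - apply tame_mult; [| exact HI]. apply tame_mult; [apply tame_mult; [apply Ha | exact HL] |].
    apply tame_minus; [now repeat apply tame_mult |].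
    apply tame_mult; [now repeat apply tame_mult | apply Ha].
Qed.

Lemma sqrt_unique_pos a x : 0 <= a -> x = a * a -> sqrt x = a.
Proof. intros Ha ->. now apply sqrt_square. Qed.

(** The parameter [e] is sqrt c.  Everything follows from
    tau E + M = [sY] / (2 c^3). *)
Lemma scaled_quantities e q rho m :
  0 < e -> 0 < q -> 0 < rho -> 0 < m ->
  let c := e * e in let x : plane := (rho, m) in
  let r := rho / c in let M := m / (2 * c ^ 3) in
  root_at q r M = sqrt 2 * e ^ 3 * sqrt q / sP c q x /\
  root_at (c * r) r M = sqrt 2 * e ^ 3 * sPsi c q x /\
  speed_at q r M = sP c q x / (sqrt q * e ^ 3) /\
  lapse_at r = sL c q x / c /\
  kM c q r M = 2 * sqrt 2 * e ^ 9 * sKM c q x /\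
  kE c q r M = 2 * sqrt 2 * e ^ 9 * sKE c q x.
Proof.
  intros He Hq Hr Hm c x r M.
  assert (Hc : 0 < c) by (unfold c; nra).
  assert (He3 : 0 < e ^ 3) by now apply pow_lt.
  assert (H2 := Rlt_sqrt2_0). assert (H22 : sqrt 2 * sqrt 2 = 2) by (apply sqrt_sqrt; lra).
  assert (HY : forall u, 0 < u -> 0 < sY c u x).
  { intros u Hu. unfold sY, x; simpl. assert (0 < c * (rho * rho) * u); [|lra].
    repeat apply Rmult_lt_0_compat; auto. }
  assert (HP : forall u, 0 < u -> 0 < sP c u x) by (intros; apply sqrt_lt_R0; auto).
  assert (HPP : forall u, 0 < u -> sP c u x * sP c u x = sY c u x).
  { intros u Hu. apply sqrt_sqrt. left; auto. }
  assert (Hsq := sqrt_lt_R0 q Hq). assert (Hss : sqrt q * sqrt q = q) by (apply sqrt_sqrt; lra).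
  assert (Hlin : forall u, u * half_sq r + M = sY c u x / (2 * e ^ 6)).
  { intros u. unfold half_sq, r, M, sY, x, c; simpl. field. lra. }
  assert (Hker : forall u, 0 < u ->
    kernelM (half_sq r) M u = 2 * sqrt 2 * e ^ 9 * sKerM c u x).
  { intros u Hu. unfold kernelM, sKerM. rewrite Hlin.
    rewrite (sqrt_unique_pos (sP c u x / (sqrt 2 * e ^ 3)) (sY c u x / (2 * e ^ 6))).
    - specialize (HY u Hu); specialize (HP u Hu).
      transitivity (2 * sqrt 2 * e ^ 9 * (sqrt u * / (sY c u x * sP c u x))); [field | reflexivity].
      repeat split; lra.
    - left. apply Rdiv_lt_0_compat; [now apply HP | now apply Rmult_lt_0_compat].
    - rewrite <- (HPP u Hu). transitivity (sP c u x * sP c u x / (sqrt 2 * sqrt 2 * e ^ 6)).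
      + rewrite H22. reflexivity.
      + field. split; lra. }
  assert (Hcr : c * r = rho) by (unfold r; field; lra).
  assert (Hseg : forall u, Rmin rho q < u -> 0 < u).
  { intros u Hu. apply (between_pos rho q); auto; lra. }
  assert (HexM : ex_RInt (fun u => sKerM c u x) rho q).
  { apply @ex_RInt_continuous. intros u [Hu _].
    assert (Hu0 : 0 < u) by now apply (between_pos rho q).
    specialize (HY u Hu0). specialize (HP u Hu0). unfold sP in HP.
    apply @ex_derive_continuous. unfold sKerM, sP, sY in *. auto_derive.
    repeat split; auto. apply Rgt_not_eq. now apply Rmult_lt_0_compat. }
  assert (HexE : ex_RInt (fun u => u * sKerM c u x) rho q).
  { apply @ex_RInt_continuous. intros u [Hu _].
    assert (Hu0 : 0 < u) by now apply (between_pos rho q).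
    specialize (HY u Hu0). specialize (HP u Hu0). unfold sP in HP.
    apply @ex_derive_continuous. unfold sKerM, sP, sY in *. auto_derive.
    repeat split; auto. apply Rgt_not_eq. now apply Rmult_lt_0_compat. }
  split; [|split; [|split; [|split; [|split]]]].
  - unfold root_at. rewrite Hlin. apply sqrt_unique_pos.
    + left. apply Rdiv_lt_0_compat; [| auto]. repeat apply Rmult_lt_0_compat; lra.
    + specialize (HP q Hq). transitivity (2 * e ^ 6 * q / sY c q x).
      * specialize (HY q Hq). field; lra.
      * rewrite <- (HPP q Hq).
        transitivity (sqrt 2 * sqrt 2 * e ^ 6 * (sqrt q * sqrt q) / (sP c q x * sP c q x)).
        -- rewrite H22, Hss. reflexivity.
        -- field. lra.
  - unfold root_at. rewrite Hlin, Hcr. apply sqrt_unique_pos.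
    + apply Rmult_le_pos; [apply Rmult_le_pos; lra | apply sqrt_pos].
    + assert (Hden : sY c rho x = snd x + c * (fst x * fst x * fst x)).
      { unfold sY, x; simpl; ring. }
      assert (Hpp : sPsi c q x * sPsi c q x = rho / sY c rho x).
      { rewrite Hden. unfold sPsi. rewrite sqrt_sqrt; [reflexivity |].
        rewrite <- Hden. left. now apply Rdiv_lt_0_compat; auto. }
      replace (sqrt 2 * e ^ 3 * sPsi c q x * (sqrt 2 * e ^ 3 * sPsi c q x))
        with (sqrt 2 * sqrt 2 * e ^ 6 * (sPsi c q x * sPsi c q x)) by ring.
      rewrite Hpp, H22. specialize (HY rho Hr). field. repeat split; lra.
  - unfold speed_at. apply sqrt_unique_pos.
    + left. apply Rdiv_lt_0_compat; [now apply HP | now apply Rmult_lt_0_compat].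
    + replace (sP c q x / (sqrt q * e ^ 3) * (sP c q x / (sqrt q * e ^ 3)))
        with (sP c q x * sP c q x / ((sqrt q * sqrt q) * e ^ 6)) by (field; split; lra).
      rewrite (HPP q Hq), Hss. unfold half_sq, r, M, sY, x, c; simpl. field. split; lra.
  - unfold lapse_at, sL. apply sqrt_unique_pos.
    + apply Rmult_le_pos; [apply sqrt_pos | left; now apply Rinv_0_lt_compat].
    + replace (sqrt (fst x * fst x + c * c) / c * (sqrt (fst x * fst x + c * c) / c))
        with (sqrt (fst x * fst x + c * c) * sqrt (fst x * fst x + c * c) / (c * c)) by (field; lra).
      rewrite sqrt_sqrt by nra. unfold half_sq, r, x; simpl. field. lra.
  - unfold kM, sKM. rewrite Hcr. simpl fst.
    etransitivity; [| exact (RInt_scal (V := R_CompleteNormedModule) (fun u => sKerM c u x)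
      rho q (2 * sqrt 2 * e ^ 9) HexM)].
    apply RInt_ext. intros u [Hu _]. apply Hker. now apply Hseg.
  - unfold kE, sKE. rewrite Hcr. simpl fst.
    etransitivity; [| exact (RInt_scal (V := R_CompleteNormedModule) (fun u => u * sKerM c u x)
      rho q (2 * sqrt 2 * e ^ 9) HexE)].
    apply RInt_ext. intros u [Hu _]. unfold kernelE. rewrite Hker by now apply Hseg.
    unfold scal; simpl; unfold mult; simpl. ring.
Qed.

(** Multiplied by c and by 2 c^3 these are the derivatives of rho and m.  The powers of c
    combine to the single small factor sqrt c = [e]. *)
Lemma scaled_flow e q dq y rho m :
  0 < e -> 0 < q -> 0 < y -> 0 < rho -> 0 < m ->
  let c := e * e in let x : plane := (rho, m) in
  let r := rho / c in let M := m / (2 * c ^ 3) in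
  sH c q x <> 0 -> sD c q x <> 0 ->
  horizon q r M <> 0 /\
  slope_det c q r M (kM c q r M) (kE c q r M) <> 0 /\
  flow_r c q dq y r M (kM c q r M) (kE c q r M)
  = e * (sqrt q / y * coef_r1 c q x + dq / sqrt q * coef_r2 c q x) / c /\
  flow_M c q dq y r M (kM c q r M) (kE c q r M)
  = e * (sqrt q / y * coef_M1 c q x + dq / sqrt q * coef_M2 c q x) / (2 * c ^ 3).
Proof.
  intros He Hq Hy Hr Hm c x r M HH HD.
  destruct (scaled_quantities e q rho m He Hq Hr Hm) as (Q1 & Q2 & Q3 & Q4 & Q5 & Q6).
  fold c x r M in Q1, Q2, Q3, Q4, Q5, Q6.
  assert (Hc : 0 < c) by (unfold c; nra).
  assert (Hse : sqrt c = e) by (unfold c; apply sqrt_square; lra).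
  assert (H2 := Rlt_sqrt2_0).
  assert (Hsq := sqrt_lt_R0 q Hq). assert (Hss : q = sqrt q * sqrt q) by (rewrite sqrt_sqrt; lra).
  assert (HP : 0 < sP c q x).
  { apply sqrt_lt_R0. unfold sY, x; simpl. assert (0 < c * (rho * rho) * q); [|lra].
    repeat apply Rmult_lt_0_compat; auto. }
  assert (EH : sH c q x = sP c q x - e * sqrt q * sL c q x).
  { unfold sH. rewrite Hse. ring. }
  assert (ED : sD c q x = sPhi c q x - c * rho * q * sKM c q x).
  { unfold sD, sPhi. rewrite Hse. unfold x, c; simpl. ring. }
  assert (F1 : horizon q r M = sH c q x / (sqrt q * e ^ 3)).
  { unfold horizon. rewrite Q3, Q4, EH. unfold c. field. split; lra. }
  assert (F2 : slopeG q r M (kM c q r M) = e ^ 6 * sKM c q x * sP c q x / sqrt q).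
  { unfold slopeG. rewrite Q1, Q5. field. repeat split; lra. }
  assert (F3 : slopeF c q r M (kE c q r M) = c * sP c q x * sPhi c q x / sqrt q).
  { unfold slopeF. rewrite Q1, Q2, Q6. unfold sPhi, r. unfold x, c; simpl. field.
    fold c x. repeat split; lra. }
  assert (F4 : slope_det c q r M (kM c q r M) (kE c q r M) = - c * sP c q x * sD c q x / sqrt q).
  { unfold slope_det. rewrite F2, F3, ED. unfold r, c. field. split; lra. }
  assert (He3 : e ^ 3 <> 0) by (apply pow_nonzero; lra).
  split; [|split; [|split]].
  - rewrite F1. apply Rmult_integral_contrapositive_currified; auto.
    apply Rinv_neq_0_compat, Rmult_integral_contrapositive_currified; lra.
  - rewrite F4. repeat apply Rmult_integral_contrapositive_currified; auto; try lra.
    apply Rinv_neq_0_compat; lra.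
  - unfold flow_r. rewrite F1, F2, F4, Q3, Q4. unfold coef_r1, coef_r2.
    set (H := sH c q x) in *. set (D := sD c q x) in *. set (p := sP c q x) in *.
    set (l := sL c q x) in *. set (k := sKM c q x) in *. set (s := sqrt q) in *.
    replace (snd x) with m by reflexivity. unfold M, c. rewrite Hss.
    field. repeat split; auto; lra.
  - unfold flow_M. rewrite F1, F3, F4, Q3, Q4. unfold coef_M1, coef_M2.
    set (H := sH c q x) in *. set (D := sD c q x) in *. set (p := sP c q x) in *.
    set (l := sL c q x) in *. set (f := sPhi c q x) in *. set (s := sqrt q) in *.
    replace (snd x) with m by reflexivity. replace (fst x) with rho by reflexivity.
    unfold M, r, c. rewrite Hss.
    field. repeat split; auto; lra.
Qed.

(** * The solution on the half-line and the theorem *)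

Definition scaled_field (Om c z : R) (x : plane) : plane :=
  let q := areal Om z in
  let a := sqrt q / (1 + z) in
  let d := areal_slope Om (1 + z) q / sqrt q in
  (sqrt c * (a * coef_r1 c q x + d * coef_r2 c q x),
   sqrt c * (a * coef_M1 c q x + d * coef_M2 c q x)).

Lemma norm_pair_le (a b D : R) :
  Rabs a <= D -> Rabs b <= D -> norm ((a, b) : plane) <= 2 * D.
Proof.
  intros Ha Hb.
  eapply Rle_trans; [apply (@norm_prod R_AbsRing R_NormedModule R_NormedModule) |].
  assert (Hs : sqrt 2 <= 2).
  { rewrite <- (sqrt_square 2) at 2 by lra. apply sqrt_le_1_alt; lra. }
  assert (Hm : Rmax (Rabs a) (Rabs b) <= D) by now apply Rmax_lub.
  assert (H0 : 0 <= Rmax (Rabs a) (Rabs b)).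
  { eapply Rle_trans; [apply Rabs_pos | apply Rmax_l]. }
  pose proof (sqrt_pos 2). apply Rmult_le_compat; auto.
Qed.

Lemma lincomb_le a d u v K w :
  Rabs a <= w -> Rabs d <= w -> Rabs u <= K -> Rabs v <= K -> Rabs (a * u + d * v) <= 2 * (w * K).
Proof.
  intros. eapply Rle_trans; [apply Rabs_triang |]. rewrite !Rabs_mult.
  assert (Rabs a * Rabs u <= w * K) by (apply Rmult_le_compat; auto using Rabs_pos).
  assert (Rabs d * Rabs v <= w * K) by (apply Rmult_le_compat; auto using Rabs_pos).
  lra.
Qed.

Lemma tame_bound4 b B T f1 f2 f3 f4 :
  tame b B T f1 -> tame b B T f2 -> tame b B T f3 -> tame b B T f4 ->
  exists K c0, 0 < K /\ 0 < c0 /\ forall f, f = f1 \/ f = f2 \/ f = f3 \/ f = f4 ->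
    forall c q x, 0 < c < c0 -> 0 < q < T -> box b B x ->
      Rabs (f c q x) <= K /\
      (forall y, box b B y -> Rabs (f c q x - f c q y) <= K * gap x y) /\
      continuous (fun u => f c u x) q.
Proof.
  intros [C1 [c1 [P1 [Q1 H1]]]] [C2 [c2 [P2 [Q2 H2]]]]
    [C3 [c3 [P3 [Q3 H3]]]] [C4 [c4 [P4 [Q4 H4]]]].
  exists (C1 + C2 + C3 + C4), (Rmin (Rmin c1 c2) (Rmin c3 c4)).
  split; [lra | split; [now repeat apply Rmin_glb_lt |]].
  intros f Hf c q x Hc Hq Hx.
  pose proof (Rmin_l (Rmin c1 c2) (Rmin c3 c4)). pose proof (Rmin_r (Rmin c1 c2) (Rmin c3 c4)).
  pose proof (Rmin_l c1 c2). pose proof (Rmin_r c1 c2).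
  pose proof (Rmin_l c3 c4). pose proof (Rmin_r c3 c4).
  assert (W : forall C, C <= C1 + C2 + C3 + C4 ->
    (Rabs (f c q x) <= C /\
      (forall y, box b B y -> Rabs (f c q x - f c q y) <= C * gap x y) /\
      continuous (fun u => f c u x) q) ->
    (Rabs (f c q x) <= C1 + C2 + C3 + C4 /\
      (forall y, box b B y -> Rabs (f c q x - f c q y) <= (C1 + C2 + C3 + C4) * gap x y) /\
      continuous (fun u => f c u x) q)).
  { intros C HC [A1 [A2 A3]]. split; [lra | split; [|auto]].
    intros y Hy. apply Rle_trans with (1 := A2 y Hy). apply Rmult_le_compat_r; auto using gap_pos. }
  destruct Hf as [-> | [-> | [-> | ->]]].
  - apply (W C1); [lra | apply H1; auto; lra].
  - apply (W C2); [lra | apply H2; auto; lra].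
  - apply (W C3); [lra | apply H3; auto; lra].
  - apply (W C4); [lra | apply H4; auto; lra].
Qed.

Lemma continuous_areal_slope Om z : 0 <= Om < 1 -> 0 < z ->
  continuous (fun s => areal_slope Om (1 + s) (areal Om s)) z.
Proof.
  intros HOm Hz. unfold areal_slope.
  assert (Ha : continuous (areal Om) z).
  { apply @ex_derive_continuous. eexists. apply is_derive_areal; auto; lra. }
  assert (H1 : continuous (fun s => 1 + s) z).
  { apply @ex_derive_continuous. auto_derive. easy. }
  apply @continuous_mult.
  - apply @continuous_minus; auto.
    apply (continuous_comp (fun s => 1 + s) (calI Om)); auto. apply continuous_calI; auto; lra.
  - apply continuous_Rinv_comp; auto. lra.
Qed.

Lemma is_derive_pair_fst (X : R -> plane) z (d : plane) :
  is_derive X z d -> is_derive (fun s => fst (X s)) z (fst d).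
Proof.
  intros H.
  refine (filterdiff_comp' (V := prod_NormedModule R_AbsRing R_NormedModule R_NormedModule)
    (W := R_NormedModule) X fst z (fun h : R => scal h d) fst H _).
  apply filterdiff_linear, (is_linear_fst (U := R_NormedModule) (V := R_NormedModule)).
Qed.

Lemma is_derive_pair_snd (X : R -> plane) z (d : plane) :
  is_derive X z d -> is_derive (fun s => snd (X s)) z (snd d).
Proof.
  intros H.
  refine (filterdiff_comp' (V := prod_NormedModule R_AbsRing R_NormedModule R_NormedModule)
    (W := R_NormedModule) X snd z (fun h : R => scal h d) snd H _).
  apply filterdiff_linear, (is_linear_snd (U := R_NormedModule) (V := R_NormedModule)).
Qed.

Lemma continuous_pair (f g : R -> R) z :
  continuous f z -> continuous g z -> continuous (fun s => (f s, g s) : plane) z.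
Proof.
  intros Hf Hg. apply continuous_norm_iff. intros eps He.
  assert (H1 := proj1 (continuous_norm_iff R_CompleteNormedModule f z) Hf (eps / 4) ltac:(lra)).
  assert (H2 := proj1 (continuous_norm_iff R_CompleteNormedModule g z) Hg (eps / 4) ltac:(lra)).
  generalize (filter_and _ _ H1 H2). apply filter_imp. intros u [A B].
  apply Rle_lt_trans with (2 * (eps / 4)); [| lra].
  apply norm_pair_le; left; [exact A | exact B].
Qed.

(** The radius is half the smaller initial coordinate, so that rho and m stay
    positive.  Then c is fixed, small enough for all bounds to hold, for the
    denominators to stay away from 0, and for the factor sqrt c to absorb the
    bounds. *)
Lemma scaled_field_contracting Om z0 :
  0 <= Om < 1 -> 0 < z0 ->
  exists (c b B rad : R) (g : R -> R), 0 < c /\ 0 < b /\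
    (forall x, norm (minus x ((areal Om z0, areal Om z0 ^ 3) : plane)) <= rad -> box b B x) /\
    (forall q x, 0 < q < 1 -> box b B x -> sH c q x <> 0 /\ sD c q x <> 0) /\
    contracting (fun z => 0 < z) g z0 ((areal Om z0, areal Om z0 ^ 3) : plane) rad
      (scaled_field Om c).
Proof.
  intros HOm Hz0.
  destruct (areal_bounds Om z0 HOm Hz0) as [Hlow [Hup _]].
  set (q0 := areal Om z0) in *.
  assert (Hq0 : 0 < q0).
  { apply Rlt_le_trans with (2 := Hlow). apply Rdiv_lt_0_compat; [auto | apply pow_lt; lra]. }
  assert (Hq3 : 0 < q0 ^ 3) by now apply pow_lt.
  pose (rad := Rmin q0 (q0 ^ 3) / 2).
  pose proof (Rmin_l q0 (q0 ^ 3)) as R1. pose proof (Rmin_r q0 (q0 ^ 3)) as R2.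
  assert (Hrad : 0 < rad).
  { unfold rad. assert (0 < Rmin q0 (q0 ^ 3)) by now apply Rmin_glb_lt. lra. }
  pose (B := q0 + q0 ^ 3 + rad). pose (T := B + 1).
  assert (HBT : B < T) by (unfold T; lra). assert (HT : 1 <= T) by (unfold T, B; lra).
  set (x0 := (q0, q0 ^ 3) : plane).
  assert (Hbox : forall x, norm (minus x x0) <= rad -> box rad B x).
  { intros x Hx. fold (gap x x0) in Hx.
    pose proof (gap_fst x x0) as G1. pose proof (gap_snd x x0) as G2. simpl in G1, G2.
    assert (K1 : Rabs (fst x - q0) <= rad) by lra. assert (K2 : Rabs (snd x - q0 ^ 3) <= rad) by (simpl; lra).
    apply Rabs_le_between in K1, K2. unfold box, B, rad in *. split; split; lra. }
  destruct (tame_coefs rad B T Hrad HBT) as (T1 & T2 & T3 & T4).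
  destruct (tame_bound4 rad B T _ _ _ _ T1 T2 T3 T4) as (K & c1 & HK & Hc1 & Htame).
  destruct (away_sH rad B T Hrad) as (k2 & c2 & Hk2 & Hc2 & HaH).
  destruct (away_sD rad B T Hrad HBT) as (k3 & c3 & Hk3 & Hc3 & HaD).
  destruct (areal_weights Om HOm) as (Cw & HCw & Hw).
  (* With |coef| <= K and weights <= Cw w, w = time_weight, the field is at most
     4 sqrt c Cw K w.  It has to be below rad * w / 8 and (w / 8)-Lipschitz; the
     factor 1/8 brings the total weight, at most 4 / 8, down to 1/2. *)
  pose (e := Rmin 1 rad / (32 * (Cw * K))).
  assert (HCK : 0 < Cw * K) by now apply Rmult_lt_0_compat.
  assert (He : 0 < e).
  { unfold e. apply Rdiv_lt_0_compat; [apply Rmin_glb_lt; lra | lra]. }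
  pose (c := Rmin (e ^ 2) (Rmin c1 (Rmin c2 c3)) / 2).
  assert (Hc0 : 0 < Rmin (e ^ 2) (Rmin c1 (Rmin c2 c3))).
  { repeat apply Rmin_glb_lt; auto. now apply pow_lt. }
  pose proof (Rmin_l (e ^ 2) (Rmin c1 (Rmin c2 c3))). pose proof (Rmin_r (e ^ 2) (Rmin c1 (Rmin c2 c3))).
  pose proof (Rmin_l c1 (Rmin c2 c3)). pose proof (Rmin_r c1 (Rmin c2 c3)).
  pose proof (Rmin_l c2 c3). pose proof (Rmin_r c2 c3).
  assert (Hc : 0 < c) by (unfold c; lra).
  assert (Hcc : c < c1 /\ c < c2 /\ c < c3 /\ c <= e ^ 2) by (unfold c; lra).
  destruct Hcc as (Hcc1 & Hcc2 & Hcc3 & Hcce).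
  assert (Hsc : sqrt c * (32 * (Cw * K)) <= Rmin 1 rad).
  { assert (Hs : sqrt c <= e).
    { rewrite <- (sqrt_pow2 e) by lra. now apply sqrt_le_1_alt. }
    apply Rle_trans with (e * (32 * (Cw * K))); [apply Rmult_le_compat_r; lra |].
    right. unfold e. field. lra. }
  pose proof (Rmin_l 1 rad). pose proof (Rmin_r 1 rad). pose proof (sqrt_pos c) as Hs0.
  assert (Htw : forall z, 0 < z -> 0 < time_weight z).
  { intros z Hz. apply Rinv_0_lt_compat, Rmult_lt_0_compat; [lra | now apply sqrt_lt_R0]. }
  assert (Hq : forall z, 0 < z -> 0 < areal Om z < T /\ areal Om z < 1).
  { intros z Hz. destruct (areal_bounds Om z HOm Hz) as [L [U _]].
    assert (0 < z / (1 + z) ^ 2) by (apply Rdiv_lt_0_compat; [auto | apply pow_lt; lra]). lra. }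
  assert (Hcoef : forall z, 0 < z ->
    Rabs (sqrt (areal Om z) / (1 + z)) <= Cw * time_weight z /\
    Rabs (areal_slope Om (1 + z) (areal Om z) / sqrt (areal Om z)) <= Cw * time_weight z).
  { intros z Hz. destruct (Hw z Hz) as [W1 W2]. destruct (Hq z Hz) as [[Q1 _] _].
    pose proof (sqrt_lt_R0 _ Q1). split.
    - rewrite Rabs_pos_eq; auto. left. apply Rdiv_lt_0_compat; lra.
    - rewrite Rabs_div by lra. now rewrite (Rabs_pos_eq (sqrt _)) by lra. }
  exists c, rad, B, rad, (fun z => / 8 * time_weight z).
  split; [exact Hc | split; [exact Hrad | split; [exact Hbox | split]]].
  { intros q x Hq1 Hx. specialize (HaH c q x ltac:(lra) ltac:(lra) Hx).
    specialize (HaD c q x ltac:(lra) ltac:(lra) Hx). split; lra. }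
  split.
  - split; [intros z Hz; now apply locally_pos | intros; lra].
  - exact Hz0.
  - exact Hrad.
  - intros z Hz. split; [|split].
    + apply @continuous_mult; [apply continuous_const | now apply continuous_time_weight].
    + specialize (Htw z Hz). lra.
    + assert (Hi : ex_RInt time_weight z0 z).
      { apply @ex_RInt_continuous. intros s [Hs _]. apply continuous_time_weight.
        now apply (between_pos z0 z). }
      apply Rle_trans with (Rabs (scal (/ 8) (RInt time_weight z0 z)));
        [right; apply (f_equal Rabs); exact (RInt_scal (V := R_CompleteNormedModule) time_weight z0 z (/ 8) Hi) |].
      unfold scal; simpl; unfold mult; simpl. rewrite Rabs_mult, (Rabs_pos_eq (/ 8)) by lra.
      pose proof (RInt_time_weight z0 z Hz0 Hz). lra.
  - intros z x Hz Hx. destruct (Hq z Hz) as [Hqz _]. destruct (Hcoef z Hz) as [W1 W2].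
    assert (Hcc : 0 < c < c1) by lra. pose proof (Hbox x Hx) as Bx. specialize (Htw z Hz).
    assert (Hb : forall f1 f2, (f1 = coef_r1 /\ f2 = coef_r2) \/ (f1 = coef_M1 /\ f2 = coef_M2) ->
      Rabs (sqrt c * (sqrt (areal Om z) / (1 + z) * f1 c (areal Om z) x
        + areal_slope Om (1 + z) (areal Om z) / sqrt (areal Om z) * f2 c (areal Om z) x))
      <= sqrt c * (2 * (Cw * time_weight z * K))).
    { intros f1 f2 Hf. rewrite Rabs_mult, (Rabs_pos_eq (sqrt c)) by lra.
      apply Rmult_le_compat_l; [lra |]. apply lincomb_le; auto; apply Htame; auto; tauto. }
    eapply Rle_trans; [apply norm_pair_le; apply Hb; auto |].
    replace (2 * (sqrt c * (2 * (Cw * time_weight z * K))))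
      with (sqrt c * (32 * (Cw * K)) * (/ 8 * time_weight z)) by field.
    apply Rmult_le_compat_r; lra.
  - intros z x y Hz Hx Hy. destruct (Hq z Hz) as [Hqz _]. destruct (Hcoef z Hz) as [W1 W2].
    assert (Hcc : 0 < c < c1) by lra. pose proof (Hbox x Hx) as Bx. pose proof (Hbox y Hy) as By.
    specialize (Htw z Hz). fold (gap x y). pose proof (gap_pos x y) as Hg.
    assert (Hb : forall f1 f2, (f1 = coef_r1 /\ f2 = coef_r2) \/ (f1 = coef_M1 /\ f2 = coef_M2) ->
      let F u := sqrt c * (sqrt (areal Om z) / (1 + z) * f1 c (areal Om z) u
        + areal_slope Om (1 + z) (areal Om z) / sqrt (areal Om z) * f2 c (areal Om z) u) in
      Rabs (F x - F y) <= sqrt c * (2 * (Cw * time_weight z * (K * gap x y)))).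
    { intros f1 f2 Hf F.
      replace (F x - F y) with (sqrt c * (sqrt (areal Om z) / (1 + z)
          * (f1 c (areal Om z) x - f1 c (areal Om z) y)
        + areal_slope Om (1 + z) (areal Om z) / sqrt (areal Om z)
          * (f2 c (areal Om z) x - f2 c (areal Om z) y))) by (unfold F; ring).
      rewrite Rabs_mult, (Rabs_pos_eq (sqrt c)) by lra.
      apply Rmult_le_compat_l; [lra |]. apply lincomb_le; auto; apply Htame; auto; tauto. }
    eapply Rle_trans; [apply (norm_pair_le (_ - _) (_ - _)); apply Hb; auto |].
    replace (2 * (sqrt c * (2 * (Cw * time_weight z * (K * gap x y)))))
      with (sqrt c * (32 * (Cw * K)) * (gap x y * (/ 8 * time_weight z))) by field.
    rewrite <- (Rmult_1_l (gap x y * _)) at 2.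
    apply Rmult_le_compat_r; [| lra]. apply Rmult_le_pos; lra.
  - intros z x Hz Hx. destruct (Hq z Hz) as [Hqz _].
    assert (Hcc : 0 < c < c1) by lra. pose proof (Hbox x Hx) as Bx.
    assert (Ca : continuous (areal Om) z).
    { apply @ex_derive_continuous. eexists. apply is_derive_areal; auto; lra. }
    assert (Csq : continuous (fun s => sqrt (areal Om s)) z).
    { apply (continuous_comp (areal Om) sqrt); [exact Ca | apply continuous_sqrt]. }
    pose proof (sqrt_lt_R0 _ (proj1 Hqz)) as Hsq.
    assert (C1 : continuous (fun s => sqrt (areal Om s) / (1 + s)) z).
    { apply @continuous_mult; [exact Csq |]. apply continuous_Rinv_comp; [| lra].
      apply @ex_derive_continuous. auto_derive. easy. }
    assert (C2 : continuous (fun s => areal_slope Om (1 + s) (areal Om s) / sqrt (areal Om s)) z).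
    { apply @continuous_mult; [now apply continuous_areal_slope |].
      apply continuous_Rinv_comp; [exact Csq | lra]. }
    assert (Cf : forall f, f = coef_r1 \/ f = coef_r2 \/ f = coef_M1 \/ f = coef_M2 ->
      continuous (fun s => f c (areal Om s) x) z).
    { intros f Hf. apply (continuous_comp (areal Om) (fun u => f c u x)); [exact Ca |].
      apply (Htame f Hf c (areal Om z) x); auto. }
    apply continuous_pair;
      (apply @continuous_mult; [apply continuous_const |]);
      (apply @continuous_plus; apply @continuous_mult; auto).
Qed.

Lemma continuous_flow_t (a d r M : R -> R) z :
  continuous a z -> continuous d z -> continuous r z -> continuous M z ->
  a z <> 0 -> horizon (a z) (r z) (M z) <> 0 ->
  continuous (fun s => flow_t (a s) (d s) (r s) (M s)) z.
Proof.
  intros Ha Hd Hr HM Ha0 Hh. unfold flow_t.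
  assert (Hr2 : continuous (fun s => 2 * half_sq (r s)) z).
  { apply (continuous_comp r (fun u => 2 * half_sq u)); [exact Hr |].
    apply @ex_derive_continuous. unfold half_sq. auto_derive. easy. }
  apply @continuous_mult; [exact Hd |]. apply continuous_Rinv_comp; [| exact Hh].
  apply @continuous_minus.
  - apply (continuous_comp (fun s => 2 * half_sq (r s) + 2 * M s / a s) sqrt);
      [| apply continuous_sqrt].
    apply @continuous_plus; [exact Hr2 |]. apply @continuous_mult.
    + apply @continuous_mult; [apply continuous_const | exact HM].
    + now apply continuous_Rinv_comp.
  - apply (continuous_comp (fun s => 1 + 2 * half_sq (r s)) sqrt); [| apply continuous_sqrt].
    apply @continuous_plus; [apply continuous_const | exact Hr2].
Qed.

(** The Picard solution of the planar equation is rescaled back to (r, M), and t is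
    obtained by a quadrature. *)
Lemma global_solution Om z0 :
  0 <= Om < 1 -> 0 < z0 ->
  exists c, 0 < c /\ exists X : R -> state,
    X z0 = State (areal Om z0 / c) (sqrt 2 * kc c) ((areal Om z0 / c) ^ 3 / 2) /\
    forall R0, (forall r, R0 r = c * r) -> forall z, 0 < z ->
      solves_at Om c half_sq R0 X z /\ 0 < sr (X z) /\ 0 < sM (X z).
Proof.
  intros HOm Hz0.
  destruct (scaled_field_contracting Om z0 HOm Hz0)
    as (c & b & B & rad & g & Hc & Hb & Hbox & Hnz & Hctr).
  destruct (picard plane _ g z0 _ rad _ Hctr) as (x & Hx0 & Hx).
  set (q0 := areal Om z0) in *.
  pose (r z := fst (x z) / c). pose (M z := snd (x z) / (2 * c ^ 3)).
  assert (Hc3 : 0 < 2 * c ^ 3) by (apply Rmult_lt_0_compat; [lra | now apply pow_lt]).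
  assert (Hpos : forall z, 0 < z -> 0 < fst (x z) /\ 0 < snd (x z)).
  { intros z Hz. destruct (Hbox _ (proj1 (Hx z Hz))). lra. }
  assert (Hq : forall z, 0 < z -> 0 < areal Om z < 1).
  { intros z Hz. destruct (areal_bounds Om z HOm Hz) as [L [U _]].
    assert (0 < z / (1 + z) ^ 2) by (apply Rdiv_lt_0_compat; [auto | apply pow_lt; lra]). lra. }
  assert (Hrp : forall z, 0 < z -> 0 < r z /\ 0 < M z).
  { intros z Hz. destruct (Hpos z Hz). split; apply Rdiv_lt_0_compat; auto. }
  assert (Hcs : sqrt c * sqrt c = c) by (apply sqrt_sqrt; lra).
  assert (Hflow : forall z, 0 < z ->
    horizon (areal Om z) (r z) (M z) <> 0 /\
    slope_det c (areal Om z) (r z) (M z)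
      (kM c (areal Om z) (r z) (M z)) (kE c (areal Om z) (r z) (M z)) <> 0 /\
    is_derive r z (flow_r c (areal Om z) (areal_slope Om (1 + z) (areal Om z)) (1 + z) (r z) (M z)
      (kM c (areal Om z) (r z) (M z)) (kE c (areal Om z) (r z) (M z))) /\
    is_derive M z (flow_M c (areal Om z) (areal_slope Om (1 + z) (areal Om z)) (1 + z) (r z) (M z)
      (kM c (areal Om z) (r z) (M z)) (kE c (areal Om z) (r z) (M z)))).
  { intros z Hz. destruct (Hx z Hz) as [Hn Hd]. destruct (Hpos z Hz) as [P1 P2].
    destruct (Hnz (areal Om z) (x z) (Hq z Hz) (Hbox _ Hn)) as [N1 N2].
    assert (S := scaled_flow (sqrt c) (areal Om z) (areal_slope Om (1 + z) (areal Om z)) (1 + z)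
      (fst (x z)) (snd (x z)) (sqrt_lt_R0 c Hc) (proj1 (Hq z Hz)) ltac:(lra) P1 P2).
    cbv zeta in S. rewrite Hcs in S. rewrite <- surjective_pairing in S.
    fold (r z) in S. fold (M z) in S. destruct (S N1 N2) as (S1 & S2 & S3 & S4).
    split; [exact S1 | split; [exact S2 | split]].
    - rewrite S3.
      apply (is_derive_ext (fun s => / c * fst (x s))); [intros; unfold r, Rdiv; apply Rmult_comm |].
      evar_last; [apply (is_derive_scal (fun s => fst (x s)) z (/ c)), (is_derive_pair_fst x z _ Hd) |].
      unfold scaled_field; simpl. unfold Rdiv; ring.
    - rewrite S4.
      apply (is_derive_ext (fun s => / (2 * c ^ 3) * snd (x s))); [intros; unfold M, Rdiv; apply Rmult_comm |].
      evar_last; [apply (is_derive_scal (fun s => snd (x s)) z (/ (2 * c ^ 3))), (is_derive_pair_snd x z _ Hd) |].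
      unfold scaled_field; simpl. unfold Rdiv; ring. }
  pose (tdot s := flow_t (areal Om s) (areal_slope Om (1 + s) (areal Om s)) (r s) (M s)).
  assert (Htdot : forall z, 0 < z -> continuous tdot z).
  { intros z Hz. destruct (Hflow z Hz) as (H1 & _ & H3 & H4).
    apply continuous_flow_t; auto.
    - apply @ex_derive_continuous. eexists. apply is_derive_areal; auto; lra.
    - now apply continuous_areal_slope.
    - apply @ex_derive_continuous. eexists; exact H3.
    - apply @ex_derive_continuous. eexists; exact H4.
    - apply Rgt_not_eq, (Hq z Hz). }
  pose (t z := sqrt 2 * kc c + RInt tdot z0 z).
  assert (Ht : forall z, 0 < z -> is_derive t z (tdot z)).
  { intros z Hz. unfold t. rewrite <- (Rplus_0_l (tdot z)).
    apply @is_derive_plus; [apply @is_derive_const |].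
    apply (is_derive_RInt tdot _ z0); [| now apply Htdot].
    generalize (locally_pos z Hz). apply filter_imp. intros u Hu.
    apply (@RInt_correct R_CompleteNormedModule). apply @ex_RInt_continuous.
    intros s [Hs _]. apply Htdot. now apply (between_pos z0 u). }
  exists c. split; [exact Hc |]. exists (fun z => State (r z) (t z) (M z)). split.
  - unfold r, M, t. rewrite Hx0, RInt_point. simpl fst. simpl snd.
    f_equal; [apply Rplus_0_r |]. field. lra.
  - intros R0 HR z Hz. destruct (Hflow z Hz) as (H1 & H2 & H3 & H4).
    destruct (Hrp z Hz) as [Hr HM]. destruct (Hq z Hz) as [Hq0 _].
    assert (HDa := is_derive_areal Om z HOm ltac:(lra)).
    split; [| split; assumption].
    split; [| split; [| split]].
    + pose proof (half_sq_pos (r z) Hr).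
      unfold admissible; cbn [sr sM]. rewrite den1_eq, den2_eq by auto. cbn [sr sM].
      split; [exact Hq0 |]. split; [rewrite HR; now apply Rmult_lt_0_compat |].
      split; [lra |]. split; [| split; assumption].
      intros tau [Htau _]. apply lin_pos; auto. apply (between_pos (R0 (r z)) (areal Om z)); auto.
      rewrite HR; now apply Rmult_lt_0_compat.
    + rewrite rhs_r_eq, (is_derive_unique _ _ _ HDa) by auto. exact H3.
    + rewrite rhs_t_eq, (is_derive_unique _ _ _ HDa). exact (Ht z Hz).
    + rewrite rhs_M_eq, (is_derive_unique _ _ _ HDa) by auto. exact H4.
Qed.

Lemma smooth_scale c : smooth (fun r => c * r).
Proof.
  intros n x. apply ex_derive_n_scal_l. destruct n as [|[|n]].
  - exact I.
  - simpl. auto_derive. easy.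
  - apply (ex_derive_n_ext (fun y => y ^ 1)); [intros; ring |]. apply ex_derive_n_pow.
Qed.

Lemma continuous_limit_eq (f g : R -> R) z :
  continuous f z -> continuous g z ->
  (forall Q, locally z Q -> exists u, Q u /\ f u = g u) -> f z = g z.
Proof.
  intros Hf Hg Hacc. apply Classical_Prop.NNPP. intros Hne.
  assert (Hc : continuous (fun s => f s - g s) z) by (apply @continuous_minus; auto).
  assert (Hl : locally (f z - g z) (fun v => v <> 0)).
  { apply locally_Rabs. exists (Rabs (f z - g z)). split; [apply Rabs_pos_lt; lra |].
    intros u Hu ->. rewrite Rminus_0_l, Rabs_Ropp in Hu. lra. }
  destruct (Hacc _ (Hc _ Hl)) as [u [Hu Heq]]. apply Hu. lra.
Qed.

Lemma Rbar_interval_open (a b : Rbar) :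
  is_open_interval (fun z => Rbar_lt a z /\ Rbar_lt z b).
Proof.
  split.
  - intros z [Ha Hb]. apply filter_and; [exact (open_Rbar_gt' z a Ha) | exact (open_Rbar_lt' z b Hb)].
  - intros x y z [Ha _] [_ Hb] [Hx Hy]. split.
    + apply Rbar_lt_le_trans with x; auto.
    + apply Rbar_le_lt_trans with y; auto.
Qed.

Theorem theorem5 (z0 Om : R) (hz0 : 0 < z0) (hOm : 0 <= Om < 1) :
  exists (R0 : R -> R) (c : R),
    smooth R0 /\ 0 < c /\ (forall r, R0 r = c * r) /\
    let E := fun r : R => r ^ 2 / 2 in
    let M := fun r : R => r ^ 3 / 2 in
    let r0 := areal Om z0 / c in
    let X0 := State r0 (sqrt 2 * kc c) (M r0) in
    exists X : R -> state,
      (* the solution extends to (0, infinity) and is real-analytic there *)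
      solves_ivp Om c E R0 z0 X0 0 p_infty X /\
      analytic_pos X /\
      (* X extends every solution of the initial value problem *)
      (forall (a b : Rbar) (Y : R -> state),
         Rbar_le 0 a -> Rbar_lt a z0 -> Rbar_lt z0 b ->
         solves_ivp Om c E R0 z0 X0 a b Y ->
         forall z : R, Rbar_lt a z -> Rbar_lt z b -> Y z = X z) /\
      (* X is the only analytic function on (0, infinity) extending the solution *)
      (forall Y : R -> state,
         analytic_pos Y ->
         locally z0 (fun z => Y z = X z) ->
         forall z : R, 0 < z -> Y z = X z).
Proof.
  destruct (global_solution Om z0 hOm hz0) as (c & Hc & X & HX0 & HX).
  exists (fun r => c * r), c.
  split; [apply smooth_scale |]. split; [exact Hc |]. split; [reflexivity |].
  intros E M r0 X0. specialize (HX (fun r => c * r) (fun r => eq_refl)).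
  assert (Hloc : forall z, 0 < z -> locally z (solves_at Om c half_sq (fun r => c * r) X)).
  { intros z Hz. generalize (locally_pos z Hz). apply filter_imp. intros u Hu. now apply HX. }
  assert (Han : analytic_pos X).
  { intros z Hz. apply (solution_analytic Om c (fun r => c * r)); auto; now apply HX. }
  exists X. split; [|split; [exact Han | split]].
  - split; [exact HX0 |]. intros z Hz _. now apply HX.
  - intros a b Y Ha Haz Hzb [HY0 HY].
    assert (Hpos : forall z : R, Rbar_lt a z -> 0 < z).
    { intros z Hz. exact (Rbar_le_lt_trans 0 a z Ha Hz). }
    pose (I (z : R) := Rbar_lt a z /\ Rbar_lt z b).
    assert (HI : is_open_interval I) by apply Rbar_interval_open.
    enough (H : forall z, I z -> Y z = X z) by (intros z H1 H2; apply H; now split).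
    apply (interval_connected I (fun z => Y z = X z) z0); auto.
    + now split.
    + now rewrite HY0.
    + intros z Hz Heq. pose proof (Hpos z (proj1 Hz)) as Hz0.
      apply (solution_local_unique Om c (fun r => c * r) X Y z); auto; try (now apply HX).
      generalize (proj1 HI z Hz). apply filter_imp. intros u [H1 H2]. now apply HY.
    + intros z Hz Hacc. pose proof (Hpos z (proj1 Hz)) as Hz0.
      destruct (HY z (proj1 Hz) (proj2 Hz)) as (_ & Yr & Yt & YM).
      destruct (HX z Hz0) as ((_ & Xr & Xt & XM) & _).
      apply state_eq.
      * apply (continuous_limit_eq (fun s => sr (Y s)) (fun s => sr (X s))).
        -- apply @ex_derive_continuous; eexists; exact Yr.
        -- apply @ex_derive_continuous; eexists; exact Xr.
        -- intros Q HQ. destruct (Hacc Q HQ) as [u [Hu Hs]]. exists u; now rewrite Hs.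
      * apply (continuous_limit_eq (fun s => st (Y s)) (fun s => st (X s))).
        -- apply @ex_derive_continuous; eexists; exact Yt.
        -- apply @ex_derive_continuous; eexists; exact Xt.
        -- intros Q HQ. destruct (Hacc Q HQ) as [u [Hu Hs]]. exists u; now rewrite Hs.
      * apply (continuous_limit_eq (fun s => sM (Y s)) (fun s => sM (X s))).
        -- apply @ex_derive_continuous; eexists; exact YM.
        -- apply @ex_derive_continuous; eexists; exact XM.
        -- intros Q HQ. destruct (Hacc Q HQ) as [u [Hu Hs]]. exists u; now rewrite Hs.
  - intros Y HY Heq z Hz. apply state_eq.
    + apply (analytic_identity (fun s => sr (Y s)) (fun s => sr (X s)) z0); auto.
      * intros s Hs; now apply HY.
      * intros s Hs; now apply Han.
      * generalize Heq. apply filter_imp. intros u Hu; now rewrite Hu.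
    + apply (analytic_identity (fun s => st (Y s)) (fun s => st (X s)) z0); auto.
      * intros s Hs; now apply HY.
      * intros s Hs; now apply Han.
      * generalize Heq. apply filter_imp. intros u Hu; now rewrite Hu.
    + apply (analytic_identity (fun s => sM (Y s)) (fun s => sM (X s)) z0); auto.
      * intros s Hs; now apply HY.
      * intros s Hs; now apply Han.
      * generalize Heq. apply filter_imp. intros u Hu; now rewrite Hu.
Qed.
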